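(* Let $g$ be monotone increasing and satisfy hypothesis (H), let $h\ge0$, and assume the equation $u_t=u_{xx}-u+g(u(t-h,x))$ has a pushed traveling front $u=\phi(x+c_*t)$, $c_*>c_\#$. Let $w_0$ satisfy conditions (IC) with constants $A,B>0$, $\sigma\in(0,\kappa)$, $\mu>\lambda_1(c_* )$, and fix $\lambda\in(\lambda_1(c_* ),\lambda_2(c_* ))$ with $\lambda<\mu$. Then the solution $u(t,x)$ of the initial value problem $u_t(t,x)=u_{xx}(t,x)-u(t,x)+g(u(t-h,x))$ ($t>0$, $x\in\mathbb{R}$), $u(s,x)=w_0(s,x)$ ($s\in[-h,0]$), satisfies, for some $s_0\in\mathbb{R}$, $$\lim_{t\to\infty}\sup_{x\in\mathbb{R}}\frac{|u(t,x)-\phi(x+c_*t+s_0)|}{\eta(x+c_*t)}=0.$$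
   Context: Hypothesis (H) on $g:\mathbb{R}_+\to\mathbb{R}_+$: $g(x)=x$ has exactly two nonnegative solutions $0$ and $\kappa>0$; $g$ is $C^1$ in a $\delta_0$-neighbourhood of $0$ and of $\kappa$, with $g'(0)>1$, $g'(\kappa)<1$; $|g(u)-g(v)|\le L_g|u-v|$ for $u,v\in[0,\kappa]$; there are $C>0,\theta\in(0,1]$ with $|g'(u)-g'(0)|+|g'(\kappa)-g'(\kappa-u)|\le Cu^\theta$ for $u\in(0,\delta_0]$; $g$ is extended linearly and $C^1$-smoothly to $(-\infty,0]$ and $[\kappa,\infty)$. Characteristic function $\chi(z,c)=z^2-cz-1+g'(0)e^{-zch}$; $c_\#$ is the unique real $c$ for which $\chi(\cdot,c)$ has a positive double zero; for $c>c_\#$ its two positive simple zeros are $\lambda_1(c)<\lambda_2(c)$. A wavefront is a solution $u=\phi(x+ct)$ with $\phi>0$, $\phi(-\infty)=0$, $\phi(+\infty)=\kappa$; $c_*$ is the minimal wavefront speed and the minimal wavefront is pushed if $c_*>c_\#$. The initial function $w_0:[-h,0]\times\mathbb{R}\to\mathbb{R}$ is continuous and locally Hölder continuous in $x$ uniformly in $s$. Conditions (IC): (IC1) $0\le w_0(s,x)\le\kappa$ for all $x\in\mathbb{R}$, $s\in[-h,0]$; (IC2) $w_0(s,x)\le Ae^{\mu x}$ for all $x$, $s\in[-h,0]$; (IC3) $w_0(s,x)>\kappa-\sigma$ for $s\in[-h,0]$, $x\ge B$. The initial value problem then has a unique classical solution with values in $[0,\kappa]$. $\eta(x)=\min\{e^{\lambda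 x},1\}$. *)

(* Defs.v *)
From Stdlib Require Import Reals.
From Coquelicot Require Import Coquelicot.
Open Scope R_scope.

(* Hypothesis (H) on g : R -> R (g already extended to all of R). *)
Definition hypH (g : R -> R) (kappa : R) : Prop :=
  0 < kappa /\ g 0 = 0 /\ g kappa = kappa /\
  (forall x, 0 <= x -> g x = x -> x = 0 \/ x = kappa) /\
  (exists delta0 : R, 0 < delta0 /\
     (forall x, Rabs x < delta0 ->
        ex_derive g x /\ continuous (Derive g) x) /\
     (forall x, Rabs (x - kappa) < delta0 ->
        ex_derive g x /\ continuous (Derive g) x) /\
     (exists C theta : R, 0 < C /\ 0 < theta <= 1 /\
        forall u, 0 < u <= delta0 ->
          Rabs (Derive g u - Derive g 0) + Rabs (Derive g kappa - Derive g (kappa - u))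
            <= C * Rpower u theta)) /\
  Derive g 0 > 1 /\ Derive g kappa < 1 /\
  (exists Lg : R, forall u v, 0 <= u <= kappa -> 0 <= v <= kappa ->
       Rabs (g u - g v) <= Lg * Rabs (u - v)) /\
  (* linear C^1 extension to (-oo,0] and [kappa,+oo) *)
  (forall x, x <= 0 -> g x = Derive g 0 * x) /\
  (forall x, kappa <= x -> g x = kappa + Derive g kappa * (x - kappa)).

Definition chi (g : R -> R) (h z c : R) : R :=
  z ^ 2 - c * z - 1 + Derive g 0 * exp (- z * c * h).

Definition is_c_sharp (g : R -> R) (h c : R) : Prop :=
  exists z, 0 < z /\ chi g h z c = 0 /\ Derive (fun y => chi g h y c) z = 0.

Definition are_lambdas (g : R -> R) (h c l1 l2 : R) : Prop :=
  0 < l1 /\ l1 < l2 /\ chi g h l1 c = 0 /\ chi g h l2 c = 0 /\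
  Derive (fun y => chi g h y c) l1 <> 0 /\ Derive (fun y => chi g h y c) l2 <> 0 /\
  (forall z, 0 < z -> chi g h z c = 0 -> z = l1 \/ z = l2).

(* u = phi(x + c t) is a wavefront of u_t = u_xx - u + g(u(t-h,x)) *)
Definition is_wavefront (g : R -> R) (h kappa c : R) (phi : R -> R) : Prop :=
  (forall s, 0 < phi s) /\
  is_lim phi m_infty 0 /\ is_lim phi p_infty kappa /\
  (forall s, ex_derive phi s /\ ex_derive (Derive phi) s /\
     Derive_n phi 2 s - c * Derive phi s - phi s + g (phi (s - c * h)) = 0).

Definition is_min_speed (g : R -> R) (h kappa c : R) : Prop :=
  (exists phi, is_wavefront g h kappa c phi) /\
  (forall c' phi, is_wavefront g h kappa c' phi -> c <= c').

Definition initial_regular (h : R) (w0 : R -> R -> R) : Prop :=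
  (forall s x, -h <= s <= 0 -> forall eps, 0 < eps -> exists delta, 0 < delta /\
     forall s' x', -h <= s' <= 0 -> Rabs (s' - s) < delta -> Rabs (x' - x) < delta ->
       Rabs (w0 s' x' - w0 s x) < eps) /\
  (forall M, 0 < M -> exists C alpha, 0 < alpha <= 1 /\
     forall s x y, -h <= s <= 0 -> Rabs x <= M -> Rabs y <= M -> x <> y ->
       Rabs (w0 s x - w0 s y) <= C * Rpower (Rabs (x - y)) alpha).

Definition is_classical_solution (g : R -> R) (h kappa : R) (w0 u : R -> R -> R) : Prop :=
  (forall s x, -h <= s <= 0 -> u s x = w0 s x) /\
  (forall t x, -h <= t -> 0 <= u t x <= kappa) /\
  (forall t x, -h <= t -> forall eps, 0 < eps -> exists delta, 0 < delta /\
     forall t' x', -h <= t' -> Rabs (t' - t) < delta -> Rabs (x' - x) < delta ->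
       Rabs (u t' x' - u t x) < eps) /\
  (forall t x, 0 < t ->
     ex_derive (fun s => u s x) t /\
     ex_derive (fun y => u t y) x /\ ex_derive (Derive (fun y => u t y)) x /\
     Derive (fun s => u s x) t
       = Derive_n (fun y => u t y) 2 x - u t x + g (u (t - h) x)).

Definition eta (lam x : R) : R := Rmin (exp (lam * x)) 1.

(* Main.v *)
(** Minimality of the speed forces [phi] to decay faster than [exp (lam1 z)].  Otherwise, for [lam] between
    [lam1] and [lam2], [min (phi, K exp (lam z))] is a supersolution of the profile equation; one application of
    the wave operator makes it smooth, subtracting a small Gaussian and adding a smaller multiple of [eta] makes
    it strict everywhere, so it remains a supersolution for a slightly smaller speed, and Weinberger's monotone
    iteration started from small seeds below it yields a wavefront of that speed.  With the fast decay, sliding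
    shows that [phi] is increasing, with [phi' > 0] and [phi' = o(eta)] in both tails.

    For the evolution, the Fife-McLeod barriers [phi (z +- p t) +- q exp (- gam t) eta z] show that being
    asymptotically below (above) a translate of [phi], in the norm weighted by [eta], is stable.  Let [s+] and [s-]
    be the best such translates.  If [s- < s+], then at arbitrarily large times [u] stays away from one of them
    at the point [x + c t = 0]; an interior Lipschitz bound and a spreading bump transfer this gap to a long
    interval, while in the tails a small shift of [phi] is absorbed by [eta] because [phi' = o(eta)].  So one of
    the two translates could be improved; hence [s- = s+].  Only maximum principles are used, with test functions
    touching the possibly nonsmooth barriers. *)

Require Import Defs.
From Stdlib Require Import Reals ZArith Lra Lia Classical IndefiniteDescription Cantor.
From Coquelicot Require Import Coquelicot.
Open Scope R_scope.

(** * Calculus and compactness *)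

(** The weight [eta] is dictated by the two equilibria. For [lam] strictly between the roots, [chi]
    is negative, so [exp (lam z)] is a strict supersolution of the linearization at 0; the slope of
    [g] at [kappa] is below 1, so constants are strict supersolutions of the linearization there. In
    a bounded middle zone neither fact helps, and each barrier must find its strictness elsewhere: a
    Gaussian correction for the slower wave, the term [p' phi'] for stability. Since [g] is smooth
    only near 0 and [kappa], the profile equation is never differentiated; [phi'] is controlled
    through increments of [phi]. Factoring [y'' - c y' - y] by its real roots [z1 < 0 < z2] supplies
    bounded solutions, a Harnack inequality and Lipschitz bounds for profiles. For the evolution no
    compactness of orbits is used: a gap is exploited within a finite time, but it must fill a whole
    delay window of length [h] before stability can be restarted. Upper and lower estimates are one
    proof, run for [e u] with [e] equal to 1 or -1. *)

Lemma exp_le x y : x <= y -> exp x <= exp y.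
Proof. intros [h| ->]; [left; apply exp_increasing, h|lra]. Qed.

Lemma exp_ge_1 x : 0 <= x -> 1 <= exp x.
Proof. intro H. rewrite <- exp_0. apply exp_le, H. Qed.

Lemma exp_le_1 x : x <= 0 -> exp x <= 1.
Proof. intro H. rewrite <- exp_0. apply exp_le, H. Qed.

Lemma exp_decay_le_1 a x : 0 <= a -> 0 <= x -> exp (- a * x) <= 1.
Proof. intros Ha Hx. apply exp_le_1. nra. Qed.

Lemma exp_decay_le a x y : 0 <= a -> x <= y -> exp (- a * y) <= exp (- a * x).
Proof. intros Ha Hxy. apply exp_le. nra. Qed.

Lemma Rmult_le_1 a x : 0 <= a -> x <= 1 -> a * x <= a.
Proof. intros Ha Hx. nra. Qed.

Lemma Rmult_nonneg_nonpos a b : 0 <= a -> b <= 0 -> a * b <= 0.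
Proof. intros Ha Hb. nra. Qed.

Lemma is_derive_linear k x : is_derive (fun y => k * y) x (k * 1).
Proof. auto_derive; [trivial|ring]. Qed.

Lemma is_derive_affine (f : R -> R) a b x l : is_derive f (a * x + b) l ->
  is_derive (fun y => f (a * y + b)) x (a * l).
Proof.
  intro H. apply (is_derive_comp f (fun y => a * y + b) x l a H). auto_derive; [trivial|ring].
Qed.

Lemma is_derive_shift (f : R -> R) s x l : is_derive f (x + s) l -> is_derive (fun y => f (y + s)) x l.
Proof.
  intro H. replace l with (1 * l) by ring.
  apply (is_derive_ext (fun y => f (1 * y + s))); [intro y; f_equal; ring|].
  apply is_derive_affine. replace (1 * x + s) with (x + s) by ring. exact H.
Qed.

Lemma is_derive_reflect (f : R -> R) x l : is_derive f (- x) l -> is_derive (fun y => f (- y)) x (- l).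
Proof.
  intro H. replace (- l) with (-1 * l) by ring.
  apply (is_derive_ext (fun y => f (-1 * y + 0))); [intro y; f_equal; ring|].
  apply is_derive_affine. replace (-1 * x + 0) with (- x) by ring. exact H.
Qed.

Lemma is_derive_exp_affine C a b x : is_derive (fun y => C * exp (a * (y - b))) x (C * (a * exp (a * (x - b)))).
Proof. auto_derive; [trivial|]. unfold Rminus. ring. Qed.

Lemma is_derive_continuous (f : R -> R) x l : is_derive f x l -> continuous f x.
Proof. intro H. apply (@ex_derive_continuous R_AbsRing R_NormedModule). exists l; exact H. Qed.

Lemma is_derive_continuity_pt (f : R -> R) x l : is_derive f x l -> continuity_pt f x.
Proof. intro H. apply continuity_pt_filterlim. apply (is_derive_continuous f x l H). Qed.

Lemma is_derive_increment (f : R -> R) x l eps : is_derive f x l -> 0 < eps ->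
  exists d, 0 < d /\ forall y, Rabs (y - x) < d ->
    Rabs (f y - f x - l * (y - x)) <= eps * Rabs (y - x).
Proof.
  intros H He. apply is_derive_Reals in H.
  destruct (H eps He) as [d Hd]. exists d. split; [apply cond_pos|].
  intros y Hy. destruct (Req_dec (y - x) 0) as [E|E].
  - replace y with x by lra. replace (f x - f x - l * (x - x)) with 0 by ring.
    replace (x - x) with 0 by ring. rewrite Rabs_R0. lra.
  - specialize (Hd (y - x) E Hy). replace (x + (y - x)) with y in Hd by ring.
    replace (f y - f x - l * (y - x)) with (((f y - f x) / (y - x) - l) * (y - x)) by (field; exact E).
    rewrite Rabs_mult. apply Rmult_le_compat_r; [apply Rabs_pos|lra].
Qed.

Lemma derive_neg_left (f : R -> R) x l : is_derive f x l -> l < 0 ->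
  exists d, 0 < d /\ forall y, x - d < y < x -> f x < f y.
Proof.
  intros H Hl. destruct (is_derive_increment f x l (- l / 2) H ltac:(lra)) as (d & Hd & K).
  exists d. split; [exact Hd|]. intros y Hy.
  assert (Ha : Rabs (y - x) = x - y) by (rewrite Rabs_left; lra).
  assert (K' := K y ltac:(lra)). rewrite Ha in K'. apply Rabs_le_between in K'. nra.
Qed.

Lemma derive_pos_right (f : R -> R) x l : is_derive f x l -> 0 < l ->
  exists d, 0 < d /\ forall y, x < y < x + d -> f x < f y.
Proof.
  intros H Hl. destruct (is_derive_increment f x l (l / 2) H ltac:(lra)) as (d & Hd & K).
  exists d. split; [exact Hd|]. intros y Hy.
  assert (Ha : Rabs (y - x) = y - x) by (rewrite Rabs_right; lra).
  assert (K' := K y ltac:(lra)). rewrite Ha in K'. apply Rabs_le_between in K'. nra.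
Qed.

Lemma left_max_derive_nonneg (f : R -> R) x l d : is_derive f x l -> 0 < d ->
  (forall y, x - d < y < x -> f y <= f x) -> 0 <= l.
Proof.
  intros H Hd Hm. destruct (Rle_lt_dec 0 l) as [h|h]; [exact h|].
  destruct (derive_neg_left f x l H h) as (d' & Hd' & K).
  pose proof (Rmin_glb_lt _ _ _ Hd Hd'). pose proof (Rmin_l d d'). pose proof (Rmin_r d d').
  specialize (Hm (x - Rmin d d' / 2) ltac:(lra)). specialize (K (x - Rmin d d' / 2) ltac:(lra)). lra.
Qed.

Lemma local_max_derive (f : R -> R) x l d : is_derive f x l -> 0 < d ->
  (forall y, Rabs (y - x) < d -> f y <= f x) -> l = 0.
Proof.
  intros H Hd Hm. apply Rle_antisym.
  - destruct (Rle_lt_dec l 0) as [h|h]; [exact h|].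
    destruct (derive_pos_right f x l H h) as (d' & Hd' & K).
    pose proof (Rmin_glb_lt _ _ _ Hd Hd'). pose proof (Rmin_l d d'). pose proof (Rmin_r d d').
    specialize (K (x + Rmin d d' / 2) ltac:(lra)).
    specialize (Hm (x + Rmin d d' / 2)). rewrite Rabs_right in Hm; [specialize (Hm ltac:(lra)); lra|lra].
  - apply (left_max_derive_nonneg f x l d H Hd). intros y Hy. apply Hm.
    rewrite Rabs_left; lra.
Qed.

Lemma mean_value (f f1 : R -> R) a b : a < b ->
  (forall z, a <= z <= b -> is_derive f z (f1 z)) ->
  exists c, f b - f a = f1 c * (b - a) /\ a < c < b.
Proof.
  intros Hab Hd. apply MVT_cor2; [exact Hab|]. intros c Hc. apply is_derive_Reals, Hd, Hc.
Qed.

Lemma derive_nonneg_le (f f1 : R -> R) a b : a <= b ->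
  (forall z, a <= z <= b -> is_derive f z (f1 z)) ->
  (forall z, a <= z <= b -> 0 <= f1 z) -> f a <= f b.
Proof.
  intros [Hab| ->] Hd Hp; [|lra].
  destruct (mean_value f f1 a b Hab Hd) as (c & E & Hc). specialize (Hp c ltac:(lra)). nra.
Qed.

Lemma derive_pos_lt (f f1 : R -> R) a b : a < b ->
  (forall z, a <= z <= b -> is_derive f z (f1 z)) ->
  (forall z, a < z < b -> 0 < f1 z) -> f a < f b.
Proof.
  intros Hab Hd Hp.
  destruct (mean_value f f1 a b Hab Hd) as (c & E & Hc). specialize (Hp c Hc). nra.
Qed.

Lemma local_max_second_derive (f f1 : R -> R) x l d :
  0 < d -> (forall y, Rabs (y - x) < d -> is_derive f y (f1 y)) -> is_derive f1 x l ->
  (forall y, Rabs (y - x) < d -> f y <= f x) -> f1 x = 0 /\ l <= 0.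
Proof.
  intros Hd Hf Hl Hm.
  assert (E : f1 x = 0).
  { apply (local_max_derive f x (f1 x) d); [apply Hf|exact Hd|exact Hm].
    replace (x - x) with 0 by ring. rewrite Rabs_R0; exact Hd. }
  split; [exact E|]. destruct (Rle_lt_dec l 0) as [h|h]; [exact h|exfalso].
  destruct (derive_pos_right f1 x l Hl h) as (d' & Hd' & K).
  pose proof (Rmin_glb_lt _ _ _ Hd Hd'). pose proof (Rmin_l d d'). pose proof (Rmin_r d d').
  set (m := Rmin d d' / 2) in *.
  assert (f x < f (x + m)).
  { apply (derive_pos_lt f f1); [unfold m; lra| |].
    - intros z Hz. apply Hf. unfold m in Hz. rewrite Rabs_right; lra.
    - intros z Hz. rewrite <- E. apply K. unfold m in Hz. lra. }
  specialize (Hm (x + m)). rewrite Rabs_right in Hm; unfold m in *; [specialize (Hm ltac:(lra)); lra|lra].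
Qed.

(** * Sequential compactness and diagonal extraction *)

Definition tends_to_infinity (s : nat -> nat) := forall N, exists n0, forall n, (n0 <= n)%nat -> (N <= s n)%nat.

Lemma is_lim_seq_tends (u : nat -> R) l s : tends_to_infinity s ->
  is_lim_seq u l -> is_lim_seq (fun n => u (s n)) l.
Proof.
  intros Hs. apply is_lim_seq_subseq. intros P [N HN]. destruct (Hs N) as [n0 H0].
  exists n0. intros n Hn. apply HN, H0, Hn.
Qed.

Lemma tends_to_infinity_comp s1 s2 : tends_to_infinity s1 -> tends_to_infinity s2 ->
  tends_to_infinity (fun n => s1 (s2 n)).
Proof. intros H1 H2 N. destruct (H1 N) as [a Ha]. destruct (H2 a) as [b Hb]. exists b. intros n Hn. apply Ha, Hb, Hn. Qed.

Lemma is_lim_seq_eps (u : nat -> R) (l : R) :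
  is_lim_seq u l <-> forall eps, 0 < eps -> exists N, forall n, (N <= n)%nat -> Rabs (u n - l) < eps.
Proof.
  split; intro H.
  - intros eps He. apply is_lim_seq_spec in H. exact (H (mkposreal eps He)).
  - apply is_lim_seq_spec. intros eps. exact (H eps (cond_pos eps)).
Qed.

Lemma inv_INR_S_pos n : 0 < / (INR n + 1).
Proof. apply Rinv_0_lt_compat. pose proof (pos_INR n). lra. Qed.

Lemma is_lim_seq_inv_S : is_lim_seq (fun n => / (INR n + 1)) 0.
Proof.
  apply (is_lim_seq_ext (fun n => / INR (S n))); [intro n; rewrite S_INR; reflexivity|].
  apply (is_lim_seq_incr_1 (fun n => / INR n)).
  replace (Finite 0) with (Rbar_inv p_infty) by reflexivity.
  apply is_lim_seq_inv; [apply is_lim_seq_INR|discriminate].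
Qed.

Lemma inv_S_small eps : 0 < eps -> exists N, forall n, (N <= n)%nat -> / (INR n + 1) < eps.
Proof.
  intro He. destruct (proj1 (is_lim_seq_eps _ _) is_lim_seq_inv_S eps He) as [N HN].
  exists N. intros n Hn. specialize (HN n Hn). rewrite Rminus_0_r in HN.
  apply Rabs_def2 in HN. lra.
Qed.

Lemma bounded_subsequence (u : nat -> R) a b : (forall n, a <= u n <= b) ->
  exists s l, (forall n, (n <= s n)%nat) /\ (forall m n, (m < n)%nat -> (s m < s n)%nat) /\
    a <= l <= b /\ is_lim_seq (fun n => u (s n)) l.
Proof.
  intro Hu. destruct (Bolzano_Weierstrass u (fun x => a <= x <= b) (compact_P3 a b) Hu) as [l Hl].
  assert (H : forall nN : nat * nat, exists p, (snd nN <= p)%nat /\ Rabs (u p - l) < / (INR (fst nN) + 1)).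
  { intros [n N]. simpl.
    destruct (Hl (disc l (mkposreal _ (inv_INR_S_pos n))) N) as (p & Hp & Hv).
    - exists (mkposreal _ (inv_INR_S_pos n)). intros x Hx; exact Hx.
    - exists p. split; [exact Hp|exact Hv]. }
  apply functional_choice in H. destruct H as [F HF].
  set (s := fix s n := match n with O => F (O, O) | S m => F (S m, S (s m)) end).
  assert (Hs1 : forall n, (s n < s (S n))%nat).
  { intro n. simpl. pose proof (proj1 (HF (S n, S (s n)))). simpl in *. lia. }
  assert (Hs2 : forall m n, (m < n)%nat -> (s m < s n)%nat).
  { intros m n Hmn. induction Hmn as [|n Hmn IH]; [apply Hs1|]. specialize (Hs1 n). lia. }
  assert (Hs3 : forall n, (n <= s n)%nat).
  { induction n as [|n IH]; [lia|]. specialize (Hs1 n). lia. }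
  assert (Hlim : is_lim_seq (fun n => u (s n)) l).
  { apply is_lim_seq_eps. intros eps He. destruct (inv_S_small eps He) as [N HN].
    exists N. intros n Hn. apply Rlt_trans with (/ (INR n + 1)); [|apply HN, Hn].
    destruct n as [|n]; simpl s; [apply (proj2 (HF (O, O)))|apply (proj2 (HF (S n, S (s n))))]. }
  exists s, l. repeat split; try assumption.
  - apply (is_lim_seq_le (fun _ => a) (fun n => u (s n)) a l); [intro n; apply Hu|apply is_lim_seq_const|exact Hlim].
  - apply (is_lim_seq_le (fun n => u (s n)) (fun _ => b) l b); [intro n; apply Hu|exact Hlim|apply is_lim_seq_const].
Qed.

(** Three variables serve both parabolic maximum principles: time, space and, when variables are
    doubled, the distance between the two points. The comparison principle uses a degenerate third
    interval. *)
Definition seq_continuous_on_box (f : R -> R -> R -> R) a1 b1 a2 b2 a3 b3 :=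
  forall (t x r : nat -> R) (t0 x0 r0 : R),
    (forall n, a1 <= t n <= b1) -> (forall n, a2 <= x n <= b2) -> (forall n, a3 <= r n <= b3) ->
    a1 <= t0 <= b1 -> a2 <= x0 <= b2 -> a3 <= r0 <= b3 ->
    is_lim_seq t t0 -> is_lim_seq x x0 -> is_lim_seq r r0 ->
    is_lim_seq (fun n => f (t n) (x n) (r n)) (f t0 x0 r0).

Lemma box_subsequence (t x r : nat -> R) a1 b1 a2 b2 a3 b3 :
  (forall n, a1 <= t n <= b1) -> (forall n, a2 <= x n <= b2) -> (forall n, a3 <= r n <= b3) ->
  exists s t0 x0 r0, tends_to_infinity s /\ a1 <= t0 <= b1 /\ a2 <= x0 <= b2 /\ a3 <= r0 <= b3 /\
    is_lim_seq (fun n => t (s n)) t0 /\ is_lim_seq (fun n => x (s n)) x0 /\ is_lim_seq (fun n => r (s n)) r0.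
Proof.
  intros Ht Hx Hr.
  assert (Hid : forall s : nat -> nat, (forall n, (n <= s n)%nat) -> tends_to_infinity s).
  { intros s Hs N. exists N. intros n Hn. specialize (Hs n). lia. }
  destruct (bounded_subsequence t a1 b1 Ht) as (s1 & t0 & A1 & _ & B1 & C1).
  destruct (bounded_subsequence (fun n => x (s1 n)) a2 b2 (fun n => Hx (s1 n))) as (s2 & x0 & A2 & _ & B2 & C2).
  destruct (bounded_subsequence (fun n => r (s1 (s2 n))) a3 b3 (fun n => Hr _)) as (s3 & r0 & A3 & _ & B3 & C3).
  apply Hid in A1. apply Hid in A2. apply Hid in A3.
  exists (fun n => s1 (s2 (s3 n))), t0, x0, r0. repeat split; try tauto.
  - apply tends_to_infinity_comp; [exact A1|]. apply tends_to_infinity_comp; assumption.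
  - apply (is_lim_seq_tends (fun n => t (s1 n)) t0 (fun n => s2 (s3 n))); [apply tends_to_infinity_comp; assumption|exact C1].
  - apply (is_lim_seq_tends (fun n => x (s1 (s2 n))) x0 s3); assumption.
Qed.

Lemma box_max (f : R -> R -> R -> R) a1 b1 a2 b2 a3 b3 :
  a1 <= b1 -> a2 <= b2 -> a3 <= b3 -> seq_continuous_on_box f a1 b1 a2 b2 a3 b3 ->
  exists t0 x0 r0, a1 <= t0 <= b1 /\ a2 <= x0 <= b2 /\ a3 <= r0 <= b3 /\
    forall t x r, a1 <= t <= b1 -> a2 <= x <= b2 -> a3 <= r <= b3 -> f t x r <= f t0 x0 r0.
Proof.
  intros H1 H2 H3 Hf.
  set (P := fun p : R * R * R => a1 <= fst (fst p) <= b1 /\ a2 <= snd (fst p) <= b2 /\ a3 <= snd p <= b3).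
  set (F := fun p : R * R * R => f (fst (fst p)) (snd (fst p)) (snd p)).
  assert (Hcl : forall q : nat -> R * R * R, (forall n, P (q n)) -> exists s p, tends_to_infinity s /\ P p /\
            is_lim_seq (fun n => F (q (s n))) (F p)).
  { intros q Hq.
    destruct (box_subsequence (fun n => fst (fst (q n))) (fun n => snd (fst (q n))) (fun n => snd (q n))
      a1 b1 a2 b2 a3 b3) as (s & t0 & x0 & r0 & Hs & A & B & C & D & E & G); try (intro n; apply (Hq n)).
    exists s, (t0, x0, r0). repeat split; try tauto.
    apply (Hf (fun n => fst (fst (q (s n)))) (fun n => snd (fst (q (s n)))) (fun n => snd (q (s n))));
      try assumption; intro n; apply (Hq (s n)). }
  assert (Hb : exists M, forall p, P p -> F p <= M).
  { apply NNPP. intro Hn.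
    assert (Hq : forall n : nat, exists p, P p /\ INR n < F p).
    { intro n. apply NNPP. intro Hk. apply Hn. exists (INR n). intros p Hp.
      destruct (Rle_lt_dec (F p) (INR n)) as [h|h]; [exact h|]. exfalso. apply Hk. exists p. tauto. }
    apply functional_choice in Hq. destruct Hq as [q Hq].
    destruct (Hcl q (fun n => proj1 (Hq n))) as (s & p & Hs & _ & Hl).
    assert (Hl' : is_lim_seq (fun n => F (q (s n))) p_infty).
    { apply (is_lim_seq_le_p_loc (fun n => INR (s n))).
      - exists O. intros n _. left. apply Hq.
      - apply (is_lim_seq_tends INR p_infty s Hs is_lim_seq_INR). }
    apply is_lim_seq_unique in Hl. apply is_lim_seq_unique in Hl'. rewrite Hl in Hl'. discriminate. }
  destruct Hb as [M HM].
  destruct (completeness (fun y => exists p, P p /\ y = F p)) as [S [Hub Hlub]].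
  - exists M. intros y (p & Hp & ->). apply HM, Hp.
  - exists (F (a1, a2, a3)), (a1, a2, a3). split; [|reflexivity]. unfold P; simpl; lra.
  - assert (Hq : forall n : nat, exists p, P p /\ S - / (INR n + 1) < F p).
    { intro n. apply NNPP. intro Hk. pose proof (inv_INR_S_pos n).
      assert (S <= S - / (INR n + 1)); [|lra]. apply Hlub. intros y (p & Hp & ->).
      destruct (Rle_lt_dec (F p) (S - / (INR n + 1))) as [h|h]; [exact h|]. exfalso. apply Hk. exists p. tauto. }
    apply functional_choice in Hq. destruct Hq as [q Hq].
    destruct (Hcl q (fun n => proj1 (Hq n))) as (s & p & Hs & Hp & Hl).
    assert (HS : S <= F p).
    { apply (is_lim_seq_le (fun n => S - / (INR (s n) + 1)) (fun n => F (q (s n))) S (F p)).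
      - intro n. left. apply Hq.
      - replace (Finite S) with (Finite (S - 0)) by (f_equal; ring).
        apply is_lim_seq_minus'; [apply is_lim_seq_const|].
        apply (is_lim_seq_tends (fun n => / (INR n + 1)) 0 s Hs is_lim_seq_inv_S).
      - exact Hl. }
    destruct p as [[t0 x0] r0]. exists t0, x0, r0. unfold P in Hp; simpl in Hp. repeat split; try tauto.
    intros t x r Ht Hx Hr. apply Rle_trans with S; [|exact HS].
    apply Hub. exists (t, x, r). split; [unfold P; simpl; tauto|reflexivity].
Qed.

(** Cantor pairing, used twice, enumerates all the rationals [(i - j) / (k + 1)]. *)
Definition dense_point (n : nat) : R :=
  let '(i, jk) := of_nat n in let '(j, k) := of_nat jk in (INR i - INR j) / (INR k + 1).

Lemma dense_point_spec x eps : 0 < eps -> exists n, Rabs (dense_point n - x) < eps.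
Proof.
  intro He. destruct (inv_S_small eps He) as [k Hk]. specialize (Hk k (le_n k)).
  set (y := x * (INR k + 1)).
  assert (Hz : exists i j : nat, Rabs (INR i - INR j - y) <= 1).
  { destruct (archimed y) as [U1 U2]. destruct (Z_le_gt_dec 0 (up y)) as [h|h].
    - exists (Z.to_nat (up y)), O. rewrite INR_IZR_INZ, Z2Nat.id by lia. simpl. apply Rabs_le. lra.
    - exists O, (Z.to_nat (- up y)). rewrite (INR_IZR_INZ (Z.to_nat _)), Z2Nat.id, opp_IZR by lia. simpl. apply Rabs_le. lra. }
  destruct Hz as (i & j & Hij).
  exists (to_nat (i, to_nat (j, k))). unfold dense_point. rewrite !cancel_of_to.
  pose proof (inv_INR_S_pos k) as Hp. pose proof (pos_INR k).
  replace ((INR i - INR j) / (INR k + 1) - x) with ((INR i - INR j - y) * / (INR k + 1))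
    by (unfold y; field; lra).
  rewrite Rabs_mult, (Rabs_right (/ (INR k + 1))) by lra. nra.
Qed.

(** The pointwise half of the Arzela-Ascoli theorem: a diagonal sequence converges at every dense
    point, and the common Lipschitz constant makes it Cauchy everywhere. *)
Lemma lipschitz_sequence_cluster (f : nat -> R -> R) M Lam : 0 <= Lam ->
  (forall k x, Rabs (f k x) <= M) -> (forall k x y, Rabs (f k x - f k y) <= Lam * Rabs (x - y)) ->
  exists s l, tends_to_infinity s /\ forall x, is_lim_seq (fun n => f (s n) x) (Finite (l x)).
Proof.
  intros HLam HM HL.
  assert (H : forall ux : (nat -> nat) * R, exists s l, (forall n, (n <= s n)%nat) /\
     (forall m n, (m < n)%nat -> (s m < s n)%nat) /\ is_lim_seq (fun n => f (fst ux (s n)) (snd ux)) (Finite l)).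
  { intros [u x]. destruct (bounded_subsequence (fun n => f (u n) x) (- M) M) as (s & l & A & B & _ & C).
    - intro n. apply Rabs_le_between, HM.
    - exists s, l. tauto. }
  apply functional_choice in H. destruct H as [E HE].
  (* [T j] composes the first [j + 1] refinements, so [f (T j n)] converges at [dense_point j]; the
     diagonal [T n n] is, from [n = j] on, drawn from [T j]. *)
  set (T := fix T j := match j with O => E (fun n => n, dense_point 0)
                                  | S i => fun n => T i (E (T i, dense_point (S i)) n) end).
  assert (HT : forall j, exists l, is_lim_seq (fun n => f (T j n) (dense_point j)) (Finite l)).
  { intros [|j]; [destruct (HE (fun n => n, dense_point 0)) as (l & _ & _ & Hl)|
      destruct (HE (T j, dense_point (S j))) as (l & _ & _ & Hl)]; exists l; exact Hl. }
  assert (Hge : forall j n, (n <= T j n)%nat).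
  { induction j as [|j IH]; intro n; simpl.
    - destruct (HE (fun n => n, dense_point 0)) as (l & A & _ & _). apply A.
    - destruct (HE (T j, dense_point (S j))) as (l & A & _ & _). specialize (A n). specialize (IH (E (T j, dense_point (S j)) n)). lia. }
  assert (Hsub : forall j i n, exists m, (n <= m)%nat /\ T (i + j)%nat n = T j m).
  { intros j i. induction i as [|i IH]; intro n; simpl.
    - exists n. split; [lia|reflexivity].
    - destruct (HE (T (i + j)%nat, dense_point (S (i + j)))) as (l & A & _ & _). specialize (A n).
      destruct (IH (E (T (i + j)%nat, dense_point (S (i + j))) n)) as (m & Hm & Em).
      exists m. split; [lia|exact Em]. }
  set (s := fun n => T n n).
  assert (Hcau : forall x, ex_finite_lim_seq (fun n => f (s n) x)).
  { intro x. apply ex_lim_seq_cauchy_corr. intro eps.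
    destruct (dense_point_spec x (eps / 8 / (Lam + 1))) as [j Hj].
    { pose proof (cond_pos eps). apply Rdiv_lt_0_compat; lra. }
    assert (Hj' : Lam * Rabs (x - dense_point j) <= eps / 8).
    { rewrite Rabs_minus_sym. apply Rmult_lt_compat_l with (r := Lam + 1) in Hj; [|lra].
      replace ((Lam + 1) * (eps / 8 / (Lam + 1))) with (eps / 8) in Hj by (field; lra).
      pose proof (Rabs_pos (dense_point j - x)). lra. }
    destruct (HT j) as [l Hl]. destruct (proj1 (is_lim_seq_eps _ _) Hl (eps / 8)) as [N HN].
    { pose proof (cond_pos eps). lra. }
    assert (Hd : forall n, (Nat.max j N <= n)%nat -> Rabs (f (s n) x - l) <= eps / 4).
    { intros n Hn. destruct (Hsub j (n - j)%nat n) as (m & Hm & Em).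
      replace (n - j + j)%nat with n in Em by lia. unfold s. rewrite Em.
      specialize (HN m ltac:(lia)). specialize (HL (T j m) x (dense_point j)).
      replace (f (T j m) x - l) with ((f (T j m) x - f (T j m) (dense_point j)) + (f (T j m) (dense_point j) - l)) by ring.
      eapply Rle_trans; [apply Rabs_triang|]. lra. }
    exists (Nat.max j N). intros n m Hn Hm. apply Hd in Hn. apply Hd in Hm.
    replace (f (s n) x - f (s m) x) with ((f (s n) x - l) - (f (s m) x - l)) by ring.
    eapply Rle_lt_trans; [apply Rabs_triang|]. rewrite Rabs_Ropp. pose proof (cond_pos eps). lra. }
  apply functional_choice in Hcau. destruct Hcau as [l Hl].
  exists s, l. split; [|exact Hl]. intro N. exists N. intros n Hn. specialize (Hge n n). unfold s. lia.
Qed.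

(** * The reaction term *)

(** Derivatives of [g] are replaced by bounds on increments, valid on both sides of 0 and of
    [kappa]. This is what the barriers require: adding or subtracting multiples of [eta] takes them
    out of the interval from 0 to [kappa]. *)
Record monostable (g : R -> R) (kappa k0 k1 L : R) : Prop := {
  ms_kappa : 0 < kappa;
  ms_L : 0 < L;
  ms_k0 : 1 < k0;
  ms_k1 : 0 <= k1 < 1;
  ms_zero : g 0 = 0;
  ms_fix : g kappa = kappa;
  ms_above : forall x, 0 < x < kappa -> x < g x;
  ms_below : forall x, kappa < x -> g x < x;
  ms_mono : forall x y, x <= y -> g x <= g y;
  ms_lip : forall x y, x <= y -> g y - g x <= L * (y - x);
  ms_slope0 : forall eps, 0 < eps -> exists d, 0 < d /\ forall x y, - d <= x -> x <= y -> y <= d ->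
     (k0 - eps) * (y - x) <= g y - g x <= (k0 + eps) * (y - x);
  ms_slope1 : forall eps, 0 < eps -> exists d, 0 < d /\ forall x y, kappa - d <= x -> x <= y -> y <= kappa + d ->
     g y - g x <= (k1 + eps) * (y - x) }.
Arguments ms_kappa {g kappa k0 k1 L} _.
Arguments ms_L {g kappa k0 k1 L} _.
Arguments ms_k0 {g kappa k0 k1 L} _.
Arguments ms_k1 {g kappa k0 k1 L} _.
Arguments ms_zero {g kappa k0 k1 L} _.
Arguments ms_fix {g kappa k0 k1 L} _.
Arguments ms_above {g kappa k0 k1 L} _.
Arguments ms_below {g kappa k0 k1 L} _.
Arguments ms_mono {g kappa k0 k1 L} _.
Arguments ms_lip {g kappa k0 k1 L} _.
Arguments ms_slope0 {g kappa k0 k1 L} _.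
Arguments ms_slope1 {g kappa k0 k1 L} _.

Lemma slope_near (g : R -> R) p d0 : 0 < d0 ->
  (forall x, Rabs (x - p) < d0 -> ex_derive g x /\ continuous (Derive g) x) ->
  forall eps, 0 < eps -> exists d, 0 < d /\ forall x y, p - d <= x -> x <= y -> y <= p + d ->
     (Derive g p - eps) * (y - x) <= g y - g x <= (Derive g p + eps) * (y - x).
Proof.
  intros Hd0 H eps He.
  destruct (H p) as [_ Hc]. { replace (p - p) with 0 by ring. rewrite Rabs_R0; exact Hd0. }
  assert (Hl : locally (Derive g p) (fun y => Rabs (y - Derive g p) < eps)).
  { exists (mkposreal eps He). intros y Hy; exact Hy. }
  destruct (Hc _ Hl) as [d1 Hd1].
  exists (Rmin d0 d1 / 2).
  pose proof (Rmin_glb_lt _ _ _ Hd0 (cond_pos d1)). pose proof (Rmin_l d0 d1). pose proof (Rmin_r d0 d1).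
  split; [lra|]. intros x y Hx Hxy Hy.
  destruct Hxy as [Hxy| ->]; [|lra].
  destruct (mean_value g (Derive g) x y Hxy) as (c & E & Hcc).
  - intros z Hz. apply Derive_correct. apply H. apply Rabs_def1; lra.
  - assert (K : Rabs (Derive g c - Derive g p) < eps).
    { apply (Hd1 c). change (Rabs (c - p) < d1). apply Rabs_def1; lra. }
    apply Rabs_def2 in K. rewrite E. split; apply Rmult_le_compat_r; lra.
Qed.

Lemma lipschitz_continuous (f : R -> R) L : (forall x y, Rabs (f x - f y) <= L * Rabs (x - y)) ->
  forall x, continuous f x.
Proof.
  intros H x. apply continuity_pt_filterlim. intros eps He.
  exists (eps / (Rabs L + 1)). pose proof (Rabs_pos L).
  split; [apply Rdiv_lt_0_compat; lra|].
  intros y [_ Hy]. simpl in *. unfold R_dist in *.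
  assert (L <= Rabs L) by apply Rle_abs.
  apply Rle_lt_trans with ((Rabs L + 1) * Rabs (y - x)).
  - eapply Rle_trans; [apply H|]. apply Rmult_le_compat_r; [apply Rabs_pos|lra].
  - apply Rmult_lt_compat_l with (r := Rabs L + 1) in Hy; [|lra].
    replace ((Rabs L + 1) * (eps / (Rabs L + 1))) with eps in Hy by (field; lra). exact Hy.
Qed.

Lemma monostable_abs_lip {g kappa k0 k1 L} : monostable g kappa k0 k1 L ->
  forall x y, Rabs (g x - g y) <= L * Rabs (x - y).
Proof.
  intros H x y. destruct (Rle_lt_dec x y) as [h|h].
  - pose proof (ms_mono H x y h). pose proof (ms_lip H x y h).
    rewrite !Rabs_left1 by lra. lra.
  - pose proof (ms_mono H y x ltac:(lra)). pose proof (ms_lip H y x ltac:(lra)).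
    rewrite !Rabs_right by lra. lra.
Qed.

Lemma monostable_continuous {g kappa k0 k1 L} : monostable g kappa k0 k1 L -> forall x, continuous g x.
Proof. intros H. apply (lipschitz_continuous g L). exact (monostable_abs_lip H). Qed.

Lemma hypH_monostable g kappa : hypH g kappa -> (forall x y, x <= y -> g x <= g y) ->
  exists L, monostable g kappa (Derive g 0) (Derive g kappa) L.
Proof.
  intros (Hk & H0 & H1 & Hfix & (d0 & Hd0 & Hz & Hka & _) & Hg0 & Hg1 & (Lg & HLg) & Hneg & Hpos) Hm.
  (* The linear extension beyond [kappa] is increasing, which fixes the sign of the slope. *)
  assert (Hk1 : 0 <= Derive g kappa).
  { specialize (Hpos (kappa + 1) ltac:(lra)). specialize (Hm kappa (kappa + 1) ltac:(lra)).
    rewrite H1, Hpos in Hm. lra. }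
  set (L := Rmax (Rmax Lg (Derive g 0)) 1).
  assert (HL : Lg <= L /\ Derive g 0 <= L /\ 1 <= L).
  { unfold L. pose proof (Rmax_l (Rmax Lg (Derive g 0)) 1). pose proof (Rmax_r (Rmax Lg (Derive g 0)) 1).
    pose proof (Rmax_l Lg (Derive g 0)). pose proof (Rmax_r Lg (Derive g 0)). lra. }
  assert (HA : forall x y, x <= y -> y <= 0 -> g y - g x <= L * (y - x)).
  { intros x y Hxy Hy. rewrite (Hneg x), (Hneg y) by lra. nra. }
  assert (HB : forall x y, kappa <= x -> x <= y -> g y - g x <= L * (y - x)).
  { intros x y Hxy Hy. rewrite (Hpos x), (Hpos y) by lra. nra. }
  assert (HC : forall x y, 0 <= x -> x <= y -> y <= kappa -> g y - g x <= L * (y - x)).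
  { intros x y Hx Hxy Hy. specialize (HLg y x ltac:(lra) ltac:(lra)).
    rewrite (Rabs_right (y - x)) in HLg by lra. pose proof (Rle_abs (g y - g x)). nra. }
  assert (HLip : forall x y, x <= y -> g y - g x <= L * (y - x)).
  { assert (HAC : forall x y, x <= y -> y <= kappa -> g y - g x <= L * (y - x)).
    { intros x y Hxy Hy. destruct (Rle_lt_dec y 0); [apply HA; lra|].
      destruct (Rle_lt_dec 0 x); [apply HC; lra|].
      specialize (HA x 0 ltac:(lra) ltac:(lra)). specialize (HC 0 y ltac:(lra) ltac:(lra) ltac:(lra)). lra. }
    intros x y Hxy. destruct (Rle_lt_dec y kappa); [apply HAC; lra|].
    destruct (Rle_lt_dec kappa x); [apply HB; lra|].
    specialize (HAC x kappa ltac:(lra) ltac:(lra)). specialize (HB kappa y ltac:(lra) ltac:(lra)). lra. }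
  pose proof (slope_near g kappa d0 Hd0 Hka) as S1.
  assert (S0 : forall eps, 0 < eps -> exists d, 0 < d /\ forall x y, - d <= x -> x <= y -> y <= d ->
     (Derive g 0 - eps) * (y - x) <= g y - g x <= (Derive g 0 + eps) * (y - x)).
  { intros eps He. destruct (slope_near g 0 d0 Hd0) with (eps := eps) as (d & Hd & K); [|exact He|].
    - intros x Hx. apply Hz. rewrite Rminus_0_r in Hx. exact Hx.
    - exists d. split; [exact Hd|]. intros x y Hx Hxy Hy. apply K; lra. }
  exists L. constructor; try lra; try assumption.
  (* Near 0 the slope exceeds 1, so [g y > y] for small [y]; if [g x <= x], the intermediate value
     theorem would produce a third fixed point. *)
  - intros x Hx. destruct (Rle_lt_dec (g x) x) as [h|h]; [exfalso|exact h].
    destruct (S0 ((Derive g 0 - 1) / 2) ltac:(lra)) as (d & Hd & K).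
    set (y := Rmin d (x / 2)).
    assert (Hy : 0 < y) by (apply Rmin_glb_lt; lra).
    assert (Hy1 : y <= d) by apply Rmin_l. assert (Hy2 : y <= x / 2) by apply Rmin_r.
    specialize (K 0 y ltac:(lra) ltac:(lra) Hy1). rewrite H0 in K.
    assert (Hgy : y < g y) by nra.
    destruct (IVT_gen (fun z => g z - z) y x 0) as (z & Hz1 & Hz2).
    + intro z. apply continuity_pt_minus; [|apply continuity_pt_id].
      apply continuity_pt_filterlim. apply (lipschitz_continuous g L).
      intros u v. destruct (Rle_lt_dec u v).
      * pose proof (Hm u v ltac:(lra)). pose proof (HLip u v ltac:(lra)). rewrite !Rabs_left1; lra.
      * pose proof (Hm v u ltac:(lra)). pose proof (HLip v u ltac:(lra)). rewrite !Rabs_right; lra.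
    + rewrite Rmin_right, Rmax_left by lra. lra.
    + rewrite Rmin_left, Rmax_right in Hz1 by lra.
      destruct (Hfix z ltac:(lra) ltac:(lra)); lra.
  - intros x Hx. rewrite (Hpos x) by lra. nra.
  - intros eps He. destruct (S1 eps He) as (d & Hd & K). exists d. split; [exact Hd|].
    intros x y Hx Hxy Hy. apply K; lra.
Qed.

(** * The linear operator y'' - c y' - y *)

Lemma line_max (w : R -> R) X : 0 <= X -> (forall z, continuous w z) ->
  exists z0, - X <= z0 <= X /\ forall z, - X <= z <= X -> w z <= w z0.
Proof.
  intros HX Hc. destruct (continuity_ab_maj w (- X) X) as (z0 & H1 & H2); [lra| |].
  - intros z _. apply continuity_pt_filterlim, Hc.
  - exists z0. split; [exact H2|]. exact H1.
Qed.

(** The function [w] may have kinks: where it is positive it only has to be touched from below by a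
    smooth subsolution [b]. At a maximum of [w] minus a quadratic, [b] minus the same quadratic is
    maximal too, and the classical argument applies to [b]. *)
Lemma line_max_principle c (w : R -> R) M :
  (forall z, continuous w z) -> (forall z, w z <= M) ->
  (forall z, 0 < w z -> exists b b1 b2, b z = w z /\ (forall y, b y <= w y) /\
     (forall y, is_derive b y (b1 y)) /\ is_derive b1 z b2 /\ 0 <= b2 - c * b1 z - b z) ->
  forall z, w z <= 0.
Proof.
  intros Hc HM Hb x. destruct (Rle_lt_dec (w x) 0) as [h|h]; [exact h|exfalso].
  (* The operator sends [A + z ^ 2] to [- 1 - (z + c) ^ 2], so this weight is a strict
     supersolution; its growth also forces the maximum to be attained. *)
  set (A := 3 + c ^ 2).
  assert (HA : 3 <= A) by (unfold A; nra).
  set (eps := w x / (2 * (A + x ^ 2))).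
  assert (Hden : 0 < A + x ^ 2) by nra.
  assert (He : 0 < eps) by (unfold eps; apply Rdiv_lt_0_compat; lra).
  assert (Hex : eps * (A + x ^ 2) = w x / 2) by (unfold eps; field; lra).
  set (v := fun z => w z - eps * (A + z ^ 2)).
  assert (Hvx : 0 < v x) by (unfold v; lra).
  set (X := 1 + Rabs x + Rabs M / eps).
  assert (HMe : 0 <= Rabs M / eps) by (apply Rdiv_le_0_compat; [apply Rabs_pos|exact He]).
  pose proof (Rabs_pos x).
  destruct (line_max v X) as (z0 & Hz0 & Hmax); [unfold X; lra| |].
  { intro z. unfold v. apply (continuous_minus w (fun z => eps * (A + z ^ 2))); [apply Hc|].
    apply (is_derive_continuous _ z (eps * (2 * z))). auto_derive; [trivial|ring]. }
  assert (Hxin : - X <= x <= X) by (apply Rabs_le_between; unfold X; lra).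
  assert (Hv0 : 0 < v z0) by (specialize (Hmax x Hxin); lra).
  assert (Hall : forall z, v z <= v z0).
  { intro z. destruct (Rle_lt_dec (Rabs z) X) as [h1|h1].
    - apply Hmax, Rabs_le_between, h1.
    - left. apply Rle_lt_trans with 0; [|exact Hv0]. unfold v.
      assert (Hz2 : X <= z ^ 2).
      { rewrite <- (pow2_abs z). assert (1 <= X) by (unfold X; lra). nra. }
      assert (Rabs M <= eps * X).
      { unfold X. rewrite !Rmult_plus_distr_l. replace (eps * (Rabs M / eps)) with (Rabs M) by (field; lra). nra. }
      pose proof (Rle_abs M). specialize (HM z). nra. }
  assert (Hw0 : 0 < w z0) by (unfold v in Hv0; nra).
  destruct (Hb z0 Hw0) as (b & b1 & b2 & E & Hle & Hd1 & Hd2 & Hineq).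
  destruct (local_max_second_derive (fun z => b z - eps * (A + z ^ 2)) (fun z => b1 z - eps * (2 * z)) z0
     (b2 - eps * 2) 1) as [D1 D2]; [lra| | |  |].
  - intros y _. apply (is_derive_minus b (fun z => eps * (A + z ^ 2))); [apply Hd1|]. auto_derive; [trivial|ring].
  - apply (is_derive_minus b1 (fun z => eps * (2 * z))); [exact Hd2|]. auto_derive; [trivial|ring].
  - intros y _. specialize (Hall y). unfold v in Hall. specialize (Hle y). lra.
  - unfold v in Hv0.
    assert (2 - 2 * c * z0 - (A + z0 ^ 2) < 0) by (unfold A; pose proof (pow2_ge_0 (z0 + c)); lra).
    assert (b1 z0 = eps * (2 * z0)) by lra. rewrite H1 in Hineq. rewrite E in Hineq. nra.
Qed.

(** These are the characteristic roots of [y'' - c y' - y]. Sum and product are the form in which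
    the factorization [(D - z1) (D - z2)] is used. *)
Lemma quadratic_roots c : exists z1 z2, z1 < 0 /\ 0 < z2 /\ z1 + z2 = c /\ z1 * z2 = -1.
Proof.
  set (s := sqrt (c ^ 2 + 4)).
  assert (Hs : s * s = c ^ 2 + 4) by (apply sqrt_sqrt; nra).
  assert (Hs0 : 0 <= s) by apply sqrt_pos.
  exists ((c - s) / 2), ((c + s) / 2).
  assert (- s < c < s) by (split; nra). repeat split; nra.
Qed.

Lemma exp_weight_derive (p : R -> R) a z l : is_derive p z l ->
  is_derive (fun x => p x * exp (a * x)) z ((l + a * p z) * exp (a * z)).
Proof.
  intro H. auto_derive; [exists l; exact H|].
  assert (E : Derive (fun x => p x) z = l) by (apply is_derive_unique; exact H). rewrite E. ring.
Qed.

(** With [D] the derivative, [(D - a') (w' - a w) <= 0] for either ordering [a, a'] of the roots, so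
    [(w' - a w) exp (- a' z)] is nonincreasing. A violation of one of the bounds then persists on a
    half-line and drives [w] below 0. *)
Lemma harnack_derive c z1 z2 (w w1 w2 : R -> R) :
  z1 < 0 -> 0 < z2 -> z1 + z2 = c -> z1 * z2 = -1 ->
  (forall z, is_derive w z (w1 z)) -> (forall z, is_derive w1 z (w2 z)) ->
  (forall z, w2 z - c * w1 z - w z <= 0) -> (forall z, 0 <= w z) ->
  forall z, z1 * w z <= w1 z <= z2 * w z.
Proof.
  intros Hz1 Hz2 Hs Hp D1 D2 Hle Hw x.
  assert (mono : forall a a', a + a' = c -> a * a' = -1 -> forall u v, u <= v ->
      (w1 v - a * w v) * exp (- a' * v) <= (w1 u - a * w u) * exp (- a' * u)).
  { intros a a' Haa Hpp u v Huv.
    enough (- ((w1 u - a * w u) * exp (- a' * u)) <= - ((w1 v - a * w v) * exp (- a' * v))) by lra.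
    apply (derive_nonneg_le (fun z => - ((w1 z - a * w z) * exp (- a' * z)))
      (fun z => - ((w2 z - a * w1 z + (- a') * (w1 z - a * w z)) * exp (- a' * z)))); [exact Huv| |].
    - intros z _.
      apply (is_derive_opp (fun z => (w1 z - a * w z) * exp (- a' * z))).
      apply (exp_weight_derive (fun z => w1 z - a * w z)).
      apply (is_derive_minus w1 (fun z => a * w z)); [apply D2|]. apply (is_derive_scal w z a), D1.
    - intros z _. specialize (Hle z).
      replace (w2 z - a * w1 z + - a' * (w1 z - a * w z)) with (w2 z - (a + a') * w1 z + (a * a') * w z) by ring.
      rewrite Haa, Hpp. pose proof (exp_pos (- a' * z)). nra. }
  split.
  - destruct (Rle_lt_dec (z1 * w x) (w1 x)) as [h|h]; [exact h|exfalso].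
    (* To the right of [x] the derivative stays at most [- k], so after a length [(w x + 1) / k] the
       function would be negative. *)
    set (k := z1 * w x - w1 x). assert (Hk : 0 < k) by (unfold k; lra).
    assert (Hd : forall y, x <= y -> w1 y <= - k).
    { intros y Hy. specialize (mono z1 z2 Hs Hp x y Hy).
      assert (He : exp (- z2 * y) <= exp (- z2 * x)) by (apply exp_le; nra).
      pose proof (exp_pos (- z2 * y)). specialize (Hw y).
      assert ((w1 y - z1 * w y) <= - k); [|nra].
      replace (w1 x - z1 * w x) with (- k) in mono by (unfold k; ring).
      apply Rmult_le_reg_r with (exp (- z2 * y)); [assumption|]. nra. }
    assert (Hx : w (x + (w x + 1) / k) <= w x - (w x + 1)).
    { pose proof (Hw x).
      assert (Ht : 0 <= (w x + 1) / k) by (apply Rdiv_le_0_compat; lra).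
      assert (K := derive_nonneg_le (fun y => - (w y) - k * y) (fun y => - w1 y - k * 1) x (x + (w x + 1) / k) ltac:(lra)).
      simpl in K. replace (k * (x + (w x + 1) / k)) with (k * x + (w x + 1)) in K by (field; lra).
      enough (- w x - k * x <= - w (x + (w x + 1) / k) - (k * x + (w x + 1))) by lra. apply K.
      - intros y _. apply (is_derive_minus (fun y => - w y) (fun y => k * y)).
        + apply (is_derive_opp w), D1.
        + apply is_derive_linear.
      - intros y Hy. specialize (Hd y ltac:(lra)). lra. }
    pose proof (Hw (x + (w x + 1) / k)). lra.
  - destruct (Rle_lt_dec (w1 x) (z2 * w x)) as [h|h]; [exact h|exfalso].
    set (k := w1 x - z2 * w x). assert (Hk : 0 < k) by (unfold k; lra).
    assert (Hd : forall y, y <= x -> k <= w1 y).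
    { intros y Hy. specialize (mono z2 z1 ltac:(lra) ltac:(lra) y x Hy).
      assert (He : exp (- z1 * y) <= exp (- z1 * x)) by (apply exp_le; nra).
      pose proof (exp_pos (- z1 * y)). specialize (Hw y).
      assert (k <= (w1 y - z2 * w y)); [|nra].
      fold k in mono.
      apply Rmult_le_reg_r with (exp (- z1 * y)); [assumption|]. nra. }
    pose proof (Hw x).
    assert (Ht : 0 <= (w x + 1) / k) by (apply Rdiv_le_0_compat; lra).
    assert (K := derive_nonneg_le (fun y => w y - k * y) (fun y => w1 y - k * 1) (x - (w x + 1) / k) x ltac:(lra)).
    simpl in K. replace (k * (x - (w x + 1) / k)) with (k * x - (w x + 1)) in K by (field; lra).
    pose proof (Hw (x - (w x + 1) / k)).
    enough (w (x - (w x + 1) / k) - (k * x - (w x + 1)) <= w x - k * x) by lra. apply K.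
    + intros y _. apply (is_derive_minus w (fun y => k * y)); [apply D1|].
      apply is_derive_linear.
    + intros y Hy. specialize (Hd y ltac:(lra)). lra.
Qed.

Lemma exp_growth_upper (w w1 : R -> R) a : (forall z, is_derive w z (w1 z)) -> (forall z, w1 z <= a * w z) ->
  forall x y, x <= y -> w y <= w x * exp (a * (y - x)).
Proof.
  intros D H x y Hxy.
  assert (K : - (w x * exp (- a * x)) <= - (w y * exp (- a * y))).
  { apply (derive_nonneg_le (fun z => - (w z * exp (- a * z))) (fun z => - ((w1 z + - a * w z) * exp (- a * z)))); [exact Hxy| |].
    - intros z _. apply (is_derive_opp (fun z => w z * exp (- a * z))). apply exp_weight_derive, D.
    - intros z _. specialize (H z). pose proof (exp_pos (- a * z)). nra. }
  replace (a * (y - x)) with (- a * x + a * y) by ring. rewrite exp_plus.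
  replace (w y) with (w y * exp (- a * y) * exp (a * y)).
  - rewrite <- Rmult_assoc. apply Rmult_le_compat_r; [left; apply exp_pos|lra].
  - rewrite Rmult_assoc, <- exp_plus. replace (- a * y + a * y) with 0 by ring. rewrite exp_0. ring.
Qed.

Lemma exp_growth_lower (w w1 : R -> R) a : (forall z, is_derive w z (w1 z)) -> (forall z, a * w z <= w1 z) ->
  forall x y, x <= y -> w x * exp (a * (y - x)) <= w y.
Proof.
  intros D H x y Hxy.
  assert (K := exp_growth_upper (fun z => - w z) (fun z => - w1 z) a).
  enough (- w y <= - w x * exp (a * (y - x))) by lra. apply K; [|intro z; specialize (H z); lra|exact Hxy].
  intro z. apply (is_derive_opp w), D.
Qed.

(** A strong maximum principle: by the bounds on [w'], positivity at one point propagates in both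
    directions with at most exponential loss. *)
Lemma harnack_positive c (w w1 w2 : R -> R) :
  (forall z, is_derive w z (w1 z)) -> (forall z, is_derive w1 z (w2 z)) ->
  (forall z, w2 z - c * w1 z - w z <= 0) -> (forall z, 0 <= w z) ->
  (exists x, 0 < w x) -> forall z, 0 < w z.
Proof.
  intros D1 D2 Hle Hw [x Hx] z.
  destruct (quadratic_roots c) as (z1 & z2 & A & B & C & D).
  pose proof (harnack_derive c z1 z2 w w1 w2 A B C D D1 D2 Hle Hw) as HH.
  destruct (Rle_lt_dec x z) as [h|h].
  - pose proof (exp_growth_lower w w1 z1 D1 (fun z => proj1 (HH z)) x z h).
    pose proof (exp_pos (z1 * (z - x))). nra.
  - pose proof (exp_growth_upper w w1 z2 D1 (fun z => proj2 (HH z)) z x ltac:(lra)).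
    pose proof (exp_pos (z2 * (x - z))). specialize (Hw z). nra.
Qed.

(** * Bounded solutions of y'' - c y' - y + G = 0 *)

Definition lin_sol c (G y y1 : R -> R) :=
  (forall z, is_derive y z (y1 z)) /\ (forall z, is_derive y1 z (c * y1 z + y z - G z)).

Lemma lin_sol_ext c G G' y y1 : (forall z, G z = G' z) -> lin_sol c G y y1 -> lin_sol c G' y y1.
Proof. intros H [A B]. split; [exact A|]. intro z. rewrite <- H. apply B. Qed.

Lemma lin_sol_shift c G y y1 s : lin_sol c G y y1 ->
  lin_sol c (fun z => G (z + s)) (fun z => y (z + s)) (fun z => y1 (z + s)).
Proof. intros [A B]. split; intro z; [apply is_derive_shift, A|apply (is_derive_shift y1), B]. Qed.

Lemma lin_sol_minus c G G' y y1 y' y1' : lin_sol c G y y1 -> lin_sol c G' y' y1' ->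
  lin_sol c (fun z => G z - G' z) (fun z => y z - y' z) (fun z => y1 z - y1' z).
Proof.
  intros [A B] [A' B']. split; intro z.
  - apply (is_derive_minus y y'); auto.
  - replace (c * (y1 z - y1' z) + (y z - y' z) - (G z - G' z))
      with ((c * y1 z + y z - G z) - (c * y1' z + y' z - G' z)) by ring.
    apply (is_derive_minus y1 y1'); auto.
Qed.

Lemma lin_sol_const c K : lin_sol c (fun _ => K) (fun _ => K) (fun _ => 0).
Proof.
  split; intro z; [apply (is_derive_const K)|].
  replace (c * 0 + K - K) with 0 by ring. apply (is_derive_const 0).
Qed.

Lemma lin_sol_continuous c G y y1 : lin_sol c G y y1 -> forall z, continuous y z.
Proof. intros [A _] z. apply (is_derive_continuous y z (y1 z)), A. Qed.

(** The quadratic weight lets solutions depend continuously on sources that converge only locally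
    uniformly. The barrier is exact enough because its image under the operator plus
    [eps (1 + z ^ 2)] equals [- eps (1 + (z + 2 c) ^ 2)]. With [eps = 0] this is the comparison
    principle. *)
Lemma lin_sol_compare c G G' y y1 y' y1' M eps :
  lin_sol c G y y1 -> lin_sol c G' y' y1' -> (forall z, Rabs (y z) <= M) -> (forall z, Rabs (y' z) <= M) ->
  0 <= eps -> (forall z, G z - G' z <= eps * (1 + z ^ 2)) ->
  forall z, y z - y' z <= 2 * eps * (3 + 2 * c ^ 2 + z ^ 2).
Proof.
  intros S S' HM HM' He HG z.
  destruct (lin_sol_minus _ _ _ _ _ _ _ S S') as [D1 D2].
  set (w := fun z => (y z - y' z) - 2 * eps * (3 + 2 * c ^ 2 + z ^ 2)).
  set (w1 := fun z => (y1 z - y1' z) - 2 * eps * (2 * z)).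
  assert (Dw : forall z, is_derive w z (w1 z)).
  { intro x. apply (is_derive_minus (fun z => y z - y' z)); [apply D1|]. auto_derive; [trivial|ring]. }
  enough (w z <= 0) by (unfold w in *; lra).
  apply (line_max_principle c w (2 * M)).
  - intro x. apply (is_derive_continuous w x (w1 x)), Dw.
  - intro x. unfold w. specialize (HM x). specialize (HM' x).
    apply Rabs_le_between in HM. apply Rabs_le_between in HM'.
    assert (0 <= eps * (3 + 2 * c ^ 2 + x ^ 2)) by (apply Rmult_le_pos; nra). lra.
  - intros x _. exists w, w1, (c * (y1 x - y1' x) + (y x - y' x) - (G x - G' x) - 2 * eps * 2).
    split; [reflexivity|split; [intro; lra|split; [exact Dw|split]]].
    + apply (is_derive_minus (fun z => y1 z - y1' z)); [apply D2|]. auto_derive; [trivial|ring].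
    + unfold w, w1. specialize (HG x).
      assert (0 <= eps * (1 + 4 * c ^ 2 + 4 * c * x + x ^ 2)).
      { apply Rmult_le_pos; [lra|]. pose proof (pow2_ge_0 (x + 2 * c)). lra. }
      lra.
Qed.

Lemma lin_sol_le c G G' y y1 y' y1' M :
  lin_sol c G y y1 -> lin_sol c G' y' y1' -> (forall z, Rabs (y z) <= M) -> (forall z, Rabs (y' z) <= M) ->
  (forall z, G z <= G' z) -> forall z, y z <= y' z.
Proof.
  intros S S' HM HM' HG z.
  pose proof (lin_sol_compare c G G' y y1 y' y1' M 0 S S' HM HM' (Rle_refl 0)) as K.
  specialize (K (fun z => ltac:(specialize (HG z); lra)) z). lra.
Qed.

Lemma lin_sol_bounds c G y y1 M K : lin_sol c G y y1 -> (forall z, Rabs (y z) <= M) ->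
  (forall z, 0 <= G z <= K) -> forall z, 0 <= y z <= K.
Proof.
  intros S HM HG z.
  assert (HK : 0 <= K) by (specialize (HG 0); lra).
  assert (HM0 : 0 <= M) by (specialize (HM 0); pose proof (Rabs_pos (y 0)); lra).
  assert (B1 : forall z, Rabs (y z) <= Rmax M K) by (intro x; specialize (HM x); pose proof (Rmax_l M K); lra).
  assert (B2 : forall k, 0 <= k <= K -> forall z : R, Rabs k <= Rmax M K).
  { intros k Hk x. rewrite Rabs_right by lra. pose proof (Rmax_r M K). lra. }
  split.
  - apply (lin_sol_le c (fun _ => 0) G (fun _ => 0) (fun _ => 0) y y1 (Rmax M K)); auto using lin_sol_const.
    + apply B2; lra.
    + intro x; apply HG.
  - apply (lin_sol_le c G (fun _ => K) y y1 (fun _ => K) (fun _ => 0) (Rmax M K)); auto using lin_sol_const.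
    + apply B2; lra.
    + intro x; apply HG.
Qed.

(** The bounded solution is the integral from minus infinity. Adding [K] makes the integrand
    nonnegative, so its primitive [Q] is monotone and the improper integral is [Q] minus its
    infimum; the constant [K / a] undoes the addition. *)
Lemma first_order_neg a G K : a < 0 -> (forall z, continuous G z) -> (forall z, Rabs (G z) <= K) ->
  exists p B, (forall z, Rabs (p z) <= B) /\ forall z, is_derive p z (a * p z + G z).
Proof.
  intros Ha Hc HK.
  assert (HK0 : 0 <= K) by (specialize (HK 0); pose proof (Rabs_pos (G 0)); lra).
  set (H := fun z => (G z + K) * exp (- a * z)).
  assert (HHc : forall z, continuous H z).
  { intro z. apply (continuous_mult (fun z => G z + K) (fun z => exp (- a * z))).
    - apply (continuous_plus G (fun _ => K)); [apply Hc|apply continuous_const].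
    - apply (is_derive_continuous _ z (- a * exp (- a * z))). auto_derive; [trivial|ring]. }
  set (Q := fun z => RInt H 0 z).
  assert (HQ : forall z, is_derive Q z (H z)).
  { intro z. apply (is_derive_RInt H Q 0 z); [|apply HHc].
    exists (mkposreal 1 Rlt_0_1). intros y _. apply (RInt_correct H 0 y).
    apply (ex_RInt_continuous H). intros x _. apply HHc. }
  set (C := 2 * K / - a).
  assert (HC : 0 <= C) by (apply Rdiv_le_0_compat; lra).
  assert (HGK : forall z, 0 <= G z + K <= 2 * K).
  { intro z. specialize (HK z). apply Rabs_le_between in HK. lra. }
  assert (Q1 : forall x y, x <= y -> Q x <= Q y).
  { intros x y Hxy. apply (derive_nonneg_le Q H); [exact Hxy|intros; apply HQ|].
    intros z _. apply Rmult_le_pos; [apply HGK|left; apply exp_pos]. }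
  assert (Q2 : forall x y, x <= y -> Q y - Q x <= C * exp (- a * y)).
  { intros x y Hxy.
    assert (C * exp (- a * x) - Q x <= C * exp (- a * y) - Q y).
    { apply (derive_nonneg_le (fun z => C * exp (- a * z) - Q z) (fun z => C * (- a * exp (- a * z)) - H z)); [exact Hxy| |].
      - intros z _. apply (is_derive_minus (fun z => C * exp (- a * z)) Q); [|apply HQ]. auto_derive; [trivial|ring].
      - intros z _. unfold H, C. replace (2 * K / - a * (- a * exp (- a * z))) with (2 * K * exp (- a * z)) by (field; lra).
        specialize (HGK z). pose proof (exp_pos (- a * z)). nra. }
    pose proof (exp_pos (- a * x)). nra. }
  (* Here [q] is minus the infimum of [Q], so [Q + q] is the integral of [H] from minus infinity. *)
  destruct (completeness (fun v => exists z, v = - Q z)) as [q [Hub Hlub]].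
  { exists (- Q 0 + C). intros v (z & ->). destruct (Rle_lt_dec 0 z) as [h|h].
    - specialize (Q1 0 z h). lra.
    - specialize (Q2 z 0 ltac:(lra)). replace (- a * 0) with 0 in Q2 by ring. rewrite exp_0 in Q2. lra. }
  { exists (- Q 0), 0. reflexivity. }
  assert (P1 : forall z, 0 <= Q z + q).
  { intro z. assert (- Q z <= q) by (apply Hub; exists z; reflexivity). lra. }
  assert (P2 : forall z, Q z + q <= C * exp (- a * z)).
  { intro z. enough (q <= C * exp (- a * z) - Q z) by lra. apply Hlub. intros v (x & ->).
    destruct (Rle_lt_dec x z) as [h|h]; [specialize (Q2 x z h); lra|].
    specialize (Q1 z x ltac:(lra)). pose proof (exp_pos (- a * z)). nra. }
  assert (Hee : forall z, exp (- a * z) * exp (a * z) = 1).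
  { intro z. rewrite <- exp_plus. replace (- a * z + a * z) with 0 by ring. apply exp_0. }
  exists (fun z => (Q z + q) * exp (a * z) + K / a), (C + Rabs (K / a)). split.
  - intro z. eapply Rle_trans; [apply Rabs_triang|]. apply Rplus_le_compat_r.
    pose proof (exp_pos (a * z)). specialize (P1 z). specialize (P2 z). specialize (Hee z).
    rewrite Rabs_right by nra. nra.
  - intro z. replace (a * ((Q z + q) * exp (a * z) + K / a) + G z)
      with ((H z + a * (Q z + q)) * exp (a * z) + 0).
    + apply (is_derive_plus (fun z => (Q z + q) * exp (a * z)) (fun _ => K / a)); [|apply (is_derive_const (K / a))].
      apply (exp_weight_derive (fun z => Q z + q)).
      replace (H z) with (H z + 0) by ring.
      apply (is_derive_plus Q (fun _ => q)); [apply HQ|apply (is_derive_const q)].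
    + unfold H. specialize (Hee z).
      replace (((G z + K) * exp (- a * z) + a * (Q z + q)) * exp (a * z))
        with ((G z + K) * (exp (- a * z) * exp (a * z)) + a * (Q z + q) * exp (a * z)) by ring.
      rewrite Hee. field. lra.
Qed.

Lemma first_order_pos a G K : 0 < a -> (forall z, continuous G z) -> (forall z, Rabs (G z) <= K) ->
  exists p B, (forall z, Rabs (p z) <= B) /\ forall z, is_derive p z (a * p z + G z).
Proof.
  intros Ha Hc HK.
  destruct (first_order_neg (- a) (fun z => - G (- z)) K) as (p & B & HB & Hp); [lra| | |].
  - intro z. apply (continuous_opp (fun z => G (- z))). apply (continuous_comp Ropp G); [|apply Hc].
    apply (is_derive_continuous _ z (-1)). auto_derive; [trivial|ring].
  - intro z. rewrite Rabs_Ropp. apply HK.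
  - exists (fun z => p (- z)), B. split; [intro z; apply HB|].
    intro z. replace (a * p (- z) + G z) with (- (- a * p (- z) + - G (- (- z)))).
    + apply is_derive_reflect, Hp.
    + rewrite Ropp_involutive. ring.
Qed.

(** Solve the two first-order factors in turn: [p = y' - z2 y] satisfies [p' = z1 p - G], and then
    [y' = z2 y + p]. *)
Lemma lin_sol_exists c G K : (forall z, continuous G z) -> (forall z, Rabs (G z) <= K) ->
  exists y y1 M, lin_sol c G y y1 /\ forall z, Rabs (y z) <= M.
Proof.
  intros Hc HK. destruct (quadratic_roots c) as (z1 & z2 & Hz1 & Hz2 & Hs & Hp).
  destruct (first_order_neg z1 (fun z => - G z) K Hz1) as (p & B & HB & Dp).
  - intro z. apply (continuous_opp G), Hc.
  - intro z. rewrite Rabs_Ropp. apply HK.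
  - destruct (first_order_pos z2 p B Hz2) as (y & M & HM & Dy).
    + intro z. eapply is_derive_continuous, Dp.
    + exact HB.
    + exists y, (fun z => z2 * y z + p z), M. split; [|exact HM]. split; [exact Dy|].
      intro z. replace (c * (z2 * y z + p z) + y z - G z)
        with (z2 * (z2 * y z + p z) + (z1 * p z + - G z)).
      * apply (is_derive_plus (fun z => z2 * y z) p); [|apply Dp]. apply (is_derive_scal y z z2), Dy.
      * assert (E : z1 * z2 * y z = - y z) by (rewrite Hp; ring). rewrite <- Hs. lra.
Qed.

(** The deficit [m - y] is compared with a multiple of [exp (z1 (z - Z))], a decaying solution of
    the homogeneous equation. *)
Lemma lin_sol_liminf c G y y1 M m Z : lin_sol c G y y1 -> (forall z, Rabs (y z) <= M) ->
  (forall z, Z <= z -> m <= G z) ->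
  forall eps, 0 < eps -> exists Z', forall z, Z' <= z -> m - eps <= y z.
Proof.
  intros [D1 D2] HM HG eps He.
  destruct (quadratic_roots c) as (z1 & z2 & Hz1 & Hz2 & Hs & Hp).
  (* To the left of [Z] this multiple already exceeds any possible deficit, so the source has to be
     known only to the right of [Z]. *)
  set (C := Rabs m + M).
  assert (HC : 0 <= C).
  { unfold C. pose proof (Rabs_pos m). specialize (HM 0). pose proof (Rabs_pos (y 0)). lra. }
  set (w := fun z => m - y z - C * exp (z1 * (z - Z))).
  set (w1 := fun z => 0 - y1 z - C * (z1 * exp (z1 * (z - Z)))).
  assert (Dw : forall z, is_derive w z (w1 z)).
  { intro z. apply (is_derive_minus (fun z => m - y z) (fun z => C * exp (z1 * (z - Z)))).
    - apply (is_derive_minus (fun _ => m) y); [apply (is_derive_const m)|apply D1].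
    - apply is_derive_exp_affine. }
  assert (Hw : forall z, w z <= 0).
  { apply (line_max_principle c w (Rabs m + M)).
    - intro z. apply (is_derive_continuous w z (w1 z)), Dw.
    - intro z. unfold w. specialize (HM z). apply Rabs_le_between in HM.
      pose proof (Rle_abs m). pose proof (exp_pos (z1 * (z - Z))). nra.
    - intros z Hz.
      assert (HzZ : Z <= z).
      { destruct (Rle_lt_dec Z z) as [h|h]; [exact h|exfalso]. unfold w in Hz.
        assert (1 <= exp (z1 * (z - Z))).
        { apply exp_ge_1. nra. }
        specialize (HM z). apply Rabs_le_between in HM. pose proof (Rle_abs m). unfold C in *. nra. }
      exists w, w1, (0 - (c * y1 z + y z - G z) - C * (z1 * (z1 * exp (z1 * (z - Z))))).
      split; [reflexivity|split; [intro; lra|split; [exact Dw|split]]].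
      + apply (is_derive_minus (fun z => 0 - y1 z) (fun z => C * (z1 * exp (z1 * (z - Z))))).
        * apply (is_derive_minus (fun _ => 0) y1); [apply (is_derive_const 0)|apply D2].
        * apply (is_derive_ext (fun z => C * z1 * exp (z1 * (z - Z)))); [intro; apply Rmult_assoc|].
          replace (C * (z1 * (z1 * exp (z1 * (z - Z))))) with (C * z1 * (z1 * exp (z1 * (z - Z)))) by ring.
          apply is_derive_exp_affine.
      + unfold w, w1. specialize (HG z HzZ).
        assert (E : z1 * z1 - c * z1 - 1 = 0) by (rewrite <- Hs; nra).
        replace (0 - (c * y1 z + y z - G z) - C * (z1 * (z1 * exp (z1 * (z - Z)))) -
          c * (0 - y1 z - C * (z1 * exp (z1 * (z - Z)))) - (m - y z - C * exp (z1 * (z - Z))))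
          with (G z - m - C * exp (z1 * (z - Z)) * (z1 * z1 - c * z1 - 1)) by ring.
        rewrite E. lra. }
  assert (Hdec : exists T, 0 <= T /\ forall t, T <= t -> C * exp (z1 * t) <= eps).
  { exists (C / eps / - z1). split.
    - apply Rdiv_le_0_compat; [apply Rdiv_le_0_compat; lra|lra].
    - intros t Ht.
      assert (Hu : C / eps <= - z1 * t).
      { apply Rmult_le_compat_l with (r := - z1) in Ht; [|lra].
        replace (- z1 * (C / eps / - z1)) with (C / eps) in Ht by (field; lra). lra. }
      assert (He2 : C / eps <= exp (- z1 * t)).
      { pose proof (exp_ineq1_le (- z1 * t)). lra. }
      assert (He3 : exp (- z1 * t) * exp (z1 * t) = 1).
      { rewrite <- exp_plus. replace (- z1 * t + z1 * t) with 0 by ring. apply exp_0. }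
      pose proof (exp_pos (z1 * t)).
      assert (C <= eps * exp (- z1 * t)).
      { apply Rmult_le_compat_l with (r := eps) in He2; [|lra].
        replace (eps * (C / eps)) with C in He2 by (field; lra). exact He2. }
      nra. }
  destruct Hdec as (T & HT & Hdec).
  exists (Z + T). intros z Hz. specialize (Hw z). unfold w in Hw.
  specialize (Hdec (z - Z) ltac:(lra)). lra.
Qed.

(** The quantity [y' - c y + e z] is nonincreasing, and [c y] is bounded, so [y'] tends to minus
    infinity and [y] cannot stay bounded. *)
Lemma no_escape_right c (y y1 y2 : R -> R) M e Z : 0 < e ->
  (forall z, is_derive y z (y1 z)) -> (forall z, is_derive y1 z (y2 z)) -> (forall z, Rabs (y z) <= M) ->
  (forall z, Z <= z -> y2 z - c * y1 z <= - e) -> False.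
Proof.
  intros He D1 D2 HM H.
  assert (HM0 : 0 <= M) by (specialize (HM 0); pose proof (Rabs_pos (y 0)); lra).
  assert (Q : forall z, Z <= z -> y1 z - c * y z + e * z <= y1 Z - c * y Z + e * Z).
  { intros z Hz.
    enough (- (y1 Z - c * y Z + e * Z) <= - (y1 z - c * y z + e * z)) by lra.
    apply (derive_nonneg_le (fun z => - (y1 z - c * y z + e * z)) (fun z => - (y2 z - c * y1 z + e * 1))); [exact Hz| |].
    - intros x _. apply (is_derive_opp (fun z => y1 z - c * y z + e * z)).
      apply (is_derive_plus (fun z => y1 z - c * y z) (fun z => e * z)).
      + apply (is_derive_minus y1 (fun z => c * y z)); [apply D2|]. apply (is_derive_scal y x c), D1.
      + apply is_derive_linear.
    - intros x Hx. specialize (H x ltac:(lra)). lra. }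
  set (B := Rabs (y1 Z - c * y Z) + Rabs c * M + 1).
  assert (HB : 0 < B).
  { unfold B. pose proof (Rabs_pos (y1 Z - c * y Z)). pose proof (Rabs_pos c). nra. }
  set (Z' := Z + B / e).
  assert (HZ' : Z <= Z') by (unfold Z'; assert (0 < B / e) by (apply Rdiv_lt_0_compat; lra); lra).
  assert (D : forall z, Z' <= z -> y1 z <= - 1).
  { intros z Hz. specialize (Q z ltac:(lra)).
    assert (e * (z - Z) >= B).
    { apply Rle_ge. apply Rle_trans with (e * (B / e)); [right; field; lra|]. apply Rmult_le_compat_l; [lra|unfold Z' in Hz; lra]. }
    assert (c * y z <= Rabs c * M).
    { eapply Rle_trans; [apply Rle_abs|]. rewrite Rabs_mult. apply Rmult_le_compat_l; [apply Rabs_pos|apply HM]. }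
    pose proof (Rle_abs (y1 Z - c * y Z)). unfold B in *. lra. }
  assert (K : y (Z' + (2 * M + 1)) + 1 * (Z' + (2 * M + 1)) <= y Z' + 1 * Z').
  { enough (- (y Z' + 1 * Z') <= - (y (Z' + (2 * M + 1)) + 1 * (Z' + (2 * M + 1)))) by lra.
    apply (derive_nonneg_le (fun z => - (y z + 1 * z)) (fun z => - (y1 z + 1 * 1))); [lra| |].
    - intros x _. apply (is_derive_opp (fun z => y z + 1 * z)). apply (is_derive_plus y (fun z => 1 * z)); [apply D1|].
      apply is_derive_linear.
    - intros x Hx. specialize (D x ltac:(lra)). lra. }
  pose proof (HM Z') as K1. pose proof (HM (Z' + (2 * M + 1))) as K2.
  apply Rabs_le_between in K1. apply Rabs_le_between in K2. lra.
Qed.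

(** If the limits differed, [y'' - c y' = y - G] would keep a fixed sign, away from 0, on a
    half-line. This identifies the limits of wave profiles as fixed points of [g]. *)
Lemma limit_balance_right c G y y1 M l m : lin_sol c G y y1 -> (forall z, Rabs (y z) <= M) ->
  (forall eps, 0 < eps -> exists Z, forall z, Z <= z -> Rabs (y z - l) <= eps) ->
  (forall eps, 0 < eps -> exists Z, forall z, Z <= z -> Rabs (G z - m) <= eps) -> m = l.
Proof.
  intros [D1 D2] HM Hy HG.
  destruct (Rtotal_order m l) as [h|[h|h]]; [exfalso|exact h|exfalso].
  - destruct (Hy ((l - m) / 3) ltac:(lra)) as [Z1 H1]. destruct (HG ((l - m) / 3) ltac:(lra)) as [Z2 H2].
    apply (no_escape_right c (fun z => - y z) (fun z => - y1 z) (fun z => - (c * y1 z + y z - G z)) M ((l - m) / 3) (Rmax Z1 Z2)).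
    + lra.
    + intro z. apply (is_derive_opp y), D1.
    + intro z. apply (is_derive_opp y1), D2.
    + intro z. rewrite Rabs_Ropp. apply HM.
    + intros z Hz. pose proof (Rmax_l Z1 Z2). pose proof (Rmax_r Z1 Z2).
      specialize (H1 z ltac:(lra)). specialize (H2 z ltac:(lra)).
      apply Rabs_le_between in H1. apply Rabs_le_between in H2. lra.
  - destruct (Hy ((m - l) / 3) ltac:(lra)) as [Z1 H1]. destruct (HG ((m - l) / 3) ltac:(lra)) as [Z2 H2].
    apply (no_escape_right c y y1 (fun z => c * y1 z + y z - G z) M ((m - l) / 3) (Rmax Z1 Z2)).
    + lra.
    + apply D1.
    + apply D2.
    + apply HM.
    + intros z Hz. pose proof (Rmax_l Z1 Z2). pose proof (Rmax_r Z1 Z2).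
      specialize (H1 z ltac:(lra)). specialize (H2 z ltac:(lra)).
      apply Rabs_le_between in H1. apply Rabs_le_between in H2. lra.
Qed.

Lemma lin_sol_reflect c G y y1 : lin_sol c G y y1 ->
  lin_sol (- c) (fun z => G (- z)) (fun z => y (- z)) (fun z => - y1 (- z)).
Proof.
  intros [A B]. split; intro z; [apply is_derive_reflect, A|].
  replace (- c * - y1 (- z) + y (- z) - G (- z)) with (- - (c * y1 (- z) + y (- z) - G (- z))) by ring.
  apply (is_derive_opp (fun z => y1 (- z))). apply is_derive_reflect, B.
Qed.

Lemma limit_balance_left c G y y1 M l m : lin_sol c G y y1 -> (forall z, Rabs (y z) <= M) ->
  (forall eps, 0 < eps -> exists Z, forall z, z <= Z -> Rabs (y z - l) <= eps) ->
  (forall eps, 0 < eps -> exists Z, forall z, z <= Z -> Rabs (G z - m) <= eps) -> m = l.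
Proof.
  intros S HM Hy HG.
  apply (limit_balance_right (- c) (fun z => G (- z)) (fun z => y (- z)) (fun z => - y1 (- z)) M l m).
  - apply lin_sol_reflect, S.
  - intro z; apply HM.
  - intros eps He. destruct (Hy eps He) as [Z HZ]. exists (- Z). intros z Hz. apply HZ. lra.
  - intros eps He. destruct (HG eps He) as [Z HZ]. exists (- Z). intros z Hz. apply HZ. lra.
Qed.

(** * Existence of wavefronts below a supersolution *)

(** In the moving coordinate [z = x + c t] the delay [h] becomes the shift [tau = c h]. *)
Definition delayed (g : R -> R) (tau : R) (a : R -> R) : R -> R := fun z => g (a (z - tau)).

Definition profile (kappa : R) (a : R -> R) := (forall z, continuous a z) /\ (forall z, 0 <= a z <= kappa).

Lemma continuous_shift (a : R -> R) s : (forall z, continuous a z) -> forall z, continuous (fun x => a (x + s)) z.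
Proof.
  intros H z. apply (continuous_comp (fun x => x + s) a); [|apply H].
  apply (is_derive_continuous _ z 1). auto_derive; [trivial|ring].
Qed.

Lemma delayed_continuous {g kappa k0 k1 L} tau a : monostable g kappa k0 k1 L -> (forall z, continuous a z) ->
  forall z, continuous (delayed g tau a) z.
Proof.
  intros Hg Ha z. unfold delayed. apply (continuous_comp (fun x => a (x - tau)) g).
  - apply (continuous_shift a (- tau) Ha z).
  - apply (monostable_continuous Hg).
Qed.

Lemma delayed_bounds {g kappa k0 k1 L} tau a : monostable g kappa k0 k1 L -> (forall z, 0 <= a z <= kappa) ->
  forall z, 0 <= delayed g tau a z <= kappa.
Proof.
  intros Hg Ha z. unfold delayed. specialize (Ha (z - tau)).
  pose proof (ms_mono Hg 0 (a (z - tau)) ltac:(lra)).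
  pose proof (ms_mono Hg (a (z - tau)) kappa ltac:(lra)).
  rewrite (ms_zero Hg) in *. rewrite (ms_fix Hg) in *. lra.
Qed.

Lemma profile_abs kappa a : profile kappa a -> forall z, Rabs (a z) <= kappa.
Proof. intros [_ H] z. specialize (H z). apply Rabs_le. lra. Qed.

Lemma profile_solution {g kappa k0 k1 L} c tau a : monostable g kappa k0 k1 L -> profile kappa a ->
  exists y y1, lin_sol c (delayed g tau a) y y1 /\ profile kappa y.
Proof.
  intros Hg [Hc Hb].
  destruct (lin_sol_exists c (delayed g tau a) kappa) as (y & y1 & M & HS & HM).
  - apply (@delayed_continuous g kappa k0 k1 L); assumption.
  - intro z. pose proof (delayed_bounds tau a Hg Hb z). apply Rabs_le. lra.
  - exists y, y1. split; [exact HS|]. split; [apply (lin_sol_continuous _ _ _ _ HS)|].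
    apply (lin_sol_bounds c (delayed g tau a) y y1 M); [exact HS|exact HM|].
    apply (@delayed_bounds g kappa k0 k1 L); assumption.
Qed.

(** Choice turns the solution of the linear problem into an operator that can be iterated; outside
    the class of profiles its value is arbitrary. *)
Lemma profile_operator {g kappa k0 k1 L} c tau : monostable g kappa k0 k1 L ->
  exists F : (R -> R) -> R -> R, forall a, profile kappa a ->
    profile kappa (F a) /\ exists y1, lin_sol c (delayed g tau a) (F a) y1.
Proof.
  intro Hg. apply (functional_choice (fun a y => profile kappa a -> profile kappa y /\ exists y1, lin_sol c (delayed g tau a) y y1)).
  intro a. destruct (classic (profile kappa a)) as [h|h].
  - destruct (profile_solution c tau a Hg h) as (y & y1 & H1 & H2).
    exists y. intros _. split; [exact H2|]. exists y1. exact H1.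
  - exists a. intro h'. contradiction.
Qed.

Lemma is_lim_seq_lipschitz (f : nat -> R -> R) (l : R -> R) Lam :
  (forall n x y, Rabs (f n x - f n y) <= Lam * Rabs (x - y)) ->
  (forall x, is_lim_seq (fun n => f n x) (Finite (l x))) ->
  forall x y, Rabs (l x - l y) <= Lam * Rabs (x - y).
Proof.
  intros HL Hl x y.
  apply (is_lim_seq_le (fun n => Rabs (f n x - f n y)) (fun _ => Lam * Rabs (x - y)) (Rabs (l x - l y)) (Lam * Rabs (x - y))).
  - intro n. apply HL.
  - apply (is_lim_seq_abs (fun n => f n x - f n y) (l x - l y)). apply is_lim_seq_minus'; apply Hl.
  - apply is_lim_seq_const.
Qed.

(** Upgrades pointwise convergence to the weighted uniform convergence that [lin_sol_compare]
    accepts: a finite grid handles a bounded interval, and beyond it the weight alone dominates the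
    bound [2 M]. *)
Lemma lipschitz_limit_quadratic (f : nat -> R -> R) (l : R -> R) Lam M :
  0 <= Lam -> (forall n x y, Rabs (f n x - f n y) <= Lam * Rabs (x - y)) ->
  (forall n x, Rabs (f n x) <= M) ->
  (forall x, is_lim_seq (fun n => f n x) (Finite (l x))) ->
  forall eps, 0 < eps -> exists N, forall n, (N <= n)%nat -> forall x, Rabs (f n x - l x) <= eps * (1 + x ^ 2).
Proof.
  intros HLam HL HM Hl eps He.
  assert (HLl := is_lim_seq_lipschitz f l Lam HL Hl).
  assert (HMl : forall x, Rabs (l x) <= M).
  { intro x. apply (is_lim_seq_le (fun n => Rabs (f n x)) (fun _ => M) (Rabs (l x)) M).
    - intro n. apply HM.
    - apply (is_lim_seq_abs (fun n => f n x) (l x)), Hl.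
    - apply is_lim_seq_const. }
  assert (HM0 : 0 <= M) by (specialize (HMl 0); pose proof (Rabs_pos (l 0)); lra).
  set (X := 1 + 2 * M / eps).
  assert (HX : 1 <= X) by (unfold X; assert (0 <= 2 * M / eps) by (apply Rdiv_le_0_compat; lra); lra).
  set (d := eps / (4 * (Lam + 1))).
  assert (Hd : 0 < d) by (apply Rdiv_lt_0_compat; lra).
  assert (Hgrid : forall m : nat, exists N, forall n, (N <= n)%nat -> forall i : nat, (i <= m)%nat ->
     Rabs (f n (- X + INR i * d) - l (- X + INR i * d)) <= eps / 2).
  { induction m as [|m [N1 IH]].
    - destruct (proj1 (is_lim_seq_eps _ _) (Hl (- X + INR 0 * d)) (eps / 2) ltac:(lra)) as [N HN].
      exists N. intros n Hn i Hi. assert (i = O) by lia. subst i. left. apply HN, Hn.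
    - destruct (proj1 (is_lim_seq_eps _ _) (Hl (- X + INR (S m) * d)) (eps / 2) ltac:(lra)) as [N HN].
      exists (Nat.max N N1). intros n Hn i Hi. destruct (Nat.eq_dec i (S m)) as [->|Hne].
      + left. apply HN. lia.
      + apply IH; lia. }
  set (m := Z.to_nat (up (2 * X / d))).
  assert (Hm : 2 * X / d < INR m).
  { unfold m. destruct (archimed (2 * X / d)) as [U _].
    assert (0 < 2 * X / d) by (apply Rdiv_lt_0_compat; lra).
    assert (0 <= up (2 * X / d))%Z by (apply le_IZR; lra).
    rewrite INR_IZR_INZ, Z2Nat.id by assumption. lra. }
  destruct (Hgrid m) as [N HN]. exists N. intros n Hn x.
  destruct (Rle_lt_dec (Rabs x) X) as [h|h].
  - apply Rabs_le_between in h.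
    assert (Hi : exists i, (i <= m)%nat /\ Rabs (x - (- X + INR i * d)) <= d).
    { set (i := Z.to_nat (up ((x + X) / d) - 1)).
      destruct (archimed ((x + X) / d)) as [U1 U2].
      assert (H0 : 0 <= (x + X) / d) by (apply Rdiv_le_0_compat; lra).
      assert (Hz : (0 <= up ((x + X) / d) - 1)%Z).
      { assert (0 < up ((x + X) / d))%Z by (apply lt_IZR; lra). lia. }
      assert (Hi : INR i = IZR (up ((x + X) / d)) - 1).
      { unfold i. rewrite INR_IZR_INZ, Z2Nat.id, minus_IZR by assumption. reflexivity. }
      exists i.
      assert (Hb : (x + X) / d <= 2 * X / d).
      { unfold Rdiv. apply Rmult_le_compat_r; [left; apply Rinv_0_lt_compat, Hd|lra]. }
      split.
      - apply INR_le. lra.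
      - replace (x - (- X + INR i * d)) with (((x + X) / d - INR i) * d) by (field; lra).
        rewrite Rabs_mult, (Rabs_right d) by lra.
        rewrite Rabs_right by lra. nra. }
    destruct Hi as (i & Hi & Hx).
    specialize (HN n Hn i Hi). set (p := - X + INR i * d) in *.
    assert (K1 := HL n x p). assert (K2 := HLl x p).
    assert (K3 : Lam * Rabs (x - p) <= eps / 4).
    { apply Rle_trans with (Lam * d); [apply Rmult_le_compat_l; lra|]. unfold d.
      replace (eps / 4) with ((Lam + 1) * (eps / (4 * (Lam + 1)))) by (field; lra).
      apply Rmult_le_compat_r; [fold d; lra|lra]. }
    replace (f n x - l x) with ((f n x - f n p) + (f n p - l p) + - (l x - l p)) by ring.
    assert (Rabs (f n x - f n p + (f n p - l p) + - (l x - l p)) <= eps).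
    { eapply Rle_trans; [apply Rabs_triang|]. rewrite Rabs_Ropp.
      pose proof (Rabs_triang (f n x - f n p) (f n p - l p)). lra. }
    pose proof (pow2_ge_0 x). nra.
  - assert (Hx2 : X <= x ^ 2). { rewrite <- (pow2_abs x). nra. }
    assert (2 * M <= eps * X).
    { unfold X. rewrite Rmult_plus_distr_l. replace (eps * (2 * M / eps)) with (2 * M) by (field; lra). lra. }
    specialize (HM n x). specialize (HMl x).
    unfold Rminus. eapply Rle_trans; [apply Rabs_triang|]. rewrite Rabs_Ropp. nra.
Qed.

Lemma monotone_limit_right (a : R -> R) M : (forall x y, x <= y -> a x <= a y) -> (forall x, a x <= M) ->
  exists l, l <= M /\ (forall x, a x <= l) /\ forall eps, 0 < eps -> exists Z, forall z, Z <= z -> Rabs (a z - l) <= eps.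
Proof.
  intros Hm HM. destruct (completeness (fun v => exists x, v = a x)) as [l [Hub Hlub]].
  - exists M. intros v (x & ->). apply HM.
  - exists (a 0), 0. reflexivity.
  - exists l. split; [apply Hlub; intros v (x & ->); apply HM|]. split; [intro x; apply Hub; exists x; reflexivity|].
    intros eps He.
    assert (HZ : exists Z, l - eps < a Z).
    { apply NNPP. intro Hn. assert (l <= l - eps); [|lra]. apply Hlub. intros v (x & ->).
      destruct (Rle_lt_dec (a x) (l - eps)); [assumption|]. exfalso. apply Hn. exists x. assumption. }
    destruct HZ as [Z HZ]. exists Z. intros z Hz. specialize (Hm Z z Hz).
    assert (a z <= l) by (apply Hub; exists z; reflexivity). apply Rabs_le. lra.
Qed.

Lemma monotone_limit_left (a : R -> R) m : (forall x y, x <= y -> a x <= a y) -> (forall x, m <= a x) ->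
  exists l, m <= l /\ (forall x, l <= a x) /\ forall eps, 0 < eps -> exists Z, forall z, z <= Z -> Rabs (a z - l) <= eps.
Proof.
  intros Hm HM. destruct (monotone_limit_right (fun z => - a (- z)) (- m)) as (l & H1 & H2 & H3).
  - intros x y Hxy. specialize (Hm (- y) (- x) ltac:(lra)). lra.
  - intro x. specialize (HM (- x)). lra.
  - exists (- l). split; [lra|]. split.
    + intro x. specialize (H2 (- x)). rewrite Ropp_involutive in H2. lra.
    + intros eps He. destruct (H3 eps He) as [Z HZ]. exists (- Z). intros z Hz.
      specialize (HZ (- z) ltac:(lra)). rewrite Ropp_involutive in HZ.
      rewrite <- Rabs_Ropp. replace (- (a z - - l)) with (- a z - l) by ring. exact HZ.
Qed.

Lemma lin_sol_wave g h c phi phi1 : lin_sol c (delayed g (c * h) phi) phi phi1 -> forall s,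
  ex_derive phi s /\ ex_derive (Derive phi) s /\
     Derive_n phi 2 s - c * Derive phi s - phi s + g (phi (s - c * h)) = 0.
Proof.
  intros [D1 D2] s.
  assert (E : forall z, Derive phi z = phi1 z) by (intro z; apply is_derive_unique, D1).
  assert (D : is_derive (Derive phi) s (c * phi1 s + phi s - delayed g (c * h) phi s)).
  { apply (is_derive_ext phi1); [intro t; symmetry; apply E|apply D2]. }
  split; [exists (phi1 s); apply D1|]. split; [eexists; exact D|].
  change (Derive_n phi 2 s) with (Derive (Derive phi) s).
  rewrite (is_derive_unique _ _ _ D), E. unfold delayed. ring.
Qed.

Lemma wave_lin_sol g h c phi : (forall s, ex_derive phi s /\ ex_derive (Derive phi) s /\
     Derive_n phi 2 s - c * Derive phi s - phi s + g (phi (s - c * h)) = 0) ->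
  lin_sol c (delayed g (c * h) phi) phi (Derive phi).
Proof.
  intro H. split; intro z; destruct (H z) as (A & B & C).
  - apply Derive_correct, A.
  - change (Derive_n phi 2 z) with (Derive (Derive phi) z) in C.
    replace (c * Derive phi z + phi z - delayed g (c * h) phi z) with (Derive (Derive phi) z).
    + apply Derive_correct, B.
    + unfold delayed. lra.
Qed.

Lemma is_lim_p_infty_eps (f : R -> R) (l : R) :
  is_lim f p_infty l <-> forall eps, 0 < eps -> exists Z, forall z, Z <= z -> Rabs (f z - l) <= eps.
Proof.
  split; intro H.
  - intros eps He. apply is_lim_spec in H. destruct (H (mkposreal eps He)) as [Z HZ].
    exists (Z + 1). intros z Hz. left. apply HZ. lra.
  - apply is_lim_spec. intros eps. pose proof (cond_pos eps). destruct (H (eps / 2) ltac:(lra)) as [Z HZ].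
    exists Z. intros z Hz. specialize (HZ z ltac:(lra)). simpl. lra.
Qed.

Lemma is_lim_m_infty_eps (f : R -> R) (l : R) :
  is_lim f m_infty l <-> forall eps, 0 < eps -> exists Z, forall z, z <= Z -> Rabs (f z - l) <= eps.
Proof.
  split; intro H.
  - intros eps He. apply is_lim_spec in H. destruct (H (mkposreal eps He)) as [Z HZ].
    exists (Z - 1). intros z Hz. left. apply HZ. lra.
  - apply is_lim_spec. intros eps. pose proof (cond_pos eps). destruct (H (eps / 2) ltac:(lra)) as [Z HZ].
    exists Z. intros z Hz. specialize (HZ z ltac:(lra)). simpl. lra.
Qed.

Lemma delayed_tends_right {g kappa k0 k1 L} tau (a : R -> R) l : monostable g kappa k0 k1 L ->
  (forall eps, 0 < eps -> exists Z, forall z, Z <= z -> Rabs (a z - l) <= eps) ->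
  forall eps, 0 < eps -> exists Z, forall z, Z <= z -> Rabs (delayed g tau a z - g l) <= eps.
Proof.
  intros Hg Ha eps He. pose proof (ms_L Hg).
  destruct (Ha (eps / L)) as [Z HZ]; [apply Rdiv_lt_0_compat; lra|].
  exists (Z + tau). intros z Hz. specialize (HZ (z - tau) ltac:(lra)). unfold delayed.
  eapply Rle_trans; [apply (monostable_abs_lip Hg)|].
  apply Rmult_le_compat_l with (r := L) in HZ; [|lra].
  replace (L * (eps / L)) with eps in HZ by (field; lra). exact HZ.
Qed.

Lemma delayed_tends_left {g kappa k0 k1 L} tau (a : R -> R) l : monostable g kappa k0 k1 L ->
  (forall eps, 0 < eps -> exists Z, forall z, z <= Z -> Rabs (a z - l) <= eps) ->
  forall eps, 0 < eps -> exists Z, forall z, z <= Z -> Rabs (delayed g tau a z - g l) <= eps.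
Proof.
  intros Hg Ha eps He. pose proof (ms_L Hg).
  destruct (Ha (eps / L)) as [Z HZ]; [apply Rdiv_lt_0_compat; lra|].
  exists (Z + tau). intros z Hz. specialize (HZ (z - tau) ltac:(lra)). unfold delayed.
  eapply Rle_trans; [apply (monostable_abs_lip Hg)|].
  apply Rmult_le_compat_l with (r := L) in HZ; [|lra].
  replace (L * (eps / L)) with eps in HZ by (field; lra). exact HZ.
Qed.

(** Both limits are fixed points of [g]. There is none strictly between 0 and [kappa], so the value
    [kappa / 2] at the origin decides which limit is which. *)
Lemma monotone_solution_wavefront {g kappa k0 k1 L} h c l l1 : monostable g kappa k0 k1 L ->
  profile kappa l -> (forall x y, x <= y -> l x <= l y) -> l 0 = kappa / 2 ->
  lin_sol c (delayed g (c * h) l) l l1 -> is_wavefront g h kappa c l.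
Proof.
  intros Hg Hp Hm H0 HS. pose proof (ms_kappa Hg) as Hk.
  destruct (monotone_limit_right l kappa Hm (fun x => proj2 (proj2 Hp x))) as (lr & R1 & R2 & R3).
  destruct (monotone_limit_left l 0 Hm (fun x => proj1 (proj2 Hp x))) as (ll & L1 & L2 & L3).
  assert (Er : g lr = lr).
  { apply (limit_balance_right c (delayed g (c * h) l) l l1 kappa lr (g lr) HS (profile_abs _ _ Hp) R3).
    apply (@delayed_tends_right g kappa k0 k1 L); assumption. }
  assert (El : g ll = ll).
  { apply (limit_balance_left c (delayed g (c * h) l) l l1 kappa ll (g ll) HS (profile_abs _ _ Hp) L3).
    apply (@delayed_tends_left g kappa k0 k1 L); assumption. }
  assert (Hr : lr = kappa).
  { destruct R1 as [R1|R1]; [|exact R1]. specialize (R2 0).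
    pose proof (ms_above Hg lr ltac:(lra)). lra. }
  assert (Hl : ll = 0).
  { destruct L1 as [L1|L1]; [|lra]. specialize (L2 0).
    pose proof (ms_above Hg ll ltac:(lra)). lra. }
  subst lr ll. split; [|split; [|split]].
  - destruct HS as [D1 D2].
    apply (harnack_positive c l l1 (fun z => c * l1 z + l z - delayed g (c * h) l z)); [exact D1|exact D2| | |].
    + intro z. pose proof (delayed_bounds (c * h) l Hg (proj2 Hp) z). lra.
    + intro z. apply Hp.
    + exists 0. lra.
  - apply is_lim_m_infty_eps, L3.
  - apply is_lim_p_infty_eps, R3.
  - apply (lin_sol_wave g h c l l1 HS).
Qed.

(** * Monotone iteration from ramp seeds *)

Definition ramp (z : R) : R := Rmin 1 (Rmax 0 z).

Lemma ramp_bounds z : 0 <= ramp z <= 1.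
Proof. unfold ramp. pose proof (Rmax_l 0 z). split; [apply Rmin_glb; lra|apply Rmin_l]. Qed.

Lemma ramp_left z : z <= 0 -> ramp z = 0.
Proof. intro H. unfold ramp. rewrite Rmax_left by lra. apply Rmin_right. lra. Qed.

Lemma ramp_right z : 1 <= z -> ramp z = 1.
Proof. intro H. unfold ramp. rewrite Rmax_right by lra. apply Rmin_left. lra. Qed.

Lemma Rabs_Rmax_le a b c d e : Rabs (a - c) <= e -> Rabs (b - d) <= e -> Rabs (Rmax a b - Rmax c d) <= e.
Proof.
  intros H1 H2. apply Rabs_le_between in H1. apply Rabs_le_between in H2. apply Rabs_le.
  unfold Rmax. destruct (Rle_dec a b), (Rle_dec c d); lra.
Qed.

Lemma Rabs_Rmin_le a b c d e : Rabs (a - c) <= e -> Rabs (b - d) <= e -> Rabs (Rmin a b - Rmin c d) <= e.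
Proof.
  intros H1 H2. apply Rabs_le_between in H1. apply Rabs_le_between in H2. apply Rabs_le.
  unfold Rmin. destruct (Rle_dec a b), (Rle_dec c d); lra.
Qed.

Lemma ramp_lipschitz x y : Rabs (ramp x - ramp y) <= Rabs (x - y).
Proof.
  unfold ramp. apply Rabs_Rmin_le.
  - replace (1 - 1) with 0 by ring. rewrite Rabs_R0. apply Rabs_pos.
  - apply Rabs_Rmax_le; [|lra]. replace (0 - 0) with 0 by ring. rewrite Rabs_R0. apply Rabs_pos.
Qed.

Lemma ramp_mono x y : x <= y -> ramp x <= ramp y.
Proof. intro H. unfold ramp. apply Rle_min_compat_l. apply Rle_max_compat_l, H. Qed.

Lemma profile_ext_sol {g kappa k0 k1 L} c tau a y y1 y' y1' : monostable g kappa k0 k1 L -> profile kappa a ->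
  lin_sol c (delayed g tau a) y y1 -> lin_sol c (delayed g tau a) y' y1' ->
  profile kappa y -> profile kappa y' -> forall z, y z = y' z.
Proof.
  intros Hg Ha S S' P P' z. apply Rle_antisym.
  - apply (lin_sol_le c _ _ y y1 y' y1' kappa S S'); try (apply profile_abs; assumption). intro; lra.
  - apply (lin_sol_le c _ _ y' y1' y y1 kappa S' S); try (apply profile_abs; assumption). intro; lra.
Qed.

(** The properties that drive Weinberger's iteration: order, translation invariance, a uniform
    Lipschitz bound and continuity under locally uniform limits. Profiles fixed by [F] are exactly
    the profiles solving the wave equation. *)
Record wave_operator (g : R -> R) (kappa c tau Lam : R) (F : (R -> R) -> R -> R) : Prop := {
  wo_sol : forall a, profile kappa a -> profile kappa (F a) /\ exists y1, lin_sol c (delayed g tau a) (F a) y1;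
  wo_le : forall a b, profile kappa a -> profile kappa b -> (forall z, a z <= b z) -> forall z, F a z <= F b z;
  wo_shift : forall a s, profile kappa a -> forall z, F (fun x => a (x + s)) z = F a (z + s);
  wo_lip : forall a, profile kappa a -> forall x y, Rabs (F a x - F a y) <= Lam * Rabs (x - y);
  wo_lim : forall f l K, (forall n, profile kappa (f n)) -> profile kappa l -> 0 <= K ->
    (forall n x y, Rabs (f n x - f n y) <= K * Rabs (x - y)) ->
    (forall x, is_lim_seq (fun n => f n x) (Finite (l x))) ->
    forall x, is_lim_seq (fun n => F (f n) x) (Finite (F l x)) }.
Arguments wo_sol {g kappa c tau Lam F} _.
Arguments wo_le {g kappa c tau Lam F} _.
Arguments wo_shift {g kappa c tau Lam F} _.
Arguments wo_lip {g kappa c tau Lam F} _.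
Arguments wo_lim {g kappa c tau Lam F} _.

Lemma profile_shift kappa a s : profile kappa a -> profile kappa (fun x => a (x + s)).
Proof. intros [A B]. split; [apply continuous_shift, A|intro z; apply B]. Qed.

Lemma derive_bound_lipschitz (y y1 : R -> R) Lam : (forall z, is_derive y z (y1 z)) -> (forall z, Rabs (y1 z) <= Lam) ->
  forall u v, Rabs (y u - y v) <= Lam * Rabs (u - v).
Proof.
  intros D H.
  assert (K : forall u v, u < v -> Rabs (y v - y u) <= Lam * Rabs (v - u)).
  { intros u v Huv. destruct (mean_value y y1 u v Huv (fun z _ => D z)) as (x & E & _).
    rewrite E, Rabs_mult. apply Rmult_le_compat_r; [apply Rabs_pos|apply H]. }
  intros u v. destruct (Rtotal_order u v) as [h|[h|h]].
  - rewrite (Rabs_minus_sym (y u)), (Rabs_minus_sym u). apply K, h.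
  - subst. replace (y v - y v) with 0 by ring. replace (v - v) with 0 by ring. rewrite Rabs_R0. lra.
  - apply K, h.
Qed.

Lemma wave_operator_exists {g kappa k0 k1 L} c tau : monostable g kappa k0 k1 L ->
  exists Lam F, 0 <= Lam /\ wave_operator g kappa c tau Lam F.
Proof.
  intro Hg. pose proof (ms_kappa Hg) as Hk. pose proof (ms_L Hg) as HL.
  destruct (quadratic_roots c) as (z1 & z2 & Hz1 & Hz2 & Hs & Hp).
  destruct (profile_operator c tau Hg) as [F HF].
  (* The Lipschitz constant comes from [z1 y <= y' <= z2 y] and [0 <= y <= kappa]. *)
  exists ((z2 - z1) * kappa), F. split; [apply Rmult_le_pos; lra|]. constructor.
  - exact HF.
  - intros a b Ha Hb Hab. destruct (HF a Ha) as [Pa [ya Sa]]. destruct (HF b Hb) as [Pb [yb Sb]].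
    apply (lin_sol_le c _ _ _ ya _ yb kappa Sa Sb (profile_abs _ _ Pa) (profile_abs _ _ Pb)).
    intro z. apply (ms_mono Hg), Hab.
  - intros a s Ha. destruct (HF a Ha) as [Pa [ya Sa]].
    destruct (HF (fun x => a (x + s)) (profile_shift _ _ s Ha)) as [Pb [yb Sb]].
    apply (profile_ext_sol c tau (fun x => a (x + s)) _ yb _ (fun x => ya (x + s)) Hg (profile_shift _ _ s Ha) Sb).
    + apply (lin_sol_ext c (fun z => delayed g tau a (z + s))).
      * intro z. unfold delayed. do 2 f_equal. ring.
      * apply lin_sol_shift, Sa.
    + exact Pb.
    + apply profile_shift, Pa.
  - intros a Ha. destruct (HF a Ha) as [Pa [ya [D1 D2]]].
    apply (derive_bound_lipschitz (F a) ya); [exact D1|].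
    assert (HH := harnack_derive c z1 z2 (F a) ya _ Hz1 Hz2 Hs Hp D1 D2).
    intro z. destruct (HH (fun z => ltac:(pose proof (delayed_bounds tau a Hg (proj2 Ha) z); lra))
                 (fun z => proj1 (proj2 Pa z)) z) as [A B].
    destruct (proj2 Pa z) as [C D]. apply Rabs_le. nra.
  - intros f l K Hf Hl HK HLip Hlim x.
    destruct (HF l Hl) as [Pl [yl Sl]].
    apply is_lim_seq_eps. intros eps He.
    set (Q := 2 * (3 + 2 * c ^ 2 + x ^ 2)).
    assert (HQ : 0 < Q) by (unfold Q; nra).
    destruct (lipschitz_limit_quadratic (fun n z => f n (z - tau)) (fun z => l (z - tau)) K kappa HK) with (eps := eps / (2 * L * Q)) as [N HN].
    + intros n u v. eapply Rle_trans; [apply HLip|]. right. do 2 f_equal. ring.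
    + intros n z. apply (profile_abs kappa (f n) (Hf n)).
    + intro z. apply Hlim.
    + apply Rdiv_lt_0_compat; [lra|]. apply Rmult_lt_0_compat; lra.
    + exists N. intros n Hn. specialize (HN n Hn).
      destruct (HF (f n) (Hf n)) as [Pn [yn Sn]].
      assert (Hc : forall z, Rabs (delayed g tau (f n) z - delayed g tau l z) <= eps / (2 * Q) * (1 + z ^ 2)).
      { intro z. unfold delayed. eapply Rle_trans; [apply (monostable_abs_lip Hg)|].
        specialize (HN z). apply Rmult_le_compat_l with (r := L) in HN; [|lra].
        replace (L * (eps / (2 * L * Q) * (1 + z ^ 2))) with (eps / (2 * Q) * (1 + z ^ 2)) in HN by (field; lra).
        exact HN. }
      assert (He' : 0 <= eps / (2 * Q)) by (apply Rdiv_le_0_compat; lra).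
      assert (K1 := lin_sol_compare c _ _ _ yn _ yl kappa _ Sn Sl (profile_abs _ _ Pn) (profile_abs _ _ Pl) He'
        (fun z => Rle_trans _ _ _ (Rle_abs _) (Hc z)) x).
      assert (K2 := lin_sol_compare c _ _ _ yl _ yn kappa _ Sl Sn (profile_abs _ _ Pl) (profile_abs _ _ Pn) He').
      specialize (K2 (fun z => Rle_trans _ _ _ (Rle_abs _) (eq_ind _ (fun t => t <= _) (Hc z) _ (Rabs_minus_sym _ _))) x).
      replace (2 * (eps / (2 * Q)) * (3 + 2 * c ^ 2 + x ^ 2)) with (eps / 2) in K1, K2 by (unfold Q; field; unfold Q in HQ; lra).
      apply Rabs_def1; lra.
Qed.

(** A supersolution is described by what the iteration needs, namely that profiles below [V] are
    sent below [V]. No derivative of [V] appears, so [V] may have kinks. *)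
Definition dominates_waves g kappa c tau (V : R -> R) :=
  forall a y y1, profile kappa a -> lin_sol c (delayed g tau a) y y1 -> profile kappa y ->
    (forall z, a z <= V z) -> forall z, y z <= V z.

Lemma lipschitz_profile kappa (a : R -> R) Lam : (forall x y, Rabs (a x - a y) <= Lam * Rabs (x - y)) ->
  (forall z, 0 <= a z <= kappa) -> profile kappa a.
Proof. intros H1 H2. split; [apply (lipschitz_continuous a Lam H1)|exact H2]. Qed.

(** Taking the maximum with the seed makes the iterates increase and keeps the limit away from the
    zero solution, while [V] keeps it small on the far left. The limit solves the wave equation up
    to an error controlled by the height [t] of the seed. *)
Lemma seeded_wave {g kappa k0 k1 L} c tau Lam F V t : monostable g kappa k0 k1 L -> 0 <= Lam ->
  wave_operator g kappa c tau Lam F -> dominates_waves g kappa c tau V ->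
  0 < t <= kappa -> (forall z, t * ramp z <= V z) ->
  (forall eps, 0 < eps -> exists Z, forall z, z <= Z -> V z <= eps) ->
  exists a m, profile kappa a /\ (forall x y, Rabs (a x - a y) <= (Lam + kappa) * Rabs (x - y)) /\
    (forall x y, x <= y -> a x <= a y) /\ (forall z, a z = Rmax (t * ramp z) (F a z)) /\ a m = kappa / 2.
Proof.
  intros Hg HLam HF HV Ht HtV HV0. pose proof (ms_kappa Hg) as Hk.
  set (al := fun z => t * ramp z).
  set (s := fix s n := match n with O => al | S m => fun z => Rmax (al z) (F (s m) z) end).
  set (Good := fun a : R -> R => profile kappa a /\ (forall x y, Rabs (a x - a y) <= (Lam + kappa) * Rabs (x - y)) /\
    (forall x y, x <= y -> a x <= a y) /\ (forall z, al z <= a z <= V z)).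
  assert (Hal0 : forall z, 0 <= al z <= kappa).
  { intro z. unfold al. pose proof (ramp_bounds z). nra. }
  assert (Hal : forall x y, Rabs (al x - al y) <= (Lam + kappa) * Rabs (x - y)).
  { intros x y. unfold al. replace (t * ramp x - t * ramp y) with (t * (ramp x - ramp y)) by ring.
    rewrite Rabs_mult, (Rabs_right t) by lra. pose proof (ramp_lipschitz x y). pose proof (Rabs_pos (ramp x - ramp y)).
    apply Rmult_le_compat; lra. }
  assert (Hal1 : forall x y, x <= y -> al x <= al y).
  { intros x y Hxy. unfold al. apply Rmult_le_compat_l; [lra|apply ramp_mono, Hxy]. }
  assert (Hstep : forall a, Good a -> Good (fun z => Rmax (al z) (F a z))).
  { intros a (A1 & A2 & A3 & A4). destruct (wo_sol HF a A1) as [P [y1 S]].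
    assert (Hlip : forall x y, Rabs (Rmax (al x) (F a x) - Rmax (al y) (F a y)) <= (Lam + kappa) * Rabs (x - y)).
    { intros x y. apply Rabs_Rmax_le; [apply Hal|].
      eapply Rle_trans; [apply (wo_lip HF a A1)|]. apply Rmult_le_compat_r; [apply Rabs_pos|lra]. }
    split; [|split; [exact Hlip|split]].
    - apply (lipschitz_profile kappa _ (Lam + kappa) Hlip). intro z. destruct P as [_ P]. specialize (P z). specialize (Hal0 z).
      split; [eapply Rle_trans; [|apply Rmax_l]; lra|apply Rmax_lub; lra].
    - intros x y Hxy. apply Rmax_lub.
      + eapply Rle_trans; [apply Hal1, Hxy|apply Rmax_l].
      + eapply Rle_trans; [|apply Rmax_r].
        replace (F a y) with (F a (x + (y - x))) by (f_equal; ring).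
        rewrite <- (wo_shift HF a (y - x) A1).
        apply (wo_le HF); [exact A1|apply profile_shift, A1|]. intro z. apply A3. lra.
    - intro z. split; [apply Rmax_l|]. apply Rmax_lub; [apply HtV|].
      apply (HV a (F a) y1 A1 S P (fun z => proj2 (A4 z))). }
  assert (HG : forall n, Good (s n)).
  { induction n as [|n IH]; [|apply Hstep, IH].
    split; [apply (lipschitz_profile kappa al (Lam + kappa) Hal Hal0)|]. split; [exact Hal|]. split; [exact Hal1|].
    intro z. split; [apply Rle_refl|apply HtV]. }
  assert (Hinc : forall n z, s n z <= s (S n) z).
  { induction n as [|n IH]; intro z.
    - apply Rmax_l.
    - simpl. apply Rle_max_compat_l. apply (wo_le HF (s n) (fun z => Rmax (al z) (F (s n) z))).
      + apply (HG n).
      + apply (HG (S n)).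
      + exact IH. }
  assert (Hlim : forall z, ex_finite_lim_seq (fun n => s n z)).
  { intro z. apply (ex_finite_lim_seq_incr _ kappa); [intro n; apply Hinc|].
    intro n. apply (proj2 (proj1 (HG n)) z). }
  apply functional_choice in Hlim. destruct Hlim as [a Ha].
  assert (HaL : forall x y, Rabs (a x - a y) <= (Lam + kappa) * Rabs (x - y)).
  { apply (is_lim_seq_lipschitz s a); [intro n; apply HG|exact Ha]. }
  assert (Hle : forall (u v : nat -> R) (x y : R), (forall n, u n <= v n) -> is_lim_seq u x -> is_lim_seq v y -> x <= y).
  { intros u v x y H1 H2 H3. exact (is_lim_seq_le u v x y H1 H2 H3). }
  assert (Hab : forall z, 0 <= a z <= kappa).
  { intro z. split.
    - apply (Hle (fun _ => 0) (fun n => s n z)); [intro n; apply (proj1 (HG n))|apply is_lim_seq_const|apply Ha].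
    - apply (Hle (fun n => s n z) (fun _ => kappa)); [intro n; apply (proj1 (HG n))|apply Ha|apply is_lim_seq_const]. }
  assert (HaP : profile kappa a) by (apply (lipschitz_profile kappa a _ HaL Hab)).
  assert (Ham : forall x y, x <= y -> a x <= a y).
  { intros x y Hxy. apply (Hle (fun n => s n x) (fun n => s n y)); [|apply Ha|apply Ha].
    intro n. apply (HG n), Hxy. }
  assert (HaV : forall z, al z <= a z <= V z).
  { intro z. split.
    - apply (Hle (fun _ => al z) (fun n => s n z)); [intro n; apply (HG n)|apply is_lim_seq_const|apply Ha].
    - apply (Hle (fun n => s n z) (fun _ => V z)); [intro n; apply (HG n)|apply Ha|apply is_lim_seq_const]. }
  assert (HaF : forall z, a z = Rmax (al z) (F a z)).
  { intro z.
    assert (HlF := wo_lim HF s a (Lam + kappa) (fun n => proj1 (HG n)) HaP ltac:(lra) (fun n => proj1 (proj2 (HG n))) Ha z).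
    assert (H1 : is_lim_seq (fun n => s (S n) z) (Rmax (al z) (F a z))).
    { simpl. apply is_lim_seq_eps. intros eps He. destruct (proj1 (is_lim_seq_eps _ _) HlF eps He) as [N HN].
      exists N. intros n Hn. specialize (HN n Hn).
      unfold Rmax in *. apply Rabs_def2 in HN.
      apply Rabs_def1; destruct (Rle_dec (al z) (F (s n) z)), (Rle_dec (al z) (F a z)); lra. }
    assert (H2 : is_lim_seq (fun n => s (S n) z) (a z)) by (apply (is_lim_seq_incr_1 (fun n => s n z)), Ha).
    apply is_lim_seq_unique in H1. apply is_lim_seq_unique in H2. rewrite H1 in H2. injection H2. intros; lra. }
  destruct (monotone_limit_right a kappa Ham (fun x => proj2 (Hab x))) as (l & Hl1 & Hl2 & Hl3).
  assert (Hl0 : 0 < l).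
  { specialize (Hl2 1). destruct (HaV 1) as [H1 _]. unfold al in H1. rewrite ramp_right in H1 by lra. lra. }
  (* If [l < kappa] then [g l > l], whereas [F a <= a <= l]. Far to the right [(F a)'' - c (F a)']
     would then be at most [- (g l - l) / 2], which a bounded function cannot sustain. *)
  assert (Hlk : l = kappa).
  { destruct Hl1 as [Hl1|Hl1]; [exfalso|exact Hl1].
    pose proof (ms_above Hg l ltac:(lra)) as Hgl.
    destruct (wo_sol HF a HaP) as [P [y1 [D1 D2]]].
    destruct (delayed_tends_right tau a l Hg Hl3 ((g l - l) / 2) ltac:(lra)) as [Z HZ].
    apply (no_escape_right c (F a) y1 (fun z => c * y1 z + F a z - delayed g tau a z) kappa ((g l - l) / 2) Z);
      [lra|exact D1|exact D2|apply profile_abs, P|].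
    intros z Hz. specialize (HZ z Hz). apply Rabs_le_between in HZ.
    assert (F a z <= a z) by (rewrite (HaF z); apply Rmax_r). specialize (Hl2 z). lra. }
  subst l.
  (* The profile runs from below [kappa / 4] to above [3 kappa / 4], so it crosses the level
     [kappa / 2] used for normalization. *)
  destruct (HV0 (kappa / 4) ltac:(lra)) as [Z0 HZ0].
  destruct (Hl3 (kappa / 4) ltac:(lra)) as [Z1 HZ1].
  set (Z2 := Rmin Z0 Z1).
  assert (Q0 : a Z2 <= kappa / 4).
  { eapply Rle_trans; [apply HaV|]. apply HZ0. apply Rmin_l. }
  assert (Q1 : 3 * kappa / 4 <= a Z1).
  { specialize (HZ1 Z1 (Rle_refl _)). apply Rabs_le_between in HZ1. lra. }
  destruct (IVT_gen a Z2 Z1 (kappa / 2)) as (m & _ & Hm).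
  - intro z. apply continuity_pt_filterlim. apply HaP.
  - rewrite Rmin_left, Rmax_right by lra. lra.
  - exists a, m. repeat split; try assumption; try apply HaP; try apply Hab.
Qed.

(* Letting the height of the seed tend to 0 while normalising the profiles at level kappa/2
   yields in the limit a wavefront. *)
Lemma wavefront_below_supersolution {g kappa k0 k1 L} h c V t0 : monostable g kappa k0 k1 L ->
  dominates_waves g kappa c (c * h) V -> 0 < t0 -> (forall z, t0 * ramp z <= V z) ->
  (forall z, 0 <= V z) ->
  (forall eps, 0 < eps -> exists Z, forall z, z <= Z -> V z <= eps) ->
  exists psi, is_wavefront g h kappa c psi.
Proof.
  intros Hg HV Ht0 HtV HVp HV0. pose proof (ms_kappa Hg) as Hk.
  destruct (wave_operator_exists c (c * h) Hg) as (Lam & F & HLam & HF).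
  set (t := fun k : nat => Rmin t0 kappa * / (INR k + 1)).
  assert (Hm0 : 0 < Rmin t0 kappa) by (apply Rmin_glb_lt; lra).
  assert (Htk : forall k, 0 < t k <= Rmin t0 kappa).
  { intro k. unfold t. pose proof (inv_INR_S_pos k).
    assert (/ (INR k + 1) <= 1). { rewrite <- Rinv_1. apply Rinv_le_contravar; pose proof (pos_INR k); lra. }
    split; nra. }
  assert (Hex : forall k, exists am : (R -> R) * R, let (a, m) := am in
    profile kappa a /\ (forall x y, Rabs (a x - a y) <= (Lam + kappa) * Rabs (x - y)) /\
    (forall x y, x <= y -> a x <= a y) /\ (forall z, a z = Rmax (t k * ramp z) (F a z)) /\ a m = kappa / 2).
  { intro k. specialize (Htk k). pose proof (Rmin_l t0 kappa). pose proof (Rmin_r t0 kappa).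
    destruct (seeded_wave c (c * h) Lam F V (t k) Hg HLam HF HV) as (a & m & H1).
    - lra.
    - intro z. eapply Rle_trans; [|apply HtV]. apply Rmult_le_compat_r; [apply ramp_bounds|lra].
    - exact HV0.
    - exists (a, m). exact H1. }
  apply functional_choice in Hex. destruct Hex as [am Ham].
  (* Recentring at the level [kappa / 2] prevents the limit from degenerating to one of the
     constants 0 and [kappa]. *)
  set (b := fun k z => fst (am k) (z + snd (am k))).
  assert (Hb : forall k, profile kappa (b k) /\ (forall x y, Rabs (b k x - b k y) <= (Lam + kappa) * Rabs (x - y)) /\
     (forall x y, x <= y -> b k x <= b k y) /\ (forall z, Rabs (b k z - F (b k) z) <= t k) /\ b k 0 = kappa / 2).
  { intro k. unfold b. specialize (Ham k). specialize (Htk k). destruct (am k) as [a m]. simpl. destruct Ham as (A1 & A2 & A3 & A4 & A5).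
    split; [apply profile_shift, A1|]. split; [|split; [|split]].
    - intros x y. replace (x - y) with ((x + m) - (y + m)) by ring. apply A2.
    - intros x y Hxy. apply A3. lra.
    (* The maximum of the seed and [F a], both nonnegative, differs from [F a] by at most the height
       of the seed; so the defect vanishes in the limit. *)
    - intro z. rewrite (wo_shift HF a m A1). rewrite (A4 (z + m)).
      pose proof (ramp_bounds (z + m)).
      assert (0 <= F a (z + m)) by (apply (wo_sol HF a A1)).
      unfold Rmax. destruct (Rle_dec (t k * ramp (z + m)) (F a (z + m))); apply Rabs_le; nra.
    - rewrite Rplus_0_l. exact A5. }
  destruct (lipschitz_sequence_cluster b kappa (Lam + kappa)) as (s & l & Hs & Hl).
  - lra.
  - intros k. apply profile_abs, Hb.
  - intros k. apply Hb.
  - assert (Hle : forall (u v : nat -> R) (x y : R), (forall n, u n <= v n) -> is_lim_seq u x -> is_lim_seq v y -> x <= y).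
    { intros u v x y H1 H2 H3. exact (is_lim_seq_le u v x y H1 H2 H3). }
    assert (HlL : forall x y, Rabs (l x - l y) <= (Lam + kappa) * Rabs (x - y)).
    { apply (is_lim_seq_lipschitz (fun n => b (s n)) l); [intro n; apply Hb|exact Hl]. }
    assert (HlB : forall z, 0 <= l z <= kappa).
    { intro z. split.
      - apply (Hle (fun _ => 0) (fun n => b (s n) z)); [intro n; apply (Hb (s n))|apply is_lim_seq_const|apply Hl].
      - apply (Hle (fun n => b (s n) z) (fun _ => kappa)); [intro n; apply (Hb (s n))|apply Hl|apply is_lim_seq_const]. }
    assert (HlP : profile kappa l) by (apply (lipschitz_profile kappa l _ HlL HlB)).
    assert (Hlm : forall x y, x <= y -> l x <= l y).
    { intros x y Hxy. apply (Hle (fun n => b (s n) x) (fun n => b (s n) y)); [|apply Hl|apply Hl].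
      intro n. apply (Hb (s n)), Hxy. }
    assert (Hl0 : l 0 = kappa / 2).
    { assert (H1 := Hl 0). assert (H2 : is_lim_seq (fun n => b (s n) 0) (kappa / 2)).
      { apply (is_lim_seq_ext (fun _ => kappa / 2)); [intro n; symmetry; apply Hb|apply is_lim_seq_const]. }
      apply is_lim_seq_unique in H1. apply is_lim_seq_unique in H2. rewrite H1 in H2. injection H2. intros; lra. }
    assert (HlF : forall z, F l z = l z).
    { intro z.
      assert (H1 := wo_lim HF (fun n => b (s n)) l (Lam + kappa) (fun n => proj1 (Hb (s n))) HlP ltac:(lra)
         (fun n => proj1 (proj2 (Hb (s n)))) Hl z).
      assert (H2 : is_lim_seq (fun n => b (s n) z - F (b (s n)) z) (l z - F l z)) by (apply is_lim_seq_minus'; [apply Hl|exact H1]).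
      assert (H3 : is_lim_seq (fun n => b (s n) z - F (b (s n)) z) 0).
      { apply (is_lim_seq_abs_0 (fun n => b (s n) z - F (b (s n)) z)).
        apply (is_lim_seq_le_le (fun _ => 0) _ (fun n => t (s n)) 0).
        - intro n. split; [apply Rabs_pos|apply (Hb (s n))].
        - apply is_lim_seq_const.
        - apply (is_lim_seq_tends t 0 s Hs). unfold t.
          replace (Finite 0) with (Rbar_mult (Rmin t0 kappa) (Finite 0)) by (simpl; f_equal; ring).
          apply (is_lim_seq_scal_l (fun k => / (INR k + 1)) (Rmin t0 kappa) 0 is_lim_seq_inv_S). }
      apply is_lim_seq_unique in H2. apply is_lim_seq_unique in H3. rewrite H2 in H3. injection H3. intros; lra. }
    exists l. destruct (wo_sol HF l HlP) as [P [y1 [D1 D2]]].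
    apply (monotone_solution_wavefront h c l y1 Hg HlP Hlm Hl0).
    split; intro z.
    + apply (is_derive_ext (F l)); [exact HlF|apply D1].
    + rewrite <- HlF. apply D2.
Qed.

(** * Decay of the minimal front *)

(** The condition [chi < 0] in the moving frame: [exp (lam z)] is a strict supersolution of the
    linearization at 0. *)
Definition decay_rate (k0 c tau lam : R) : Prop :=
  0 < lam /\ lam ^ 2 - c * lam - 1 + k0 * exp (- (lam * tau)) < 0.

Lemma chi_tau g h z c : chi g h z c = z ^ 2 - c * z - 1 + Derive g 0 * exp (- (z * (c * h))).
Proof. unfold chi. do 3 f_equal. ring. Qed.

Lemma are_lambdas_speed_pos g kappa k1 L h c l1 l2 : monostable g kappa (Derive g 0) k1 L -> 0 <= h ->
  are_lambdas g h c l1 l2 -> 0 < c.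
Proof.
  intros Hg Hh (H1 & _ & H2 & _). destruct (Rlt_le_dec 0 c) as [h0|h0]; [exact h0|exfalso].
  rewrite chi_tau in H2. pose proof (ms_k0 Hg).
  assert (0 <= l1 * (- c * h)) by (apply Rmult_le_pos; [lra|apply Rmult_le_pos; lra]).
  assert (1 <= exp (- (l1 * (c * h)))) by (apply exp_ge_1; lra).
  assert (Derive g 0 * exp (- (l1 * (c * h))) >= Derive g 0) by nra. nra.
Qed.

(** Strict convexity of [chi] in [z]: if it were nonnegative between its zeros, its derivative would
    fail to increase between two mean-value points. *)
Lemma decay_rate_between g kappa k1 L h c l1 l2 lam : monostable g kappa (Derive g 0) k1 L -> 0 <= h ->
  are_lambdas g h c l1 l2 -> l1 < lam < l2 -> decay_rate (Derive g 0) c (c * h) lam.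
Proof.
  intros Hg Hh Hl Hlam. pose proof (are_lambdas_speed_pos g kappa k1 L h c l1 l2 Hg Hh Hl) as Hc.
  destruct Hl as (H1 & H2 & H3 & H4 & _). pose proof (ms_k0 Hg) as Hk.
  rewrite chi_tau in H3, H4. set (k0 := Derive g 0) in *. set (tau := c * h) in *.
  assert (Ht : 0 <= tau) by (apply Rmult_le_pos; lra).
  split; [lra|].
  set (f := fun z => z ^ 2 - c * z - 1 + k0 * exp (- (z * tau))).
  set (f1 := fun z => 2 * z - c - k0 * tau * exp (- (z * tau))).
  assert (D : forall z, is_derive f z (f1 z)).
  { intro z. unfold f, f1. auto_derive; [trivial|ring]. }
  change (f lam < 0). destruct (Rlt_le_dec (f lam) 0) as [h0|h0]; [exact h0|exfalso].
  destruct (mean_value f f1 l1 lam ltac:(lra) (fun z _ => D z)) as (u & E1 & Hu).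
  destruct (mean_value f f1 lam l2 ltac:(lra) (fun z _ => D z)) as (v & E2 & Hv).
  change (f l1 = 0) in H3. change (f l2 = 0) in H4. rewrite H3 in E1. rewrite H4 in E2.
  assert (0 <= f1 u) by nra. assert (f1 v <= 0) by nra.
  assert (f1 u < f1 v); [|lra]. unfold f1.
  assert (exp (- (v * tau)) <= exp (- (u * tau))) by (apply exp_le; nra).
  assert (0 <= k0 * tau) by nra. nra.
Qed.

(** The room [eps] absorbs the difference between [g] and its linear part near 0. *)
Lemma decay_rate_margin k0 c tau lam : decay_rate k0 c tau lam ->
  exists eps, 0 < eps /\ lam ^ 2 - c * lam - 1 + (k0 + eps) * exp (- (lam * tau)) < 0.
Proof.
  intros [_ H]. pose proof (exp_pos (- (lam * tau))) as He.
  set (m := - (lam ^ 2 - c * lam - 1 + k0 * exp (- (lam * tau)))).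
  exists (m / 2 / exp (- (lam * tau))). split.
  - apply Rdiv_lt_0_compat; [unfold m; lra|exact He].
  - replace ((k0 + m / 2 / exp (- (lam * tau))) * exp (- (lam * tau)))
      with (k0 * exp (- (lam * tau)) + m / 2) by (field; lra). unfold m. lra.
Qed.

Lemma attains_max (f : R -> R) x0 v Z1 Z2 : (forall z, continuous f z) -> v < f x0 ->
  (forall z, z <= Z1 -> f z <= v) -> (forall z, Z2 <= z -> f z <= v) ->
  exists z0, (forall z, f z <= f z0) /\ Z1 < z0 < Z2.
Proof.
  intros Hc Hv H1 H2.
  assert (A1 : Z1 < x0) by (destruct (Rlt_le_dec Z1 x0); [assumption|specialize (H1 x0 ltac:(lra)); lra]).
  assert (A2 : x0 < Z2) by (destruct (Rlt_le_dec x0 Z2); [assumption|specialize (H2 x0 ltac:(lra)); lra]).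
  destruct (continuity_ab_maj f Z1 Z2) as (z0 & B1 & B2); [lra| |].
  - intros z _. apply continuity_pt_filterlim, Hc.
  - assert (B3 := B1 x0 ltac:(lra)).
    assert (Hm : forall z, f z <= f z0).
    { intro z. destruct (Rle_lt_dec z Z1); [specialize (H1 z ltac:(lra)); lra|].
      destruct (Rle_lt_dec Z2 z); [specialize (H2 z ltac:(lra)); lra|]. apply B1. lra. }
    exists z0. split; [exact Hm|]. split.
    + destruct (Rlt_le_dec Z1 z0); [assumption|]. specialize (H1 z0 ltac:(lra)). lra.
    + destruct (Rlt_le_dec z0 Z2); [assumption|]. specialize (H2 z0 ltac:(lra)). lra.
Qed.

(** Monotonicity of the profile is deliberately absent, since the definition of a wavefront does not
    provide it; it is derived later from fast decay. *)
Record front (g : R -> R) (kappa c tau : R) (phi phi1 : R -> R) : Prop := {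
  fr_sol : lin_sol c (delayed g tau phi) phi phi1;
  fr_pos : forall z, 0 < phi z;
  fr_lt : forall z, phi z < kappa;
  fr_left : forall eps, 0 < eps -> exists Z, forall z, z <= Z -> phi z <= eps;
  fr_right : forall eps, 0 < eps -> exists Z, forall z, Z <= z -> kappa - eps <= phi z }.
Arguments fr_sol {g kappa c tau phi phi1} _.
Arguments fr_pos {g kappa c tau phi phi1} _.
Arguments fr_lt {g kappa c tau phi phi1} _.
Arguments fr_left {g kappa c tau phi phi1} _.
Arguments fr_right {g kappa c tau phi phi1} _.

Lemma wavefront_front {g kappa k0 k1 L} h c phi : monostable g kappa k0 k1 L -> is_wavefront g h kappa c phi ->
  front g kappa c (c * h) phi (Derive phi).
Proof.
  intros Hg (Hpos & Hl & Hr & Hode). apply wave_lin_sol in Hode.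
  set (tau := c * h) in *. pose proof (ms_kappa Hg) as Hk.
  assert (Hl' := proj1 (is_lim_m_infty_eps _ _) Hl). assert (Hr' := proj1 (is_lim_p_infty_eps _ _) Hr).
  (* At a maximum [z0] above [kappa] the equation gives [phi z0 <= g (phi (z0 - tau)) <= g (phi
     z0)], against [g y < y] for [y > kappa]. *)
  assert (Hle : forall z, phi z <= kappa).
  { intro x. destruct (Rle_lt_dec (phi x) kappa) as [h0|h0]; [exact h0|exfalso].
    set (v := (phi x + kappa) / 2).
    destruct (Hl' kappa Hk) as [Z1 HZ1]. destruct (Hr' (v - kappa)) as [Z2 HZ2]; [unfold v; lra|].
    destruct (attains_max phi x v Z1 Z2) as (z0 & Hm & _).
    - apply (lin_sol_continuous _ _ _ _ Hode).
    - unfold v; lra.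
    - intros z Hz. specialize (HZ1 z Hz). apply Rabs_le_between in HZ1. unfold v. lra.
    - intros z Hz. specialize (HZ2 z Hz). apply Rabs_le_between in HZ2. lra.
    - destruct Hode as [D1 D2].
      destruct (local_max_second_derive phi (Derive phi) z0 _ 1 ltac:(lra) (fun y _ => D1 y) (D2 z0) (fun y _ => Hm y)) as [E1 E2].
      rewrite E1 in E2. unfold delayed in E2.
      pose proof (Hm x). pose proof (ms_below Hg (phi z0) ltac:(lra)).
      pose proof (ms_mono Hg _ _ (Hm (z0 - tau))). lra. }
  assert (Hp : profile kappa phi).
  { split; [apply (lin_sol_continuous _ _ _ _ Hode)|]. intro z. split; [left; apply Hpos|apply Hle]. }
  constructor; try assumption.
  - intro z. enough (0 < kappa - phi z) by lra.
    destruct (lin_sol_minus c _ _ _ _ _ _ (lin_sol_const c kappa) Hode) as [D1 D2].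
    apply (harnack_positive c (fun z => kappa - phi z) _ _ D1 D2).
    + intro x. simpl. pose proof (delayed_bounds tau phi Hg (proj2 Hp) x). lra.
    + intro x. specialize (Hle x). lra.
    + destruct (Hl' (kappa / 2) ltac:(lra)) as [Z HZ]. exists Z.
      specialize (HZ Z (Rle_refl _)). apply Rabs_le_between in HZ. lra.
  - intros eps He. destruct (Hl' eps He) as [Z HZ]. exists Z. intros z Hz. specialize (HZ z Hz).
    apply Rabs_le_between in HZ. lra.
  - intros eps He. destruct (Hr' eps He) as [Z HZ]. exists Z. intros z Hz. specialize (HZ z Hz).
    apply Rabs_le_between in HZ. lra.
Qed.

Lemma front_profile {g kappa c tau phi phi1} : front g kappa c tau phi phi1 -> profile kappa phi.
Proof.
  intro H. split; [apply (lin_sol_continuous _ _ _ _ (fr_sol H))|].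
  intro z. pose proof (fr_pos H z). pose proof (fr_lt H z). lra.
Qed.

Lemma lin_sol_harnack c G y y1 : lin_sol c G y y1 -> (forall z, 0 <= G z) -> (forall z, 0 <= y z) ->
  exists z1 z2, z1 < 0 /\ 0 < z2 /\ z1 + z2 = c /\ z1 * z2 = -1 /\ forall z, z1 * y z <= y1 z <= z2 * y z.
Proof.
  intros [D1 D2] HG Hy. destruct (quadratic_roots c) as (z1 & z2 & A & B & C & D).
  exists z1, z2. repeat (split; [assumption|]).
  apply (harnack_derive c z1 z2 y y1 _ A B C D D1 D2); [|exact Hy].
  intro z. specialize (HG z). lra.
Qed.

(** If [phi] is below one multiple of [exp (lam z)] at points going to minus infinity, then it is
    below a fixed multiple everywhere. Harnack carries the bound from each such point over a delay
    interval, and the strict supersolution carries it up to a fixed [Z0], with constants independent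
    of the starting point. *)
Lemma decay_dichotomy {g kappa k0 k1 L} c tau phi phi1 lam : monostable g kappa k0 k1 L -> 0 <= tau ->
  front g kappa c tau phi phi1 -> decay_rate k0 c tau lam ->
  (exists M, forall z, phi z <= M * exp (lam * z)) \/
  (forall M, exists Z, forall z, z <= Z -> M * exp (lam * z) < phi z).
Proof.
  intros Hg Ht Hf Hlam. pose proof (front_profile Hf) as Hp.
  destruct (classic (forall M, exists Z, forall z, z <= Z -> M * exp (lam * z) < phi z)) as [h|h]; [right; exact h|left].
  apply not_all_ex_not in h. destruct h as [M0 HM0].
  assert (HM : forall Z, exists z, z <= Z /\ phi z <= M0 * exp (lam * z)).
  { intro Z. apply NNPP. intro Hn. apply HM0. exists Z. intros z Hz.
    destruct (Rlt_le_dec (M0 * exp (lam * z)) (phi z)); [assumption|]. exfalso. apply Hn. exists z. tauto. }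
  clear HM0.
  assert (HM0 : 0 <= M0).
  { destruct (HM 0) as (z & _ & Hz). pose proof (fr_pos Hf z). pose proof (exp_pos (lam * z)).
    destruct (Rle_lt_dec 0 M0); [assumption|nra]. }
  destruct (lin_sol_harnack c _ phi phi1 (fr_sol Hf)) as (z1 & z2 & Hz1 & Hz2 & _ & _ & HH).
  { intro z. apply (delayed_bounds tau phi Hg (proj2 Hp)). }
  { intro z. apply Hp. }
  destruct (decay_rate_margin _ _ _ _ Hlam) as (eps & He & Hm).
  destruct (ms_slope0 Hg eps He) as (d & Hd & Hs).
  destruct (fr_left Hf d Hd) as [Z0 HZ0].
  destruct (fr_sol Hf) as [D1 D2].
  pose proof (ms_kappa Hg) as Hk.
  (* [C1] is the price of going back from [zn] over one delay interval with [phi' >= z1 phi]; [C2]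
     makes the exponential reach [kappa] at [Z0]. *)
  set (C1 := M0 * exp ((lam - z1) * tau)). set (C2 := kappa * exp (- lam * Z0)).
  assert (HC2 : 0 < C2) by (apply Rmult_lt_0_compat; [lra|apply exp_pos]).
  set (C := Rmax C1 C2).
  assert (HC1C : C1 <= C) by apply Rmax_l. assert (HC2C : C2 <= C) by apply Rmax_r.
  assert (Eprod : forall z, exp (- lam * z) * exp (lam * z) = 1).
  { intro z. rewrite <- exp_plus. replace (- lam * z + lam * z) with 0 by ring. apply exp_0. }
  exists C. intro x. destruct (Rle_lt_dec x Z0) as [hx|hx].
  2:{ apply Rle_trans with kappa; [left; apply (fr_lt Hf)|].
      apply Rle_trans with (C2 * exp (lam * x)); [|apply Rmult_le_compat_r; [left; apply exp_pos|exact HC2C]].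
      unfold C2. rewrite Rmult_assoc, <- exp_plus.
      assert (1 <= exp (- lam * Z0 + lam * x)). { apply exp_ge_1. destruct Hlam. nra. } nra. }
  destruct (HM (Rmin x Z0)) as (zn & Hzn & Hpn).
  assert (Hznx : zn <= x) by (pose proof (Rmin_l x Z0); lra).
  assert (Hinit : forall z, zn - tau <= z <= zn -> phi z <= C1 * exp (lam * z)).
  { intros z Hz.
    assert (K := exp_growth_lower phi phi1 z1 D1 (fun z => proj1 (HH z)) z zn ltac:(lra)).
    assert (E : phi z * exp (z1 * (zn - z)) * exp (- z1 * (zn - z)) = phi z).
    { rewrite Rmult_assoc, <- exp_plus. replace (z1 * (zn - z) + - z1 * (zn - z)) with 0 by ring. rewrite exp_0. ring. }
    rewrite <- E. apply Rle_trans with (M0 * exp (lam * zn) * exp (- z1 * (zn - z))).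
    - apply Rmult_le_compat_r; [left; apply exp_pos|]. lra.
    - unfold C1. rewrite !Rmult_assoc. apply Rmult_le_compat_l; [exact HM0|].
      rewrite <- !exp_plus. apply exp_le. destruct Hlam as [Hl0 _].
      enough ((lam - z1) * (zn - z) <= (lam - z1) * tau) by lra.
      apply Rmult_le_compat_l; lra. }
  set (f := fun z => phi z * exp (- lam * z)).
  assert (Hfc : forall z, is_derive f z ((phi1 z + - lam * phi z) * exp (- lam * z))).
  { intro z. apply exp_weight_derive, D1. }
  destruct (continuity_ab_maj f (zn - tau) Z0) as (x0 & B1 & B2); [lra| |].
  { intros z _. eapply is_derive_continuity_pt, Hfc. }
  assert (Hfphi : forall z, phi z = f z * exp (lam * z)).
  { intro z. unfold f. rewrite Rmult_assoc, Eprod. ring. }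
  set (m := f x0) in *.
  assert (HmC : m <= C).
  { destruct (Rle_lt_dec m C) as [h0|h0]; [exact h0|exfalso].
    assert (Hx0 : zn < x0).
    { destruct (Rlt_le_dec zn x0); [assumption|exfalso].
      specialize (Hinit x0 ltac:(lra)). rewrite Hfphi in Hinit.
      apply Rmult_le_reg_r in Hinit; [|apply exp_pos]. fold m in Hinit. lra. }
    assert (Hx1 : x0 < Z0).
    { destruct (Rlt_le_dec x0 Z0); [assumption|exfalso]. assert (x0 = Z0) by lra.
      assert (m <= C2); [|lra]. unfold m, f, C2. subst x0. apply Rmult_le_compat_r; [left; apply exp_pos|].
      left. apply (fr_lt Hf). }
    assert (Hm0 : 0 < m) by lra.
    set (E := exp (lam * x0)). assert (HE : 0 < E) by apply exp_pos.
    set (rho := Rmin (x0 - zn) (Z0 - x0)).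
    assert (Hrho : 0 < rho) by (apply Rmin_glb_lt; lra).
    assert (Hr1 : rho <= x0 - zn) by apply Rmin_l. assert (Hr2 : rho <= Z0 - x0) by apply Rmin_r.
    (* At an interior maximum of [phi exp (- lam z)] the function [phi] is touched by
       [m exp (lam z)] from above; the delayed value obeys the same bound, so the negative margin
       gives a contradiction. *)
    destruct (local_max_second_derive (fun z => phi z - m * exp (lam * (z - 0))) (fun z => phi1 z - m * (lam * exp (lam * (z - 0)))) x0
      (c * phi1 x0 + phi x0 - delayed g tau phi x0 - m * lam * (lam * exp (lam * (x0 - 0)))) rho Hrho) as [L1 L2].
    - intros y _. apply (is_derive_minus phi (fun z => m * exp (lam * (z - 0)))); [apply D1|apply is_derive_exp_affine].
    - apply (is_derive_minus phi1 (fun z => m * (lam * exp (lam * (z - 0))))); [apply D2|].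
      apply (is_derive_ext (fun z => m * lam * exp (lam * (z - 0)))); [intro; apply Rmult_assoc|apply is_derive_exp_affine].
    - intros y Hy. apply Rabs_def2 in Hy. rewrite !Rminus_0_r, (Hfphi y), (Hfphi x0). fold m.
      specialize (B1 y ltac:(lra)). pose proof (exp_pos (lam * y)). nra.
    - rewrite !Rminus_0_r in *. fold E in L1, L2.
      assert (Ephi : phi x0 = m * E) by apply Hfphi.
      assert (Hdel : delayed g tau phi x0 <= (k0 + eps) * (m * (E * exp (- (lam * tau))))).
      { unfold delayed.
        assert (Hdd : phi (x0 - tau) <= d) by (apply HZ0; lra).
        pose proof (fr_pos Hf (x0 - tau)) as Hpp.
        destruct (Hs 0 (phi (x0 - tau)) ltac:(lra) ltac:(lra) Hdd) as [_ K].
        rewrite (ms_zero Hg), Rminus_0_r, Rminus_0_r in K.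
        eapply Rle_trans; [exact K|]. apply Rmult_le_compat_l; [pose proof (ms_k0 Hg); lra|].
        rewrite Hfphi. unfold E. rewrite <- exp_plus.
        replace (lam * x0 + - (lam * tau)) with (lam * (x0 - tau)) by ring.
        apply Rmult_le_compat_r; [left; apply exp_pos|]. apply B1. lra. }
      assert (Hfin : m * E * (lam ^ 2 - c * lam - 1 + (k0 + eps) * exp (- (lam * tau))) < 0).
      { assert (0 < m * E) by (apply Rmult_lt_0_compat; assumption). nra. }
      assert (phi1 x0 = m * (lam * E)) by lra. rewrite H, Ephi in L2. nra. }
  rewrite Hfphi. apply Rmult_le_compat_r; [left; apply exp_pos|].
  apply Rle_trans with m; [apply B1; lra|exact HmC].
Qed.

(** * The weight eta and Gaussian correctors *)

Lemma eta_pos lam z : 0 < eta lam z.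
Proof. unfold eta. apply Rmin_glb_lt; [apply exp_pos|lra]. Qed.

Lemma eta_le_1 lam z : eta lam z <= 1.
Proof. apply Rmin_r. Qed.

Lemma eta_le_exp lam z : eta lam z <= exp (lam * z).
Proof. apply Rmin_l. Qed.

Lemma eta_left lam z : 0 <= lam -> z <= 0 -> eta lam z = exp (lam * z).
Proof. intros Hl Hz. unfold eta. apply Rmin_left. apply exp_le_1. nra. Qed.

Lemma eta_right lam z : 0 <= lam -> 0 <= z -> eta lam z = 1.
Proof. intros Hl Hz. unfold eta. apply Rmin_right. apply exp_ge_1. nra. Qed.

Lemma eta_mono lam x y : 0 <= lam -> x <= y -> eta lam x <= eta lam y.
Proof. intros Hl Hxy. unfold eta. apply Rle_min_compat_r. apply exp_le. nra. Qed.

Lemma eta_shift lam x s : 0 <= lam -> eta lam (x + s) <= exp (lam * Rabs s) * eta lam x.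
Proof.
  intro Hl. pose proof (Rabs_pos s). pose proof (Rle_abs s).
  assert (1 <= exp (lam * Rabs s)) by (apply exp_ge_1; nra).
  unfold eta at 2. apply Rmin_case.
  - eapply Rle_trans; [apply eta_le_exp|]. rewrite <- exp_plus. apply exp_le. nra.
  - pose proof (eta_le_1 lam (x + s)). lra.
Qed.

Lemma le_eta lam x A B z : 0 <= A -> 0 <= B -> x <= A -> x <= B * exp (lam * z) -> x <= (A + B) * eta lam z.
Proof.
  intros HA HB H1 H2. pose proof (exp_pos (lam * z)). unfold eta. apply Rmin_case; nra.
Qed.

(** Expresses [eta' <= lam eta] in a form that ignores the kink at 0 and may be evaluated at any
    later point [z]. *)
Lemma eta_increment lam p q z : 0 <= lam -> q <= p -> p <= z ->
  eta lam p - eta lam q <= lam * eta lam z * (p - q).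
Proof.
  intros Hl Hqp Hpz. pose proof (eta_pos lam z).
  destruct (Rle_lt_dec 0 q) as [h|h].
  - rewrite !eta_right by lra. nra.
  - rewrite (eta_left lam q) by lra.
    assert (E : exp (lam * q) = exp (lam * p) * exp (- (lam * (p - q)))).
    { rewrite <- exp_plus. f_equal. ring. }
    pose proof (exp_ineq1_le (- (lam * (p - q)))). pose proof (eta_le_exp lam p).
    pose proof (eta_mono lam p z Hl Hpz). pose proof (eta_pos lam p).
    pose proof (exp_pos (- (lam * (p - q)))).
    assert (eta lam p * exp (- (lam * (p - q))) <= exp (lam * q)) by (rewrite E; apply Rmult_le_compat_r; lra).
    assert (0 <= lam * (p - q)) by nra.
    assert (eta lam p * (1 - exp (- (lam * (p - q)))) <= eta lam z * (lam * (p - q))) by nra. nra.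
Qed.

Lemma eta_abs_increment lam p q : 0 <= lam -> Rabs (eta lam p - eta lam q) <= lam * Rabs (p - q).
Proof.
  intro Hl.
  assert (K : forall p q, q <= p -> Rabs (eta lam p - eta lam q) <= lam * Rabs (p - q)).
  { intros u v Huv. pose proof (eta_mono lam v u Hl Huv).
    rewrite !Rabs_right by lra. pose proof (eta_increment lam u v u Hl Huv (Rle_refl u)).
    pose proof (eta_le_1 lam u). assert (0 <= lam * (u - v)) by nra. nra. }
  destruct (Rle_lt_dec q p); [apply K; assumption|].
  rewrite (Rabs_minus_sym (eta lam p)), (Rabs_minus_sym p). apply K; lra.
Qed.

Lemma eta_continuous lam z : 0 <= lam -> continuous (eta lam) z.
Proof. intro Hl. apply (lipschitz_continuous (eta lam) lam). intros; apply eta_abs_increment, Hl. Qed.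

Lemma Rmin_continuous (f1 f2 : R -> R) : (forall z, continuous f1 z) -> (forall z, continuous f2 z) ->
  forall z, continuous (fun x => Rmin (f1 x) (f2 x)) z.
Proof.
  intros H1 H2 z.
  apply (continuous_ext (fun x => / 2 * ((f1 x + f2 x) - Rabs (f1 x - f2 x)))).
  - intro x. unfold Rmin, Rabs. destruct (Rle_dec (f1 x) (f2 x)), (Rcase_abs (f1 x - f2 x)); lra.
  - apply (continuous_scal_r (/ 2) (fun x => (f1 x + f2 x) - Rabs (f1 x - f2 x))).
    apply (continuous_minus (fun x => f1 x + f2 x) (fun x => Rabs (f1 x - f2 x))).
    + apply (continuous_plus f1 f2); auto.
    + apply (continuous_comp (fun x => f1 x - f2 x) Rabs).
      * apply (continuous_minus f1 f2); auto.
      * apply continuous_Rabs.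
Qed.

Definition gauss N z0 z := exp (- N * (z - z0) ^ 2).
Definition gauss1 N z0 z := - (2 * N * (z - z0)) * gauss N z0 z.
Definition gauss2 N z0 z := (4 * N ^ 2 * (z - z0) ^ 2 - 2 * N) * gauss N z0 z.

Lemma gauss_derive N z0 z : is_derive (gauss N z0) z (gauss1 N z0 z).
Proof. unfold gauss1, gauss. auto_derive; [trivial|]. unfold Rminus. simpl. ring. Qed.

Lemma gauss1_derive N z0 z : is_derive (gauss1 N z0) z (gauss2 N z0 z).
Proof. unfold gauss2, gauss1, gauss. auto_derive; [trivial|]. unfold Rminus. simpl. ring. Qed.

Lemma gauss_bounds N z0 z : 0 <= N -> 0 < gauss N z0 z <= 1.
Proof.
  intro HN. unfold gauss. split; [apply exp_pos|]. apply exp_le_1.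
  pose proof (pow2_ge_0 (z - z0)). nra.
Qed.

(** Completing the square bounds the bracket multiplying the Gaussian from below, uniformly in the
    distance to the centre. *)
Lemma gauss_operator_lower N c z0 z : 0 <= N ->
  - (2 * N + 1 + c ^ 2) <= gauss2 N z0 z - c * gauss1 N z0 z - gauss N z0 z.
Proof.
  intro HN. pose proof (gauss_bounds N z0 z HN) as Hb. unfold gauss2, gauss1.
  set (y := z - z0) in *. set (w := gauss N z0 z) in *.
  assert (0 <= 4 * N ^ 2 * y ^ 2 - 2 * N + 2 * c * N * y - 1 + (2 * N + 1 + c ^ 2)).
  { pose proof (pow2_ge_0 (2 * N * y + c / 2)). pose proof (pow2_ge_0 c). lra. }
  assert (0 <= 2 * N + 1 + c ^ 2) by nra. nra.
Qed.

(** For a narrow Gaussian the second derivative dominates outside radius [rho], so it is a strict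
    subsolution there; only a small ball around the centre is bad. *)
Lemma gauss_operator_far N c z0 z rho : 0 < rho -> 0 <= c -> 1 <= N -> 4 / rho + 2 * c <= 4 * N * rho ->
  rho <= Rabs (z - z0) -> gauss N z0 z <= gauss2 N z0 z - c * gauss1 N z0 z - gauss N z0 z.
Proof.
  intros Hr Hc HN HNr Hz. pose proof (gauss_bounds N z0 z ltac:(lra)) as Hb. unfold gauss2, gauss1.
  set (y := z - z0) in *. set (w := gauss N z0 z) in *.
  assert (Hy2 : y ^ 2 = Rabs y * Rabs y) by (rewrite <- (pow2_abs y); ring).
  assert (Hya : - Rabs y <= y) by (pose proof (Rle_abs (- y)); rewrite Rabs_Ropp in *; lra).
  set (t := Rabs y) in *.
  assert (Hrr : rho * (4 / rho) = 4) by (field; lra).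
  assert (H1 : 4 / rho <= 4 * N * t - 2 * c) by nra.
  assert (H2 : 4 <= t * (4 * N * t - 2 * c)).
  { assert (0 < 4 / rho) by (apply Rdiv_lt_0_compat; lra). apply Rle_trans with (rho * (4 / rho)); [lra|]. apply Rmult_le_compat; lra. }
  assert (H3 : 4 * N <= N * (t * (4 * N * t - 2 * c))) by nra.
  assert (H4 : - (2 * c * N * t) <= 2 * c * N * y) by (assert (0 <= 2 * c * N) by nra; nra).
  assert (2 <= 4 * N ^ 2 * y ^ 2 - 2 * N + 2 * c * N * y) by (rewrite Hy2; nra).
  nra.
Qed.

(** A square completion compares the Gaussian with an exponential of any rate [M]; Harnack bounds
    positive solutions from below by such an exponential. *)
Lemma gauss_exp_bound N z0 z M : 0 < N -> gauss N z0 z <= exp (M ^ 2 / (4 * N)) * exp (- M * Rabs (z - z0)).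
Proof.
  intro HN. unfold gauss. rewrite <- exp_plus. apply exp_le.
  rewrite <- (pow2_abs (z - z0)). set (t := Rabs (z - z0)).
  assert (0 <= N * (t - M / (2 * N)) ^ 2) by (apply Rmult_le_pos; [lra|apply pow2_ge_0]).
  replace (N * (t - M / (2 * N)) ^ 2) with (N * t ^ 2 - M * t + M ^ 2 / (4 * N)) in H by (field; lra). lra.
Qed.

Lemma gauss1_eta N z0 z lam : 1 <= N -> 0 <= lam ->
  Rabs (gauss1 N z0 z) <= 2 * N * exp ((1 + lam) ^ 2 / (4 * N)) * (1 + exp (- (lam * z0))) * eta lam z.
Proof.
  intros HN Hl. unfold gauss1. rewrite Rabs_mult, Rabs_Ropp, Rabs_mult, (Rabs_right (2 * N)) by lra.
  pose proof (gauss_bounds N z0 z ltac:(lra)) as Hb. rewrite (Rabs_right (gauss N z0 z)) by lra.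
  pose proof (gauss_exp_bound N z0 z (1 + lam) ltac:(lra)) as H1.
  set (t := Rabs (z - z0)) in *. assert (Ht : 0 <= t) by apply Rabs_pos.
  set (A := exp ((1 + lam) ^ 2 / (4 * N))) in *. assert (HA : 0 < A) by apply exp_pos.
  assert (H2 : t <= exp t) by (pose proof (exp_ineq1_le t); lra).
  assert (H3 : t * gauss N z0 z <= A * exp (- lam * t)).
  { apply Rle_trans with (exp t * (A * exp (- (1 + lam) * t))).
    - apply Rmult_le_compat; lra.
    - right. replace (exp t * (A * exp (- (1 + lam) * t))) with (A * (exp t * exp (- (1 + lam) * t))) by ring.
      rewrite <- exp_plus. do 2 f_equal. ring. }
  assert (Hz : - t <= z - z0) by (pose proof (Rle_abs (- (z - z0))); rewrite Rabs_Ropp in *; unfold t; lra).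
  assert (H4 : exp (- lam * t) <= exp (- (lam * z0)) * exp (lam * z)).
  { rewrite <- exp_plus. apply exp_le. nra. }
  assert (H5 : exp (- lam * t) <= 1) by (apply exp_le_1; nra).
  assert (H6 : exp (- lam * t) <= (1 + exp (- (lam * z0))) * eta lam z).
  { apply le_eta; try lra. left; apply exp_pos. }
  replace (2 * N * t * gauss N z0 z) with (2 * N * (t * gauss N z0 z)) by ring.
  rewrite !Rmult_assoc. apply Rmult_le_compat_l; [lra|]. apply Rmult_le_compat_l; [lra|].
  eapply Rle_trans; [exact H3|]. apply Rmult_le_compat_l; [lra|exact H6].
Qed.

Lemma continuous_eps (f : R -> R) x eps : continuous f x -> 0 < eps ->
  exists d, 0 < d /\ forall y, Rabs (y - x) < d -> Rabs (f y - f x) < eps.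
Proof.
  intros H He. assert (Hl : locally (f x) (fun y => Rabs (y - f x) < eps)) by (exists (mkposreal eps He); intros y Hy; exact Hy).
  destruct (H _ Hl) as [d Hd]. exists d. split; [apply cond_pos|]. intros y Hy. apply (Hd y Hy).
Qed.

(** Let [V0] be the minimum of [phi] and the exponential, and [W] its image under the wave operator.
    Slow decay puts the exponential strictly below [phi] somewhere, and there [W < V0]; the
    inequality [g (W) < g (V0)] one delay later is the seed of strictness. *)
Lemma slow_front_improves {g kappa k0 k1 L} c tau phi phi1 lam : monostable g kappa k0 k1 L -> 0 <= tau ->
  front g kappa c tau phi phi1 -> decay_rate k0 c tau lam ->
  (forall M, exists Z, forall z, z <= Z -> M * exp (lam * z) < phi z) ->
  exists V0 W W1 K zs, profile kappa V0 /\ profile kappa W /\ lin_sol c (delayed g tau V0) W W1 /\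
    (forall z, 0 < W z) /\ (forall z, W z <= V0 z) /\ (forall z, W z <= phi z) /\ 0 < K /\
    (forall z, W z <= K * exp (lam * z)) /\
    (forall eps, 0 < eps -> exists Z, forall z, Z <= z -> kappa - eps <= W z) /\
    g (W (zs - tau)) < g (V0 (zs - tau)).
Proof.
  intros Hg Ht Hf Hlam Hslow. pose proof (front_profile Hf) as Hp.
  pose proof (ms_kappa Hg) as Hk. pose proof (ms_k0 Hg) as Hk0.
  destruct (decay_rate_margin _ _ _ _ Hlam) as (eps0 & He0 & Hm0).
  destruct Hlam as [Hl0 _].
  (* The second bound keeps [k0 - eps] positive, so that [g] is strictly increasing near 0; this is
     needed to transfer [W < V0] through [g]. *)
  set (eps := Rmin eps0 ((k0 - 1) / 2)).
  assert (He : 0 < eps) by (apply Rmin_glb_lt; lra).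
  assert (He1 : eps <= eps0) by apply Rmin_l. assert (He2 : eps <= (k0 - 1) / 2) by apply Rmin_r.
  assert (Hm : lam ^ 2 - c * lam - 1 + (k0 + eps) * exp (- (lam * tau)) < 0).
  { pose proof (exp_pos (- (lam * tau))). nra. }
  destruct (ms_slope0 Hg eps He) as (d & Hd & Hs).
  destruct (fr_left Hf d Hd) as [Z0 HZ0].
  (* With this [K] the exponential equals [kappa] at [Z0], so right of [Z0] the minimum is [phi],
     and left of it the linear bound on [g] is available. *)
  set (K := kappa * exp (- lam * Z0)).
  assert (HK : 0 < K) by (apply Rmult_lt_0_compat; [lra|apply exp_pos]).
  set (E := fun z => K * exp (lam * (z - 0))).
  assert (HEpos : forall z, 0 < E z) by (intro z; apply Rmult_lt_0_compat; [lra|apply exp_pos]).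
  assert (HEZ : forall z, Z0 <= z -> kappa <= E z).
  { intros z Hz. unfold E, K. rewrite Rmult_assoc, <- exp_plus.
    assert (1 <= exp (- lam * Z0 + lam * (z - 0))). { apply exp_ge_1. nra. } nra. }
  set (V0 := fun z => Rmin (phi z) (E z)).
  assert (HV0p : profile kappa V0).
  { split.
    - apply Rmin_continuous; [apply Hp|]. intro z. eapply is_derive_continuous, is_derive_exp_affine.
    - intro z. split; [apply Rmin_glb; [apply Hp|left; apply HEpos]|]. eapply Rle_trans; [apply Rmin_l|apply Hp]. }
  destruct (profile_solution c tau V0 Hg HV0p) as (W & W1 & SW & PW).
  assert (HWphi : forall z, W z <= phi z).
  { destruct Hf as [Sphi _ _ _ _].
    apply (lin_sol_le c _ _ W W1 phi phi1 kappa SW Sphi (profile_abs _ _ PW) (profile_abs _ _ Hp)).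
    intro z. apply (ms_mono Hg). apply Rmin_l. }
  destruct SW as [D1 D2].
  set (w := fun z => W z - E z). set (w1 := fun z => W1 z - K * (lam * exp (lam * (z - 0)))).
  set (w2 := fun z => (c * W1 z + W z - delayed g tau V0 z) - K * lam * (lam * exp (lam * (z - 0)))).
  assert (Dw : forall z, is_derive w z (w1 z)).
  { intro z. apply (is_derive_minus W E); [apply D1|apply is_derive_exp_affine]. }
  assert (Dw1 : forall z, is_derive w1 z (w2 z)).
  { intro z. apply (is_derive_minus W1 (fun z => K * (lam * exp (lam * (z - 0))))); [apply D2|].
    apply (is_derive_ext (fun z => K * lam * exp (lam * (z - 0)))); [intro; apply Rmult_assoc|apply is_derive_exp_affine]. }
  assert (Hop : forall z, z <= Z0 -> 0 < w2 z - c * w1 z - w z).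
  { intros z Hz.
    assert (Hdel : delayed g tau V0 z <= (k0 + eps) * (E z * exp (- (lam * tau)))).
    { unfold delayed. pose proof (proj1 (proj2 HV0p (z - tau))) as HV.
      assert (HVd : V0 (z - tau) <= d) by (eapply Rle_trans; [apply Rmin_l|]; apply HZ0; lra).
      destruct (Hs 0 (V0 (z - tau)) ltac:(lra) HV HVd) as [_ Q].
      rewrite (ms_zero Hg), !Rminus_0_r in Q. eapply Rle_trans; [exact Q|].
      apply Rmult_le_compat_l; [lra|]. eapply Rle_trans; [apply Rmin_r|]. right.
      unfold E. rewrite Rmult_assoc, <- exp_plus. do 2 f_equal. ring. }
    pose proof (HEpos z) as HEz. unfold w2, w1, w.
    assert (HE' : K * exp (lam * (z - 0)) = E z) by reflexivity.
    replace (K * lam * (lam * exp (lam * (z - 0)))) with (lam ^ 2 * E z) by (rewrite <- HE'; ring).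
    replace (K * (lam * exp (lam * (z - 0)))) with (lam * E z) by (rewrite <- HE'; ring). nra. }
  assert (HwE : forall z, w z <= 0).
  { apply (line_max_principle c w kappa).
    - intro z. eapply is_derive_continuous, Dw.
    - intro z. unfold w. pose proof (HEpos z). pose proof (proj2 (proj2 PW z)). lra.
    - intros z Hz. exists w, w1, (w2 z). split; [reflexivity|split; [intro; lra|split; [exact Dw|split; [apply Dw1|]]]].
      left. apply Hop. destruct (Rle_lt_dec z Z0); [assumption|exfalso].
      pose proof (HEZ z ltac:(lra)). pose proof (proj2 (proj2 PW z)). unfold w in Hz. lra. }
  assert (HwE' : forall z, z <= Z0 -> w z < 0).
  { intros z Hz. destruct (HwE z) as [h|h]; [exact h|exfalso].
    destruct (local_max_second_derive w w1 z (w2 z) 1 ltac:(lra) (fun y _ => Dw y) (Dw1 z)) as [E1 E2].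
    - intros y _. rewrite h. apply HwE.
    - pose proof (Hop z Hz). rewrite E1, h in H. lra. }
  assert (HWright : forall e, 0 < e -> exists Z, forall z, Z <= z -> kappa - e <= W z).
  { intros e Hee.
    destruct (delayed_tends_right tau V0 kappa Hg) with (eps := e / 2) as [Z HZ]; [|lra|].
    - intros e' He'. destruct (fr_right Hf e' He') as [Z HZ]. exists (Rmax Z Z0).
      intros z Hz. pose proof (Rmax_l Z Z0). pose proof (Rmax_r Z Z0).
      specialize (HZ z ltac:(lra)). specialize (HEZ z ltac:(lra)).
      pose proof (fr_lt Hf z).
      unfold V0. rewrite Rmin_left by lra. apply Rabs_le. lra.
    - rewrite (ms_fix Hg) in HZ.
      destruct (lin_sol_liminf c (delayed g tau V0) W W1 kappa (kappa - e / 2) Z (conj D1 D2) (profile_abs _ _ PW)) with (eps := e / 2) as [Z' HZ'].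
      + intros z Hz. specialize (HZ z Hz). apply Rabs_le_between in HZ. lra.
      + lra.
      + exists Z'. intros z Hz. specialize (HZ' z Hz). lra. }
  (* The only use of slow decay: at [za] the minimum is the exponential branch, which [W] stays
     strictly below. *)
  destruct (Hslow K) as [Z1 HZ1].
  set (za := Rmin Z1 Z0).
  assert (Hza1 : za <= Z1) by apply Rmin_l. assert (Hza0 : za <= Z0) by apply Rmin_r.
  assert (HWV : forall z, W z <= V0 z).
  { intro z. apply Rmin_glb; [apply HWphi|]. specialize (HwE z). unfold w in HwE. lra. }
  exists V0, W, W1, K, (za + tau). split; [exact HV0p|]. split; [exact PW|]. split; [exact (conj D1 D2)|].
  split; [|split; [|split; [|split; [|split; [|split]]]]].
  - apply (harnack_positive c W W1 _ D1 D2).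
    + intro z. pose proof (delayed_bounds tau V0 Hg (proj2 HV0p) z). lra.
    + intro z. apply PW.
    + destruct (HWright (kappa / 2) ltac:(lra)) as [Z HZ]. exists Z. specialize (HZ Z (Rle_refl _)). lra.
  - exact HWV.
  - exact HWphi.
  - exact HK.
  - intro z. specialize (HwE z). unfold w, E in HwE. rewrite Rminus_0_r in HwE. lra.
  - exact HWright.
  - replace (za + tau - tau) with za by ring.
    assert (HVE : V0 za = E za).
    { unfold V0. apply Rmin_right. left. unfold E. rewrite Rminus_0_r. apply HZ1, Hza1. }
    assert (HWlt : W za < V0 za) by (rewrite HVE; specialize (HwE' za Hza0); unfold w in HwE'; lra).
    assert (HVd : V0 za <= d) by (eapply Rle_trans; [apply Rmin_l|]; apply HZ0, Hza0).
    pose proof (proj1 (proj2 PW za)).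
    destruct (Hs (W za) (V0 za) ltac:(lra) ltac:(lra) HVd) as [Q _].
    assert (0 < (k0 - eps) * (V0 za - W za)) by (apply Rmult_lt_0_compat; lra). lra.
Qed.

(* The profile U + a * eta, with its two smooth branches on both sides of the kink of eta,
   satisfies the wave inequality of speed c with the margin m * eta. *)
Record strict_supersolution (g : R -> R) (kappa c tau lam a m C : R) (U U1 U2 : R -> R) : Prop := {
  ss_a : 0 < a;
  ss_m : 0 < m;
  ss_d1 : forall z, is_derive U z (U1 z);
  ss_d2 : forall z, is_derive U1 z (U2 z);
  ss_pos : forall z, 0 <= U z;
  ss_bound : forall z, U z <= C * eta lam z;
  ss_bound1 : forall z, Rabs (U1 z) <= C * eta lam z;
  ss_left : forall z, z <= 0 -> U2 z - c * U1 z - U z + a * (lam ^ 2 - c * lam - 1) * exp (lam * z)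
      + g (U (z - tau) + a * eta lam (z - tau)) <= - m * eta lam z;
  ss_right : forall z, 0 <= z -> U2 z - c * U1 z - U z - a
      + g (U (z - tau) + a * eta lam (z - tau)) <= - m * eta lam z }.

(** The residual [r = g (V0) - g (W)], delayed, is nonnegative but is known to be positive only near
    [zs]. Subtracting a small Gaussian centred there makes the inequality strict on every bounded
    set. Adding [a eta] costs at most [L a] in the middle and creates the margin in the tails, from
    [decay_rate] on the left and from [k1 < 1] on the right. *)
Lemma slow_strict_supersolution {g kappa k0 k1 L} c tau phi phi1 lam : monostable g kappa k0 k1 L ->
  0 <= c -> 0 <= tau ->
  front g kappa c tau phi phi1 -> decay_rate k0 c tau lam ->
  (forall M, exists Z, forall z, z <= Z -> M * exp (lam * z) < phi z) ->
  exists a m C U U1 U2, strict_supersolution g kappa c tau lam a m C U U1 U2.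
Proof.
  intros Hg Hc Ht Hf Hlam Hslow.
  pose proof (ms_kappa Hg) as Hk. pose proof (ms_k0 Hg) as Hk0.
  pose proof (ms_k1 Hg) as Hk1. pose proof (ms_L Hg) as HL.
  destruct (slow_front_improves c tau phi phi1 lam Hg Ht Hf Hlam Hslow)
    as (V0 & W & W1 & K & zs & PV & PW & SW & HWp & HWV & HWphi & HK & HWK & HWr & Hzs).
  destruct (decay_rate_margin _ _ _ _ Hlam) as (eps & He & Hm).
  destruct Hlam as [Hl0 Hl1].
  set (m1 := - (lam ^ 2 - c * lam - 1 + (k0 + eps) * exp (- (lam * tau)))).
  assert (Hm1 : 0 < m1) by (unfold m1; lra).
  assert (Hlin : lam ^ 2 - c * lam - 1 <= 0) by (pose proof (exp_pos (- (lam * tau))); nra).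
  destruct (lin_sol_harnack c _ W W1 SW) as (z1 & z2 & Hz1 & Hz2 & _ & _ & HH).
  { intro z. apply (delayed_bounds tau V0 Hg (proj2 PV)). }
  { intro z. apply PW. }
  destruct SW as [D1 D2].
  set (Mh := z2 - z1).
  assert (HW1 : forall z, Rabs (W1 z) <= Mh * W z).
  { intro z. specialize (HH z). specialize (HWp z). apply Rabs_le. unfold Mh. nra. }
  set (v0 := W zs). assert (Hv0 : 0 < v0) by apply HWp.
  (* [W] decays at most exponentially away from [zs], hence more slowly than the Gaussian; so
     [U = W - b om] can be kept nonnegative. *)
  assert (HWlow : forall z, v0 * exp (- Mh * Rabs (z - zs)) <= W z).
  { intro z. unfold v0. destruct (Rle_lt_dec zs z) as [h|h].
    - rewrite Rabs_right by lra.
      eapply Rle_trans; [|apply (exp_growth_lower W W1 (- Mh) D1)]; [apply Rle_refl| |exact h].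
      intro x. specialize (HW1 x). apply Rabs_le_between in HW1. lra.
    - rewrite Rabs_left by lra.
      assert (Q := exp_growth_upper W W1 Mh D1). specialize (Q (fun x => ltac:(specialize (HW1 x); apply Rabs_le_between in HW1; lra)) z zs ltac:(lra)).
      apply Rle_trans with (W z * exp (Mh * (zs - z)) * exp (- Mh * - (z - zs))).
      + apply Rmult_le_compat_r; [left; apply exp_pos|exact Q].
      + right. rewrite Rmult_assoc, <- exp_plus. replace (Mh * (zs - z) + - Mh * - (z - zs)) with 0 by ring. rewrite exp_0. ring. }
  set (r := fun z => delayed g tau V0 z - delayed g tau W z).
  assert (Hr : forall z, 0 <= r z).
  { intro z. unfold r, delayed. pose proof (ms_mono Hg _ _ (HWV (z - tau))). lra. }
  set (r0 := r zs / 2). assert (Hr0 : 0 < r0) by (unfold r0, r, delayed; lra).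
  assert (Hrc : continuous r zs).
  { apply (continuous_minus (delayed g tau V0) (delayed g tau W)); apply (@delayed_continuous g kappa k0 k1 L); try assumption; [apply PV|apply PW]. }
  destruct (continuous_eps r zs r0 Hrc Hr0) as (rho0 & Hrho0 & Hrho).
  set (rho := rho0 / 2). assert (Hrho1 : 0 < rho) by (unfold rho; lra).
  set (N := 1 + (4 / rho + 2 * c) / (4 * rho)).
  assert (HN0 : 0 <= (4 / rho + 2 * c) / (4 * rho)).
  { assert (0 < 4 / rho) by (apply Rdiv_lt_0_compat; lra). apply Rdiv_le_0_compat; lra. }
  assert (HN : 1 <= N) by (unfold N; lra).
  assert (HNr : 4 / rho + 2 * c <= 4 * N * rho).
  { unfold N. apply Rle_trans with (4 * rho * ((4 / rho + 2 * c) / (4 * rho))); [right; field; lra|]. nra. }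
  set (om := gauss N zs). set (om1 := gauss1 N zs). set (om2 := gauss2 N zs).
  set (P := fun z => om2 z - c * om1 z - om z).
  set (CP := 2 * N + 1 + c ^ 2). assert (HCP : 0 < CP) by (unfold CP; nra).
  assert (HP1 : forall z, - CP <= P z) by (intro z; apply gauss_operator_lower; lra).
  assert (HP2 : forall z, rho <= Rabs (z - zs) -> om z <= P z).
  { intros z Hz. apply (gauss_operator_far N c zs z rho); try assumption. }
  assert (Hom : forall z, 0 < om z <= 1) by (intro z; apply gauss_bounds; lra).
  set (Cg := exp (Mh ^ 2 / (4 * N))). assert (HCg : 0 < Cg) by apply exp_pos.
  (* The first bound gives [U >= 0]; the second lets the residual [r >= r0] near [zs] pay for the
     bad part of the Gaussian. *)
  set (b := Rmin (v0 / Cg) (r0 / (2 * CP))).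
  assert (Hb : 0 < b) by (apply Rmin_glb_lt; apply Rdiv_lt_0_compat; lra).
  assert (Hb1 : b * Cg <= v0).
  { apply Rle_trans with (v0 / Cg * Cg); [|right; field; lra]. apply Rmult_le_compat_r; [lra|apply Rmin_l]. }
  assert (Hb2 : b * CP <= r0 / 2).
  { apply Rle_trans with (r0 / (2 * CP) * CP); [|right; field; lra]. apply Rmult_le_compat_r; [lra|apply Rmin_r]. }
  set (U := fun z => W z - b * om z). set (U1 := fun z => W1 z - b * om1 z).
  set (U2 := fun z => (c * W1 z + W z - delayed g tau V0 z) - b * om2 z).
  assert (HUp : forall z, 0 <= U z).
  { intro z. unfold U. pose proof (HWlow z). pose proof (gauss_exp_bound N zs z Mh ltac:(lra)).
    fold Cg in H0. change (gauss N zs z) with (om z) in H0. pose proof (exp_pos (- Mh * Rabs (z - zs))).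
    assert (b * om z <= b * (Cg * exp (- Mh * Rabs (z - zs)))) by (apply Rmult_le_compat_l; lra). nra. }
  assert (HUW : forall z, U z <= W z) by (intro z; unfold U; specialize (Hom z); nra).
  destruct (ms_slope0 Hg eps He) as (d0 & Hd0 & Hs0).
  destruct (ms_slope1 Hg ((1 - k1) / 2) ltac:(lra)) as (d1 & Hd1 & Hs1).
  destruct (fr_left Hf (d0 / 2) ltac:(lra)) as [Z0 HZ0].
  destruct (HWr d1 Hd1) as [Zr HZr].
  set (R0 := 1 + Rabs Z0 + Rabs Zr + tau + Rabs zs + rho).
  pose proof (Rabs_pos Z0) as A0. pose proof (Rabs_pos Zr) as Ar. pose proof (Rabs_pos zs) as As.
  assert (HR1 : - R0 <= Z0) by (pose proof (Rle_abs (- Z0)); rewrite Rabs_Ropp in *; unfold R0; lra).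
  assert (HR2 : Zr + tau <= R0) by (pose proof (Rle_abs Zr); unfold R0; lra).
  assert (HR3 : Rabs zs + rho <= R0) by (unfold R0; lra).
  set (ommin := exp (- N * (2 * R0) ^ 2)). assert (Hommin : 0 < ommin) by apply exp_pos.
  (* The middle zone has strictness [2 q], one half for the cost [L a] of [a eta] and one half left
     as the margin; [ommin] bounds the Gaussian from below on that zone. *)
  set (q := Rmin (r0 / 4) (b * ommin / 2)).
  assert (Hq : 0 < q) by (apply Rmin_glb_lt; [lra|assert (0 < b * ommin) by (apply Rmult_lt_0_compat; lra); lra]).
  assert (Hq1 : q <= r0 / 4) by apply Rmin_l. assert (Hq2 : q <= b * ommin / 2) by apply Rmin_r.
  set (a := Rmin (d0 / 2) (Rmin d1 (q / L))).
  assert (HqL : 0 < q / L) by (apply Rdiv_lt_0_compat; lra).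
  assert (Ha : 0 < a) by (apply Rmin_glb_lt; [lra|apply Rmin_glb_lt; lra]).
  assert (Ha0 : a <= d0 / 2) by apply Rmin_l.
  assert (Ha' : a <= Rmin d1 (q / L)) by apply Rmin_r.
  assert (Ha1 : a <= d1) by (pose proof (Rmin_l d1 (q / L)); lra).
  assert (HaL : L * a <= q).
  { pose proof (Rmin_r d1 (q / L)). apply Rle_trans with (L * (q / L)); [apply Rmult_le_compat_l; lra|right; field; lra]. }
  (* One margin per zone: far left, middle, far right. *)
  set (m := Rmin (a * m1) (Rmin q (a * (1 - k1) / 2))).
  assert (Hm0 : 0 < m).
  { apply Rmin_glb_lt; [apply Rmult_lt_0_compat; lra|]. apply Rmin_glb_lt; [lra|].
    assert (0 < a * (1 - k1)) by (apply Rmult_lt_0_compat; lra). lra. }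
  assert (Hma : m <= a * m1) by apply Rmin_l.
  assert (Hm' : m <= Rmin q (a * (1 - k1) / 2)) by apply Rmin_r.
  assert (Hmq : m <= q) by (pose proof (Rmin_l q (a * (1 - k1) / 2)); lra).
  assert (Hmk : m <= a * (1 - k1) / 2) by (pose proof (Rmin_r q (a * (1 - k1) / 2)); lra).
  set (D := fun z => g (U (z - tau) + a * eta lam (z - tau)) - g (W (z - tau))).
  assert (HDL : forall z, D z <= L * a).
  { intro z. unfold D. set (x := z - tau). pose proof (eta_pos lam x). pose proof (eta_le_1 lam x).
    assert (a * eta lam x <= a) by (apply Rmult_le_1; lra).
    pose proof (ms_mono Hg (U x + a * eta lam x) (W x + a) ltac:(specialize (HUW x); lra)).
    pose proof (ms_lip Hg (W x) (W x + a) ltac:(lra)). lra. }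
  assert (HDleft : forall z, z <= - R0 -> D z <= (k0 + eps) * (a * (exp (lam * z) * exp (- (lam * tau))))).
  { intros z Hz. unfold D. rewrite <- exp_plus. replace (lam * z + - (lam * tau)) with (lam * (z - tau)) by ring.
    set (x := z - tau). pose proof (eta_pos lam x). pose proof (eta_le_1 lam x). pose proof (eta_le_exp lam x).
    assert (Hae : 0 < a * eta lam x <= a) by (split; [apply Rmult_lt_0_compat|apply Rmult_le_1]; lra).
    pose proof (ms_mono Hg (U x + a * eta lam x) (W x + a * eta lam x) ltac:(specialize (HUW x); lra)).
    assert (W x <= d0 / 2) by (eapply Rle_trans; [apply HWphi|]; apply HZ0; unfold x; lra).
    specialize (HWp x).
    destruct (Hs0 (W x) (W x + a * eta lam x) ltac:(lra) ltac:(lra) ltac:(lra)) as [_ Q].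
    assert ((k0 + eps) * (W x + a * eta lam x - W x) <= (k0 + eps) * (a * exp (lam * x))).
    { apply Rmult_le_compat_l; [lra|]. assert (a * eta lam x <= a * exp (lam * x)) by (apply Rmult_le_compat_l; lra). lra. } lra. }
  assert (HDright : forall z, R0 <= z -> D z <= (k1 + (1 - k1) / 2) * a).
  { intros z Hz. unfold D. set (x := z - tau). pose proof (eta_pos lam x). pose proof (eta_le_1 lam x).
    assert (Hae : 0 < a * eta lam x <= a) by (split; [apply Rmult_lt_0_compat|apply Rmult_le_1]; lra).
    pose proof (ms_mono Hg (U x + a * eta lam x) (W x + a) ltac:(specialize (HUW x); lra)).
    assert (kappa - d1 <= W x) by (apply HZr; unfold x; lra).
    pose proof (proj2 (proj2 PW x)).
    pose proof (Hs1 (W x) (W x + a) ltac:(lra) ltac:(lra) ltac:(lra)) as Q.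
    replace (W x + a - W x) with a in Q by ring. lra. }
  assert (HPfar : forall z, R0 <= Rabs z -> 0 <= P z).
  { intros z Hz. assert (rho <= Rabs (z - zs)).
    { pose proof (Rabs_triang (z - zs) zs). replace (z - zs + zs) with z in H by ring. lra. }
    specialize (HP2 z H). specialize (Hom z). lra. }
  assert (HPmid : forall z, Rabs z <= R0 -> - r z - b * P z <= - 2 * q).
  { intros z Hz. destruct (Rle_lt_dec rho (Rabs (z - zs))) as [h|h].
    - specialize (HP2 z h). specialize (Hr z).
      assert (ommin <= om z).
      { unfold ommin, om, gauss. apply exp_le. rewrite <- (pow2_abs (z - zs)).
        assert (Rabs (z - zs) <= 2 * R0).
        { unfold Rminus. eapply Rle_trans; [apply Rabs_triang|]. rewrite Rabs_Ropp. lra. }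
        pose proof (Rabs_pos (z - zs)).
        assert (N * Rabs (z - zs) ^ 2 <= N * (2 * R0) ^ 2) by (apply Rmult_le_compat_l; [lra|apply pow_incr; lra]). lra. }
      assert (b * ommin <= b * P z) by (apply Rmult_le_compat_l; lra). lra.
    - assert (Hz' : Rabs (z - zs) < rho0) by (unfold rho in h; lra).
      specialize (Hrho z Hz'). apply Rabs_def2 in Hrho. specialize (HP1 z).
      assert (r0 <= r z) by (unfold r0 in *; lra). assert (b * - CP <= b * P z) by (apply Rmult_le_compat_l; lra). lra. }
  assert (Hop : forall z, U2 z - c * U1 z - U z + g (U (z - tau) + a * eta lam (z - tau)) = - r z - b * P z + D z).
  { intro z. unfold D, P, r, U2, U1, U, delayed. ring. }
  set (C1 := 2 * N * exp ((1 + lam) ^ 2 / (4 * N)) * (1 + exp (- (lam * zs)))).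
  assert (HC1 : 0 <= C1).
  { unfold C1. pose proof (exp_pos ((1 + lam) ^ 2 / (4 * N))). pose proof (exp_pos (- (lam * zs))).
    apply Rmult_le_pos; [apply Rmult_le_pos|]; lra. }
  assert (HMh : 0 <= Mh) by (unfold Mh; lra).
  assert (HWe : forall z, W z <= (kappa + K) * eta lam z).
  { intro z. apply le_eta; [lra|lra|apply PW|apply HWK]. }
  exists a, m, ((kappa + K) + Mh * (kappa + K) + b * C1), U, U1, U2. constructor; try assumption.
  - intro z. apply (is_derive_minus W (fun z => b * om z)); [apply D1|]. apply (is_derive_scal om), gauss_derive.
  - intro z. apply (is_derive_minus W1 (fun z => b * om1 z)); [apply D2|]. apply (is_derive_scal om1), gauss1_derive.
  - intro z. specialize (HUW z). specialize (HWe z). pose proof (eta_pos lam z).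
    assert (0 <= (Mh * (kappa + K) + b * C1) * eta lam z).
    { apply Rmult_le_pos; [|lra]. apply Rplus_le_le_0_compat; apply Rmult_le_pos; lra. } lra.
  - intro z. unfold U1. unfold Rminus. eapply Rle_trans; [apply Rabs_triang|].
    rewrite Rabs_Ropp, Rabs_mult, (Rabs_right b) by lra.
    pose proof (gauss1_eta N zs z lam HN ltac:(lra)) as G1. fold C1 in G1. change (gauss1 N zs z) with (om1 z) in G1.
    specialize (HW1 z). specialize (HWe z). pose proof (eta_pos lam z).
    assert (Mh * W z <= Mh * ((kappa + K) * eta lam z)) by (apply Rmult_le_compat_l; lra).
    assert (b * Rabs (om1 z) <= b * (C1 * eta lam z)) by (apply Rmult_le_compat_l; lra).
    assert (0 <= (kappa + K) * eta lam z) by (apply Rmult_le_pos; lra). lra.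
  - intros z Hz. pose proof (eta_pos lam z). pose proof (eta_le_1 lam z).
    rewrite (eta_left lam z) in * by lra. specialize (Hop z). set (e := exp (lam * z)) in *.
    replace (U2 z - c * U1 z - U z + a * (lam ^ 2 - c * lam - 1) * e + g (U (z - tau) + a * eta lam (z - tau)))
      with (- r z - b * P z + D z + a * (lam ^ 2 - c * lam - 1) * e) by lra.
    destruct (Rle_lt_dec z (- R0)) as [h|h].
    + specialize (HDleft z h). specialize (Hr z). specialize (HPfar z ltac:(rewrite Rabs_left1; lra)).
      fold e in HDleft.
      assert (0 <= b * P z) by (apply Rmult_le_pos; lra).
      assert (m * e <= a * m1 * e) by (apply Rmult_le_compat_r; lra).
      unfold m1 in *. lra.
    + specialize (HPmid z ltac:(rewrite Rabs_left1; lra)). specialize (HDL z).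
      assert (0 <= a * - (lam ^ 2 - c * lam - 1) * e) by (apply Rmult_le_pos; [apply Rmult_le_pos; lra|lra]).
      assert (m * e <= q * 1) by (apply Rmult_le_compat; lra). lra.
  - intros z Hz. rewrite (eta_right lam z) by lra. specialize (Hop z).
    replace (U2 z - c * U1 z - U z - a + g (U (z - tau) + a * eta lam (z - tau)))
      with (- r z - b * P z + D z - a) by lra.
    destruct (Rle_lt_dec R0 z) as [h|h].
    + specialize (HDright z h). specialize (Hr z). specialize (HPfar z ltac:(rewrite Rabs_right; lra)).
      assert (0 <= b * P z) by (apply Rmult_le_pos; lra). lra.
    + specialize (HPmid z ltac:(rewrite Rabs_right; lra)). specialize (HDL z). lra.
Qed.

(** Lowering the speed by [d] changes the inequality by [d V'] and by a shift [d h] of the delayed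
    argument. Both are of order [d eta], so a small [d] is absorbed by the margin [m eta]. *)
Lemma strict_supersolution_slower_wave {g kappa k0 k1 L} h c lam a m C U U1 U2 : monostable g kappa k0 k1 L ->
  0 <= h -> 0 < c -> 0 < lam -> strict_supersolution g kappa c (c * h) lam a m C U U1 U2 ->
  exists c' psi, c' < c /\ is_wavefront g h kappa c' psi.
Proof.
  intros Hg Hh Hc Hl HS. pose proof (ms_L Hg) as HL. pose proof (ms_kappa Hg) as Hk.
  destruct HS as [Ha Hm D1 D2 Hpos Hbd Hbd1 Hleft Hright].
  assert (HC : 0 <= C).
  { pose proof (Hpos 0). specialize (Hbd 0). pose proof (eta_pos lam 0). destruct (Rle_lt_dec 0 C); [assumption|nra]. }
  (* [C + a lam] bounds the slope of [U + a eta] relative to [eta]; the factor adds the direct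
     effect of [d] and the effect through the delay. *)
  set (Q := (C + a * lam) * (1 + L * h)).
  assert (Hal : 0 < a * lam) by (apply Rmult_lt_0_compat; lra).
  assert (HLh : 0 <= L * h) by (apply Rmult_le_pos; lra).
  assert (HQ : 0 < Q) by (apply Rmult_lt_0_compat; lra).
  set (d := Rmin c (m / Q)).
  assert (Hd : 0 < d) by (apply Rmin_glb_lt; [lra|apply Rdiv_lt_0_compat; lra]).
  assert (Hdc : d <= c) by apply Rmin_l.
  assert (HdQ : d * Q <= m).
  { apply Rle_trans with (m / Q * Q); [apply Rmult_le_compat_r; [lra|apply Rmin_r]|right; field; lra]. }
  set (V := fun z => U z + a * eta lam z).
  exists (c - d).
  assert (HVinc : forall z, V (z - (c - d) * h) - V (z - c * h) <= (C + a * lam) * eta lam z * (d * h)).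
  { intro z. set (p := z - (c - d) * h). set (x := z - c * h).
    assert (Epx : p - x = d * h) by (unfold p, x; ring).
    assert (Hxp : 0 <= d * h) by (apply Rmult_le_pos; lra).
    assert (Hpz : p <= z) by (unfold p; assert (0 <= (c - d) * h) by (apply Rmult_le_pos; lra); lra).
    pose proof (eta_increment lam p x z ltac:(lra) ltac:(lra) Hpz) as I1.
    pose proof (eta_pos lam z).
    assert (I2 : U p - U x <= C * eta lam z * (p - x)).
    { destruct (Rle_lt_dec p x) as [h0|h0].
      - replace p with x by lra. replace (x - x) with 0 by ring. lra.
      - destruct (mean_value U U1 x p h0 (fun y _ => D1 y)) as (y & E & Hy). rewrite E.
        apply Rmult_le_compat_r; [lra|]. eapply Rle_trans; [apply Rle_abs|]. eapply Rle_trans; [apply Hbd1|].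
        apply Rmult_le_compat_l; [exact HC|]. apply eta_mono; lra. }
    rewrite Epx in *. unfold V. nra. }
  assert (HVc : forall z, continuous V z).
  { intro z. apply (continuous_plus U (fun z => a * eta lam z)); [eapply is_derive_continuous, D1|].
    apply (continuous_scal_r a (eta lam)). apply eta_continuous; lra. }
  assert (HV0 : forall z, 0 <= V z).
  { intro z. unfold V. specialize (Hpos z). pose proof (eta_pos lam z). nra. }
  assert (Hgap : forall z, (C + a * lam) * eta lam z * d + L * ((C + a * lam) * eta lam z * (d * h)) <= m * eta lam z).
  { intro z. pose proof (eta_pos lam z).
    replace ((C + a * lam) * eta lam z * d + L * ((C + a * lam) * eta lam z * (d * h))) with (d * Q * eta lam z) by (unfold Q; ring).
    apply Rmult_le_compat_r; lra. }
  destruct (wavefront_below_supersolution h (c - d) V a Hg) as [psi Hpsi].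
  - intros f y y1 Pf [Y1 Y2] Py HfV z.
    enough (y z - V z <= 0) by lra. revert z.
    apply (line_max_principle (c - d) (fun z => y z - V z) kappa).
    + intro z. apply (continuous_minus y V); [apply Py|apply HVc].
    + intro z. pose proof (proj2 (proj2 Py z)). specialize (HV0 z). lra.
    + intros z _.
      assert (Hdel : delayed g ((c - d) * h) f z <= g (V (z - c * h)) + L * ((C + a * lam) * eta lam z * (d * h))).
      { unfold delayed. eapply Rle_trans; [apply (ms_mono Hg), HfV|].
        specialize (HVinc z). set (p := z - (c - d) * h) in *. set (x := z - c * h) in *.
        assert (0 <= (C + a * lam) * eta lam z * (d * h)).
        { pose proof (eta_pos lam z). apply Rmult_le_pos; [apply Rmult_le_pos; lra|apply Rmult_le_pos; lra]. }
        set (I := (C + a * lam) * eta lam z * (d * h)) in *.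
        pose proof (ms_mono Hg (V p) (V x + I) ltac:(lra)).
        pose proof (ms_lip Hg (V x) (V x + I) ltac:(lra)).
        replace (V x + I - V x) with I in * by ring. lra. }
      specialize (Hgap z). specialize (Hbd1 z). apply Rabs_le_between in Hbd1. pose proof (eta_pos lam z).
      (* Since [eta] is a minimum, either branch lies above it; replacing [eta] by the active branch
         gives a smooth function touching [y - V] from below. *)
      destruct (Rle_lt_dec z 0) as [h0|h0].
      * exists (fun x => y x - (U x + a * exp (lam * (x - 0)))), (fun x => y1 x - (U1 x + a * (lam * exp (lam * (x - 0))))),
          (((c - d) * y1 z + y z - delayed g ((c - d) * h) f z) - (U2 z + a * lam * (lam * exp (lam * (z - 0))))).
        split; [|split; [|split; [|split]]].
        -- unfold V. rewrite (eta_left lam z) by lra. rewrite Rminus_0_r. reflexivity.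
        -- intro x. unfold V. rewrite Rminus_0_r. pose proof (eta_le_exp lam x). nra.
        -- intro x. apply (is_derive_minus y (fun x => U x + a * exp (lam * (x - 0)))); [apply Y1|].
           apply (is_derive_plus U (fun x => a * exp (lam * (x - 0)))); [apply D1|apply is_derive_exp_affine].
        -- apply (is_derive_minus y1 (fun x => U1 x + a * (lam * exp (lam * (x - 0))))); [apply Y2|].
           apply (is_derive_plus U1 (fun x => a * (lam * exp (lam * (x - 0))))); [apply D2|].
           apply (is_derive_ext (fun x => a * lam * exp (lam * (x - 0)))); [intro; apply Rmult_assoc|apply is_derive_exp_affine].
        -- specialize (Hleft z h0). rewrite (eta_left lam z) in * by lra. rewrite Rminus_0_r.
           unfold V in Hdel. set (e := exp (lam * z)) in *.
           assert (d * (U1 z + a * (lam * e)) <= d * ((C + a * lam) * e)) by (apply Rmult_le_compat_l; lra).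
           lra.
      * exists (fun x => y x - (U x + a)), (fun x => y1 x - U1 x),
          (((c - d) * y1 z + y z - delayed g ((c - d) * h) f z) - U2 z).
        split; [|split; [|split; [|split]]].
        -- unfold V. rewrite (eta_right lam z) by lra. rewrite Rmult_1_r. reflexivity.
        -- intro x. unfold V. pose proof (eta_le_1 lam x). nra.
        -- intro x. apply (is_derive_minus y (fun x => U x + a)); [apply Y1|].
           replace (U1 x) with (U1 x + 0) by ring. apply (is_derive_plus U (fun x => a)); [apply D1|apply (is_derive_const a)].
        -- apply (is_derive_minus y1 U1); [apply Y2|apply D2].
        -- specialize (Hright z ltac:(lra)). rewrite (eta_right lam z) in * by lra.
           unfold V in Hdel.
           assert (d * U1 z <= d * ((C + a * lam) * 1)) by (apply Rmult_le_compat_l; lra).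
           lra.
  - exact Ha.
  - intro z. unfold V. specialize (Hpos z). pose proof (eta_pos lam z). pose proof (ramp_bounds z).
    destruct (Rle_lt_dec z 0) as [h0|h0].
    + rewrite ramp_left by lra. nra.
    + rewrite eta_right by lra. nra.
  - exact HV0.
  - intros eps He.
    set (B := C + a). assert (HB : 0 < B) by (unfold B; lra).
    exists (ln (eps / B) / lam). intros z Hz.
    assert (HV1 : V z <= B * exp (lam * z)).
    { unfold V, B. specialize (Hbd z). pose proof (eta_le_exp lam z). nra. }
    assert (exp (lam * z) <= eps / B).
    { rewrite <- (exp_ln (eps / B)) by (apply Rdiv_lt_0_compat; lra). apply exp_le.
      apply Rle_trans with (lam * (ln (eps / B) / lam)); [apply Rmult_le_compat_l; lra|right; field; lra]. }
    assert (B * (eps / B) = eps) by (field; lra). nra.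
  - exists psi. split; [lra|exact Hpsi].
Qed.

(* If the decay were slower, a strict supersolution, hence a wavefront, would exist for some smaller speed. *)
Lemma minimal_front_decay {g kappa k0 k1 L} h c phi lam : monostable g kappa k0 k1 L -> 0 <= h -> 0 < c ->
  is_min_speed g h kappa c -> is_wavefront g h kappa c phi -> decay_rate k0 c (c * h) lam ->
  exists M, forall z, phi z <= M * exp (lam * z).
Proof.
  intros Hg Hh Hc [_ Hmin] Hphi Hlam.
  pose proof (wavefront_front h c phi Hg Hphi) as Hf.
  assert (Ht : 0 <= c * h) by (apply Rmult_le_pos; lra).
  destruct (decay_dichotomy c (c * h) phi _ lam Hg Ht Hf Hlam) as [Hfast|Hslow]; [exact Hfast|exfalso].
  destruct (slow_strict_supersolution c (c * h) phi _ lam Hg ltac:(lra) Ht Hf Hlam Hslow)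
    as (a & m & C & U & U1 & U2 & HS).
  destruct Hlam as [Hl _].
  destruct (strict_supersolution_slower_wave h c lam a m C U U1 U2 Hg Hh Hc Hl HS) as (c' & psi & Hlt & Hpsi).
  specialize (Hmin c' psi Hpsi). lra.
Qed.

(** * Monotonicity of rapidly decaying fronts *)

Lemma exp_small_left a M eps : 0 < a -> 0 <= M -> 0 < eps -> exists Z, forall z, z <= Z -> M * exp (a * z) <= eps.
Proof.
  intros Ha HM He. exists (ln (eps / (M + 1)) / a). intros z Hz.
  assert (Hp : 0 < eps / (M + 1)) by (apply Rdiv_lt_0_compat; lra).
  assert (exp (a * z) <= eps / (M + 1)).
  { rewrite <- (exp_ln (eps / (M + 1))) by exact Hp. apply exp_le.
    apply Rle_trans with (a * (ln (eps / (M + 1)) / a)); [apply Rmult_le_compat_l; lra|right; field; lra]. }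
  assert ((M + 1) * (eps / (M + 1)) = eps) by (field; lra). pose proof (exp_pos (a * z)). nra.
Qed.

Lemma continuous_clamp_above (f : R -> R) K : (forall z, continuous f z) -> forall z, continuous (fun x => f (Rmin x K)) z.
Proof.
  intros Hf z. apply (continuous_comp (fun x => Rmin x K) f); [|apply Hf].
  apply (Rmin_continuous (fun x => x) (fun _ => K)); intro x; [apply continuous_id|apply continuous_const].
Qed.

(* Outside a fixed interval the order of a front and its translates propagates by the maximum principle,
   with the weights exp(lam z) on the left and 1 on the right. *)
Lemma translate_order_propagates {g kappa k0 k1 L} c tau phi phi1 lam lam' M : monostable g kappa k0 k1 L -> 0 <= tau ->
  front g kappa c tau phi phi1 -> decay_rate k0 c tau lam -> lam < lam' ->
  (forall z, phi z <= M * exp (lam' * z)) ->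
  exists R0, 0 < R0 /\ forall s, 0 <= s -> (forall z, - R0 <= z <= R0 -> phi z <= phi (z + s)) ->
    forall z, phi z <= phi (z + s).
Proof.
  intros Hg Ht Hf Hlam Hll HM.
  pose proof (front_profile Hf) as Hp.
  pose proof (ms_k0 Hg) as Hk0. pose proof (ms_k1 Hg) as Hk1.
  destruct (decay_rate_margin _ _ _ _ Hlam) as (eps & He & Hm).
  destruct (ms_slope0 Hg eps He) as (d0 & Hd0 & Hs0).
  destruct (ms_slope1 Hg ((1 - k1) / 2) ltac:(lra)) as (d1 & Hd1 & Hs1).
  destruct (fr_left Hf d0 Hd0) as [Z0 HZ0].
  destruct (fr_right Hf d1 Hd1) as [Z1 HZ1].
  set (R0 := 1 + Rabs Z0 + Rabs Z1).
  pose proof (Rabs_pos Z0). pose proof (Rabs_pos Z1).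
  assert (HR0 : - R0 <= Z0) by (pose proof (Rle_abs (- Z0)); rewrite Rabs_Ropp in *; unfold R0; lra).
  assert (HR1 : Z1 <= R0) by (pose proof (Rle_abs Z1); unfold R0; lra).
  exists R0. split; [unfold R0; lra|].
  intros s Hs Hmid.
  destruct (lin_sol_minus c _ _ _ _ _ _ (fr_sol Hf) (lin_sol_shift _ _ _ _ s (fr_sol Hf))) as [D1 D2].
  set (e := fun z => phi z - phi (z + s)) in *. set (e1 := fun z => phi1 z - phi1 (z + s)) in *.
  simpl in D2.
  assert (Hec : forall z, continuous e z) by (intro z; eapply is_derive_continuous, D1).
  assert (Hshift : forall z, delayed g tau phi (z + s) = g (phi (z - tau + s))) by (intro z; unfold delayed; do 2 f_equal; ring).
  pose proof (exp_pos (- (lam * tau))) as Hept.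
  assert (Hleft : forall z, z <= R0 -> e z <= 0).
  { intros x Hx. destruct (Rle_lt_dec (- R0) x) as [hx|hx]; [specialize (Hmid x ltac:(lra)); unfold e; lra|].
    destruct (Rle_lt_dec (e x) 0) as [h|h]; [exact h|exfalso].
    set (f := fun z => e z * exp (- lam * z)).
    assert (Df : forall z, is_derive f z ((e1 z + - lam * e z) * exp (- lam * z))) by (intro z; apply exp_weight_derive, D1).
    assert (Hfx : 0 < f x) by (apply Rmult_lt_0_compat; [exact h|apply exp_pos]).
    assert (HM0 : 0 <= M).
    { pose proof (HM 0). pose proof (fr_pos Hf 0). pose proof (exp_pos (lam' * 0)). destruct (Rle_lt_dec 0 M); [assumption|nra]. }
    (* Here decay at a rate strictly above [lam] enters: the weighted difference becomes small at
       minus infinity, so its maximum is attained. *)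
    destruct (exp_small_left (lam' - lam) M (f x / 2)) as [Zl HZl]; [lra|exact HM0|lra|].
    (* Freezing the argument at [- R0] turns a maximization over a half-line into one over the whole
       line. *)
    destruct (attains_max (fun z => f (Rmin z (- R0))) x (f x / 2) (Rmin Zl (- R0)) (- R0)) as (z0 & Hmax & Hz0).
    - apply continuous_clamp_above. intro z. eapply is_derive_continuous, Df.
    - rewrite Rmin_left by lra. lra.
    - intros z Hz. pose proof (Rmin_l Zl (- R0)). pose proof (Rmin_r Zl (- R0)). rewrite Rmin_left by lra.
      specialize (HZl z ltac:(lra)). eapply Rle_trans; [|exact HZl].
      unfold f. replace ((lam' - lam) * z) with (lam' * z + - lam * z) by ring. rewrite exp_plus, <- Rmult_assoc.
      apply Rmult_le_compat_r; [left; apply exp_pos|]. unfold e.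
      specialize (HM z). pose proof (fr_pos Hf (z + s)). lra.
    - intros z Hz. rewrite Rmin_right by lra. apply Rle_trans with 0; [|lra].
      unfold f. pose proof (exp_pos (- lam * - R0)). specialize (Hmid (- R0)). unfold e. specialize (Hmid ltac:(unfold R0; lra)). nra.
    - destruct Hz0 as [_ Hz0].
      assert (Hmax' : forall z, z <= - R0 -> f z <= f z0).
      { intros z Hz. specialize (Hmax z). rewrite (Rmin_left z), (Rmin_left z0) in Hmax by lra. exact Hmax. }
      set (m := f z0) in *.
      assert (Hm0 : 0 < m) by (specialize (Hmax' x ltac:(lra)); lra).
      assert (Hef : forall z, e z = f z * exp (lam * z)).
      { intro z. unfold f. rewrite Rmult_assoc, <- exp_plus. replace (- lam * z + lam * z) with 0 by ring. rewrite exp_0. ring. }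
      set (E := exp (lam * z0)). assert (HE : 0 < E) by apply exp_pos.
      destruct (local_max_second_derive (fun z => e z - m * exp (lam * (z - 0))) (fun z => e1 z - m * (lam * exp (lam * (z - 0)))) z0
        (c * e1 z0 + e z0 - (delayed g tau phi z0 - delayed g tau phi (z0 + s)) - m * lam * (lam * exp (lam * (z0 - 0)))) (- R0 - z0)) as [L1 L2]; [lra| | | |].
      + intros y _. apply (is_derive_minus e (fun z => m * exp (lam * (z - 0)))); [apply D1|apply is_derive_exp_affine].
      + apply (is_derive_minus e1 (fun z => m * (lam * exp (lam * (z - 0))))); [apply D2|].
        apply (is_derive_ext (fun z => m * lam * exp (lam * (z - 0)))); [intro; apply Rmult_assoc|apply is_derive_exp_affine].
      + intros y Hy. apply Rabs_def2 in Hy. rewrite !Rminus_0_r, (Hef y), (Hef z0). fold m.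
        specialize (Hmax' y ltac:(lra)). pose proof (exp_pos (lam * y)). nra.
      + rewrite !Rminus_0_r in *. fold E in L1, L2.
        assert (Ez0 : e z0 = m * E) by apply Hef.
        assert (Hdel : delayed g tau phi z0 - delayed g tau phi (z0 + s) <= (k0 + eps) * (m * (E * exp (- (lam * tau))))).
        { rewrite Hshift. unfold delayed. set (y := z0 - tau).
          assert (0 <= m * (E * exp (- (lam * tau)))) by (apply Rmult_le_pos; [lra|apply Rmult_le_pos; lra]).
          destruct (Rle_lt_dec (phi y) (phi (y + s))) as [h1|h1].
          - pose proof (ms_mono Hg _ _ h1). assert (0 <= (k0 + eps) * (m * (E * exp (- (lam * tau))))) by (apply Rmult_le_pos; lra). lra.
          - pose proof (fr_pos Hf (y + s)).
            assert (phi y <= d0) by (apply HZ0; unfold y; lra).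
            destruct (Hs0 (phi (y + s)) (phi y) ltac:(lra) ltac:(lra) ltac:(lra)) as [_ Q].
            eapply Rle_trans; [exact Q|]. apply Rmult_le_compat_l; [lra|].
            change (phi y - phi (y + s)) with (e y). rewrite Hef.
            replace (E * exp (- (lam * tau))) with (exp (lam * y)).
            + apply Rmult_le_compat_r; [left; apply exp_pos|]. apply Hmax'. unfold y; lra.
            + unfold E, y. rewrite <- exp_plus. f_equal. ring. }
        assert (Hfin : m * E * (lam ^ 2 - c * lam - 1 + (k0 + eps) * exp (- (lam * tau))) < 0).
        { assert (0 < m * E) by (apply Rmult_lt_0_compat; assumption). nra. }
        assert (H3 : e1 z0 = m * (lam * E)) by lra. rewrite H3, Ez0 in L2. nra. }
  assert (Hall : forall z, e z <= 0); [|intro z; specialize (Hall z); unfold e in Hall; lra].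
  intro x. destruct (Rle_lt_dec x R0) as [hx|hx]; [apply Hleft, hx|].
  destruct (Rle_lt_dec (e x) 0) as [h|h]; [exact h|exfalso].
  destruct (fr_right Hf (e x / 2) ltac:(lra)) as [Zr HZr].
  destruct (attains_max (fun z => e (- (Rmin (- z) (- R0)))) x (e x / 2) R0 (Rmax Zr R0)) as (z0 & Hmax & Hz0).
  - intro z. apply (continuous_comp (fun z => - z) (fun y => e (- Rmin y (- R0)))).
    + apply (continuous_opp (fun z : R => z)), continuous_id.
    + apply (continuous_comp (fun y => Rmin y (- R0)) (fun y => e (- y))).
      * apply (Rmin_continuous (fun x => x) (fun _ => - R0)); intro y; [apply continuous_id|apply continuous_const].
      * apply (continuous_comp (fun z => - z) e); [|apply Hec]. apply (continuous_opp (fun z : R => z)), continuous_id.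
  - rewrite Rmin_left, Ropp_involutive by lra. lra.
  - intros z Hz. rewrite Rmin_right, Ropp_involutive by lra. specialize (Hleft R0 (Rle_refl _)). lra.
  - intros z Hz. pose proof (Rmax_l Zr R0). pose proof (Rmax_r Zr R0). rewrite Rmin_left, Ropp_involutive by lra.
    specialize (HZr (z + s) ltac:(lra)). pose proof (fr_lt Hf z). unfold e at 1. lra.
  - destruct Hz0 as [Hz0 _].
    assert (Hmax' : forall z, e z <= e z0).
    { intros z. destruct (Rle_lt_dec z R0) as [h1|h1].
      - apply Rle_trans with 0; [apply Hleft, h1|].
        specialize (Hmax x). rewrite !Rmin_left, !Ropp_involutive in Hmax by lra. lra.
      - specialize (Hmax z). rewrite !Rmin_left, !Ropp_involutive in Hmax by lra. exact Hmax. }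
    set (m := e z0) in *. assert (Hm0 : 0 < m) by (specialize (Hmax' x); lra).
    destruct (local_max_second_derive e e1 z0 _ 1 ltac:(lra) (fun y _ => D1 y) (D2 z0) (fun y _ => Hmax' y)) as [L1 L2].
    change (phi1 z0 - phi1 (z0 + s)) with (e1 z0) in L2. rewrite L1 in L2. change (phi z0 - phi (z0 + s)) with m in L2.
    (* If the delayed point is still out of order it lies right of [R0], where [g] has slope below
       1; otherwise the delayed difference is nonpositive. *)
    assert (Hdel : delayed g tau phi z0 - delayed g tau phi (z0 + s) <= (k1 + (1 - k1) / 2) * m).
    { rewrite Hshift. unfold delayed. set (y := z0 - tau).
      destruct (Rle_lt_dec (phi y) (phi (y + s))) as [h1|h1].
      - pose proof (ms_mono Hg _ _ h1). nra.
      - assert (Hy : R0 < y).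
        { destruct (Rlt_le_dec R0 y); [assumption|]. specialize (Hleft y ltac:(lra)). unfold e in Hleft. lra. }
        pose proof (HZ1 (y + s) ltac:(lra)). pose proof (fr_lt Hf y).
        eapply Rle_trans; [apply (Hs1 (phi (y + s)) (phi y)); lra|]. apply Rmult_le_compat_l; [lra|]. apply Hmax'. }
    nra.
Qed.

(** Sliding: large translates lie above [phi] on the core interval, hence everywhere. If some shift
    failed, at the supremum of the failing shifts the order would be strict, and compactness of the
    core would allow slightly smaller shifts as well. *)
Lemma fast_front_monotone {g kappa k0 k1 L} c tau phi phi1 lam lam' M : monostable g kappa k0 k1 L -> 0 <= tau ->
  front g kappa c tau phi phi1 -> decay_rate k0 c tau lam -> lam < lam' ->
  (forall z, phi z <= M * exp (lam' * z)) ->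
  forall s, 0 <= s -> forall z, phi z <= phi (z + s).
Proof.
  intros Hg Ht Hf Hlam Hll HM.
  destruct (translate_order_propagates c tau phi phi1 lam lam' M Hg Ht Hf Hlam Hll HM) as (R0 & HR0 & Hprop).
  pose proof (front_profile Hf) as Hp.
  assert (Hcpt : forall z, continuity_pt phi z) by (intro z; apply continuity_pt_filterlim, Hp).
  destruct (fr_sol Hf) as [D1 D2].
  assert (Hlip : exists Lam, 0 <= Lam /\ forall u v, Rabs (phi u - phi v) <= Lam * Rabs (u - v)).
  { destruct (lin_sol_harnack c _ phi phi1 (conj D1 D2)) as (z1 & z2 & Hz1 & Hz2 & _ & _ & HH).
    { intro z. apply (delayed_bounds tau phi Hg (proj2 Hp)). }
    { intro z. apply Hp. }
    pose proof (ms_kappa Hg) as Hk.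
    exists ((z2 - z1) * kappa). split; [apply Rmult_le_pos; lra|].
    apply (derive_bound_lipschitz phi phi1); [exact D1|]. intro z. specialize (HH z).
    pose proof (proj2 Hp z). apply Rabs_le. nra. }
  destruct Hlip as (Lam & HLam & Hlip).
  destruct (continuity_ab_maj phi (- R0) R0) as (zm & Hzm & _); [lra|intros; apply Hcpt|].
  pose proof (fr_lt Hf zm) as Hlt.
  destruct (fr_right Hf (kappa - phi zm) ltac:(lra)) as [Zv HZv].
  assert (Hbig : forall s, 0 <= s -> Zv + R0 <= s -> forall z, phi z <= phi (z + s)).
  { intros s Hs0 Hs. apply Hprop; [exact Hs0|]. intros z Hz. specialize (HZv (z + s) ltac:(lra)). specialize (Hzm z Hz). lra. }
  intros s0 Hs0.
  destruct (classic (forall z, phi z <= phi (z + s0))) as [h|h]; [exact h|exfalso].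
  destruct (completeness (fun s => 0 <= s /\ ~ (forall z, phi z <= phi (z + s)))) as [ss [Hub Hlub]].
  - exists (Zv + R0). intros s [H1 H2]. destruct (Rle_lt_dec s (Zv + R0)); [assumption|]. exfalso. apply H2. apply Hbig; lra.
  - exists s0. tauto.
  - assert (Hss0 : s0 <= ss) by (apply Hub; tauto).
    assert (Habove : forall s, ss < s -> forall z, phi z <= phi (z + s)).
    { intros s Hs. apply NNPP. intro Hn. assert (s <= ss); [|lra]. apply Hub. split; [lra|exact Hn]. }
    assert (Hat : forall z, phi z <= phi (z + ss)).
    { intro z. destruct (Rle_lt_dec (phi z) (phi (z + ss))) as [h1|h1]; [exact h1|exfalso].
      set (q := (phi z - phi (z + ss)) / (2 * (Lam + 1))).
      assert (Hq : 0 < q) by (apply Rdiv_lt_0_compat; lra).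
      specialize (Habove (ss + q) ltac:(lra) z). specialize (Hlip (z + (ss + q)) (z + ss)).
      replace (z + (ss + q) - (z + ss)) with q in Hlip by ring. rewrite (Rabs_right q) in Hlip by lra.
      apply Rabs_le_between in Hlip.
      assert ((Lam + 1) * q = (phi z - phi (z + ss)) / 2) by (unfold q; field; lra). nra. }
    assert (Hss : 0 < ss).
    { destruct Hs0 as [Hs0|Hs0]; [lra|]. exfalso. apply h. intro z. rewrite <- Hs0, Rplus_0_r. lra. }
    assert (Hstrict : forall z, 0 < phi (z + ss) - phi z).
    { destruct (lin_sol_minus c _ _ _ _ _ _ (lin_sol_shift _ _ _ _ ss (conj D1 D2)) (conj D1 D2)) as [E1 E2].
      apply (harnack_positive c (fun z => phi (z + ss) - phi z) _ _ E1 E2).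
      - intro z. simpl. enough (delayed g tau phi z <= delayed g tau phi (z + ss)) by lra.
        unfold delayed. apply (ms_mono Hg). replace (z + ss - tau) with (z - tau + ss) by ring. apply Hat.
      - intro z. specialize (Hat z). lra.
      (* Equality everywhere would make [phi] periodic with period [ss > 0], against its decay at
         minus infinity. *)
      - apply NNPP. intro Hn.
        assert (Heq : forall z, phi (z + ss) = phi z).
        { intro z. specialize (Hat z). destruct (Rle_lt_dec (phi (z + ss)) (phi z)); [lra|]. exfalso. apply Hn. exists z. lra. }
        assert (Hper : forall n, phi (- (INR n * ss)) = phi 0).
        { induction n as [|n IH]; [simpl; f_equal; ring|]. rewrite <- IH, <- Heq. f_equal. rewrite S_INR. ring. }
        pose proof (fr_pos Hf 0) as Hp0.
        destruct (fr_left Hf (phi 0 / 2) ltac:(lra)) as [Z HZ].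
        destruct (INR_archimed ss (- Z) Hss) as [n Hn'].
        specialize (HZ (- (INR n * ss)) ltac:(lra)). rewrite Hper in HZ. lra. }
    destruct (continuity_ab_min (fun z => phi (z + ss) - phi z) (- R0) R0) as (zn & Hzn & _); [lra| |].
    { intros z _. apply continuity_pt_minus; [|apply Hcpt]. apply continuity_pt_filterlim.
      apply (continuous_shift phi ss (proj1 Hp)). }
    set (mu := phi (zn + ss) - phi zn) in *. assert (Hmu : 0 < mu) by apply Hstrict.
    (* On the core the gap is at least [mu], so decreasing the shift by at most [q] keeps the order
       there, and propagation extends it to the line. *)
    set (q := Rmin ss (mu / (Lam + 1))).
    assert (Hq : 0 < q) by (apply Rmin_glb_lt; [lra|apply Rdiv_lt_0_compat; lra]).
    assert (Hq1 : q <= ss) by apply Rmin_l.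
    assert (Hq2 : Lam * q <= mu).
    { apply Rle_trans with ((Lam + 1) * q); [nra|]. apply Rle_trans with ((Lam + 1) * (mu / (Lam + 1))).
      - apply Rmult_le_compat_l; [lra|apply Rmin_r].
      - right. field. lra. }
    assert (ss <= ss - q); [|lra]. apply Hlub. intros s [H1 H2].
    destruct (Rle_lt_dec s (ss - q)) as [h1|h1]; [exact h1|exfalso]. apply H2.
    destruct (Rlt_le_dec ss s) as [h2|h2]; [apply Habove, h2|].
    apply Hprop; [exact H1|]. intros z Hz. specialize (Hzn z Hz).
    specialize (Hlip (z + s) (z + ss)). replace (z + s - (z + ss)) with (s - ss) in Hlip by ring.
    rewrite (Rabs_left1 (s - ss)) in Hlip by lra. apply Rabs_le_between in Hlip. nra.
Qed.

(** The last three fields say that [phi] is negligible against [eta] on the left and [phi'] is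
    negligible against it in both tails; this is why small shifts of the front cost little in the
    weighted norm. *)
Record fast_front (g : R -> R) (kappa c tau lam : R) (phi phi1 : R -> R) : Prop := {
  ff_front : front g kappa c tau phi phi1;
  ff_deriv_pos : forall z, 0 < phi1 z;
  ff_small : forall eps, 0 < eps -> exists Z, forall z, z <= Z -> phi z <= eps * exp (lam * z);
  ff_deriv_small : forall eps, 0 < eps -> exists Z, forall z, z <= Z -> phi1 z <= eps * exp (lam * z);
  ff_deriv_right : forall eps, 0 < eps -> exists Z, forall z, Z <= z -> phi1 z <= eps }.
Arguments ff_front {g kappa c tau lam phi phi1} _.
Arguments ff_deriv_pos {g kappa c tau lam phi phi1} _.
Arguments ff_small {g kappa c tau lam phi phi1} _.
Arguments ff_deriv_small {g kappa c tau lam phi phi1} _.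
Arguments ff_deriv_right {g kappa c tau lam phi phi1} _.

(** The profile equation cannot be differentiated, because [g] need not be differentiable between
    the equilibria. Instead Harnack is applied to the increments [phi (z + s) - phi z], which
    satisfy a linear inequality by monotonicity, and [s] tends to 0. *)
Lemma fast_front_intro {g kappa k0 k1 L} c tau phi phi1 lam lam' M : monostable g kappa k0 k1 L -> 0 <= tau ->
  front g kappa c tau phi phi1 -> decay_rate k0 c tau lam -> lam < lam' ->
  (forall z, phi z <= M * exp (lam' * z)) -> fast_front g kappa c tau lam phi phi1.
Proof.
  intros Hg Ht Hf Hlam Hll HM.
  pose proof (fast_front_monotone c tau phi phi1 lam lam' M Hg Ht Hf Hlam Hll HM) as Hmon.
  pose proof (front_profile Hf) as Hp.
  destruct (fr_sol Hf) as [D1 D2].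
  destruct (lin_sol_harnack c _ phi phi1 (conj D1 D2)) as (z1 & z2 & Hz1 & Hz2 & Hs & Hpr & HH).
  { intro z. apply (delayed_bounds tau phi Hg (proj2 Hp)). }
  { intro z. apply Hp. }
  assert (HM0 : 0 <= M).
  { pose proof (HM 0). pose proof (fr_pos Hf 0). pose proof (exp_pos (lam' * 0)). destruct (Rle_lt_dec 0 M); [assumption|nra]. }
  assert (Hdiff : forall s, 0 <= s -> forall x y, x <= y ->
    (phi (x + s) - phi x) * exp (z1 * (y - x)) <= phi (y + s) - phi y <= (phi (x + s) - phi x) * exp (z2 * (y - x))).
  { intros s Hs0.
    destruct (lin_sol_minus c _ _ _ _ _ _ (lin_sol_shift _ _ _ _ s (conj D1 D2)) (conj D1 D2)) as [E1 E2].
    pose proof (harnack_derive c z1 z2 (fun z => phi (z + s) - phi z) _ _ Hz1 Hz2 Hs Hpr E1 E2) as HD.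
    intros x y Hxy. simpl in HD.
    assert (HD' : forall z, z1 * (phi (z + s) - phi z) <= phi1 (z + s) - phi1 z <= z2 * (phi (z + s) - phi z)).
    { apply HD.
      - intro z. enough (delayed g tau phi z <= delayed g tau phi (z + s)) by lra.
        unfold delayed. apply (ms_mono Hg). replace (z + s - tau) with (z - tau + s) by ring. apply Hmon, Hs0.
      - intro z. pose proof (Hmon s Hs0 z). lra. }
    split.
    - apply (exp_growth_lower (fun z => phi (z + s) - phi z) _ z1 E1 (fun z => proj1 (HD' z)) x y Hxy).
    - apply (exp_growth_upper (fun z => phi (z + s) - phi z) _ z2 E1 (fun z => proj2 (HD' z)) x y Hxy). }
  assert (Hright : forall (f : R -> R) l, is_derive f 0 l -> f 0 = 0 -> (forall s, 0 <= s -> 0 <= f s) -> 0 <= l).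
  { intros f l Hd H0 Hpos. destruct (Rle_lt_dec 0 l) as [h|h]; [exact h|exfalso].
    destruct (derive_pos_right (fun s => - f s) 0 (- l)) as (d & Hd' & K); [apply (is_derive_opp f), Hd|lra|].
    specialize (K (d / 2) ltac:(lra)). specialize (Hpos (d / 2) ltac:(lra)). lra. }
  assert (Dz : forall z, is_derive (fun s => phi (z + s)) 0 (phi1 z)).
  { intro z. apply (is_derive_ext (fun s => phi (s + z))); [intro; f_equal; apply Rplus_comm|].
    apply is_derive_shift. rewrite Rplus_0_l. apply D1. }
  assert (Hinc : forall a x y, is_derive (fun s => (phi (y + s) - phi y) - a * (phi (x + s) - phi x)) 0 (phi1 y - a * phi1 x)).
  { intros a x y.
    replace (phi1 y - a * phi1 x) with ((phi1 y - 0) - a * (phi1 x - 0)) by ring.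
    apply (is_derive_minus (fun s => phi (y + s) - phi y) (fun s => a * (phi (x + s) - phi x))).
    - apply (is_derive_minus (fun s => phi (y + s)) (fun _ => phi y)); [apply Dz|apply (is_derive_const (phi y))].
    - apply (is_derive_scal (fun s => phi (x + s) - phi x)).
      apply (is_derive_minus (fun s => phi (x + s)) (fun _ => phi x)); [apply Dz|apply (is_derive_const (phi x))]. }
  assert (Hd : forall x y, x <= y -> phi1 x * exp (z1 * (y - x)) <= phi1 y <= phi1 x * exp (z2 * (y - x))).
  { intros x y Hxy. split.
    - enough (0 <= phi1 y - exp (z1 * (y - x)) * phi1 x) by lra.
      apply (Hright _ _ (Hinc (exp (z1 * (y - x))) x y)).
      + rewrite !Rplus_0_r. ring.
      + intros s Hs0. destruct (Hdiff s Hs0 x y Hxy). lra.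
    - enough (0 <= - (phi1 y - exp (z2 * (y - x)) * phi1 x)) by lra.
      apply (Hright _ _ (is_derive_opp _ _ _ (Hinc (exp (z2 * (y - x))) x y))).
      + simpl. unfold opp; simpl. rewrite !Rplus_0_r. ring.
      + intros s Hs0. destruct (Hdiff s Hs0 x y Hxy). unfold opp; simpl. lra. }
  assert (Hd0 : forall z, 0 <= phi1 z).
  { intro z. apply (Hright (fun s => phi (z + s) - phi z)).
    - replace (phi1 z) with (phi1 z - 0) by ring.
      apply (is_derive_minus (fun s => phi (z + s)) (fun _ => phi z)); [apply Dz|apply (is_derive_const (phi z))].
    - rewrite Rplus_0_r. ring.
    - intros s Hs0. pose proof (Hmon s Hs0 z). lra. }
  constructor.
  - exact Hf.
  - intro z. destruct (Hd0 z) as [h|h]; [exact h|exfalso].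
    assert (Hall : forall y, phi1 y = 0).
    { intro y. specialize (Hd0 y). destruct (Rle_lt_dec z y) as [h1|h1].
      - destruct (Hd z y h1) as [_ K]. rewrite <- h in K. lra.
      - destruct (Hd y z ltac:(lra)) as [K _]. rewrite <- h in K. pose proof (exp_pos (z1 * (z - y))). nra. }
    pose proof (fr_pos Hf 0) as Hp0.
    destruct (fr_left Hf (phi 0 / 2) ltac:(lra)) as [Z HZ].
    set (x := Rmin Z (-1)). assert (Hx : x <= -1) by apply Rmin_r.
    destruct (mean_value phi phi1 x 0 ltac:(lra) (fun y _ => D1 y)) as (y & E & _).
    rewrite Hall in E. specialize (HZ x (Rmin_l _ _)). lra.
  - intros eps He. destruct (exp_small_left (lam' - lam) M eps ltac:(lra) HM0 He) as [Z HZ].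
    exists Z. intros z Hz. eapply Rle_trans; [apply HM|].
    replace (lam' * z) with ((lam' - lam) * z + lam * z) by ring. rewrite exp_plus, <- Rmult_assoc.
    apply Rmult_le_compat_r; [left; apply exp_pos|apply HZ, Hz].
  - intros eps He. destruct (exp_small_left (lam' - lam) (z2 * M) eps ltac:(lra)) as [Z HZ]; [apply Rmult_le_pos; lra|exact He|].
    exists Z. intros z Hz. apply Rle_trans with (z2 * phi z); [apply HH|].
    apply Rle_trans with (z2 * M * exp (lam' * z)).
    + rewrite Rmult_assoc. apply Rmult_le_compat_l; [lra|apply HM].
    + replace (lam' * z) with ((lam' - lam) * z + lam * z) by ring. rewrite exp_plus, <- Rmult_assoc.
      apply Rmult_le_compat_r; [left; apply exp_pos|apply HZ, Hz].
  - intros eps He.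
    pose proof (exp_pos z1) as Hez.
    destruct (fr_right Hf (eps * exp z1)) as [Z HZ]; [apply Rmult_lt_0_compat; lra|].
    exists Z. intros z Hz. specialize (HZ z Hz).
    (* The increment over a unit interval tends to 0, and Harnack bounds [phi'] at the left end by a
       multiple of its value at the mean-value point. *)
    destruct (mean_value phi phi1 z (z + 1) ltac:(lra) (fun y _ => D1 y)) as (y & E & Hy).
    destruct (Hd z y ltac:(lra)) as [K _].
    pose proof (fr_lt Hf (z + 1)).
    assert (exp z1 <= exp (z1 * (y - z))) by (apply exp_le; nra).
    specialize (Hd0 z).
    assert (phi1 z * exp z1 <= eps * exp z1) by nra.
    apply Rmult_le_reg_r in H1; assumption.
Qed.

(** * The parabolic equation *)

Definition jointly_continuous T0 T (U : R -> R -> R) := forall (t x : nat -> R) (t0 x0 : R),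
  (forall n, T0 <= t n <= T) -> T0 <= t0 <= T -> is_lim_seq t t0 -> is_lim_seq x x0 ->
  is_lim_seq (fun n => U (t n) (x n)) (U t0 x0).

Definition is_subsolution (g : R -> R) h T0 T (U : R -> R -> R) := forall t x, T0 < t <= T ->
  exists ut U1 uxx, is_derive (fun s => U s x) t ut /\ (forall y, is_derive (U t) y (U1 y)) /\
    is_derive U1 x uxx /\ ut <= uxx - U t x + g (U (t - h) x).

(* Supersolutions are understood through test functions touching from above, separately in t and x. *)
Definition supersolution_at (g : R -> R) h T0 (Psi : R -> R -> R) t x :=
  exists (a b b1 : R -> R) pt pxx, a t = Psi t x /\ (forall s, T0 <= s <= t -> Psi s x <= a s) /\ is_derive a t pt /\
    b x = Psi t x /\ (forall y, Psi t y <= b y) /\ (forall y, is_derive b y (b1 y)) /\ is_derive b1 x pxx /\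
    pxx - Psi t x + g (Psi (t - h) x) <= pt.

Lemma supersolution_at_ext g h T0 (P Q : R -> R -> R) t x : (forall r y, P r y = Q r y) ->
  supersolution_at g h T0 P t x -> supersolution_at g h T0 Q t x.
Proof.
  intros E (a & b & b1 & pt & pxx & H1 & H2 & H3 & H4 & H5 & H6 & H7 & H8).
  exists a, b, b1, pt, pxx. rewrite <- !E. repeat (split; [first [assumption|intros; rewrite <- E; auto]|]). exact H8.
Qed.

Definition is_supersolution g h T0 T Psi := forall t x, T0 < t <= T -> supersolution_at g h T0 Psi t x.

(** The weighted difference [(U - Psi) exp (- K t)], penalized by a quadratic in [x], attains a
    maximum. There the derivatives of [U] are compared with those of the two test functions of
    [Psi], one in time and one in space. *)
Lemma comparison (g : R -> R) L h T0 T (U Psi : R -> R -> R) M :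
  0 <= L -> (forall x y, x <= y -> g x <= g y) -> (forall x y, x <= y -> g y - g x <= L * (y - x)) -> 0 <= h ->
  jointly_continuous T0 T U -> jointly_continuous T0 T Psi ->
  is_subsolution g h T0 T U -> is_supersolution g h T0 T Psi ->
  (forall t x, T0 <= t <= T -> U t x - Psi t x <= M) ->
  (forall t x, T0 - h <= t <= T0 -> U t x <= Psi t x) ->
  forall t x, T0 <= t <= T -> U t x <= Psi t x.
Proof.
  intros HL Hgm Hgl Hh CU CP HU HP HM Hinit.
  (* At a positive maximum the diffusion of the penalty costs at most [2 Y], the delayed term [L Y],
     and the linear damping gains [Y]; any rate above [L + 1] gives a contradiction. *)
  set (K := L + 2).
  assert (Hee : forall s, exp (- K * s) * exp (K * s) = 1).
  { intro s. rewrite <- exp_plus. replace (- K * s + K * s) with 0 by ring. apply exp_0. }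
  assert (Hmain : forall eps, 0 < eps -> forall t x, T0 <= t <= T ->
     (U t x - Psi t x) * exp (- K * t) - eps * (1 + x ^ 2) <= 0).
  { intros eps He t1 x1 Ht1.
    set (N := fun t x => (U t x - Psi t x) * exp (- K * t) - eps * (1 + x ^ 2)).
    change (N t1 x1 <= 0). destruct (Rle_lt_dec (N t1 x1) 0) as [h0|h0]; [exact h0|exfalso].
    set (B := exp (- K * T0) * Rabs M / eps).
    assert (HB : 0 <= B).
    { apply Rdiv_le_0_compat; [apply Rmult_le_pos; [left; apply exp_pos|apply Rabs_pos]|exact He]. }
    set (X := 1 + Rabs x1 + B). pose proof (Rabs_pos x1).
    destruct (box_max (fun t x _ => N t x) T0 T (- X) X 0 0) as (t0 & x0 & r0 & Ht0 & Hx0 & _ & Hmax); try lra.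
    { unfold X; lra. }
    { intros t x r t0 x0 r0 A1 A2 A3 B1 B2 B3 L1 L2 L3. unfold N.
      apply is_lim_seq_minus'.
      - apply (is_lim_seq_mult' (fun n => U (t n) (x n) - Psi (t n) (x n)) (fun n => exp (- K * t n))).
        + apply is_lim_seq_minus'; [apply (CU t x t0 x0)|apply (CP t x t0 x0)]; assumption.
        + apply (is_lim_seq_continuous (fun s => exp (- K * s)) t t0); [|exact L1].
          apply (is_derive_continuity_pt (fun s => exp (- K * s)) t0 (- K * exp (- K * t0))). auto_derive; [trivial|ring].
      - apply (is_lim_seq_continuous (fun s => eps * (1 + s ^ 2)) x x0); [|exact L2].
        apply (is_derive_continuity_pt (fun s => eps * (1 + s ^ 2)) x0 (eps * (2 * x0))). auto_derive; [trivial|ring]. }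
    assert (Hx1 : - X <= x1 <= X) by (apply Rabs_le_between; unfold X; lra).
    assert (HN0 : 0 < N t0 x0) by (specialize (Hmax t1 x1 0 Ht1 Hx1 ltac:(lra)); simpl in Hmax; lra).
    assert (Hall : forall t x, T0 <= t <= T -> N t x <= N t0 x0).
    { intros t x Ht. destruct (Rle_lt_dec (Rabs x) X) as [h1|h1].
      - apply (Hmax t x 0 Ht); [apply Rabs_le_between, h1|lra].
      - left. apply Rle_lt_trans with 0; [|exact HN0]. unfold N.
        assert (Hx2 : X <= x ^ 2). { rewrite <- (pow2_abs x). assert (1 <= X) by (unfold X; lra). nra. }
        assert (HMe : (U t x - Psi t x) * exp (- K * t) <= exp (- K * T0) * Rabs M).
        { assert (Hek : exp (- K * t) <= exp (- K * T0)) by (apply exp_le; unfold K; nra).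
          pose proof (exp_pos (- K * t)). specialize (HM t x Ht). pose proof (Rle_abs M). pose proof (Rabs_pos M). nra. }
        assert (eps * B = exp (- K * T0) * Rabs M) by (unfold B; field; lra).
        assert (eps * B <= eps * X) by (apply Rmult_le_compat_l; [lra|unfold X; lra]). nra. }
    set (Y := U t0 x0 - Psi t0 x0).
    pose proof (exp_pos (- K * t0)) as Hek0. pose proof (exp_pos (K * t0)) as Hek1.
    assert (HY : eps * exp (K * t0) < Y).
    { assert (Q : eps < Y * exp (- K * t0)) by (unfold N in HN0; fold Y in HN0; pose proof (pow2_ge_0 x0); nra).
      apply Rmult_lt_compat_r with (r := exp (K * t0)) in Q; [|exact Hek1].
      rewrite Rmult_assoc, Hee, Rmult_1_r in Q. exact Q. }
    assert (HY0 : 0 < Y) by (assert (0 < eps * exp (K * t0)) by (apply Rmult_lt_0_compat; lra); lra).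
    assert (Ht00 : T0 < t0).
    { destruct (proj1 Ht0) as [h1|h1]; [exact h1|exfalso]. specialize (Hinit t0 x0 ltac:(lra)). unfold Y in HY0. lra. }
    destruct (HU t0 x0 ltac:(lra)) as (ut & U1 & uxx & DU1 & DU2 & DU3 & HUe).
    destruct (HP t0 x0 ltac:(lra)) as (a & b & b1 & pt & pxx & Ea & La & Da & Eb & Lb & Db & Db1 & HPe).
    assert (Htime : K * Y <= ut - pt).
    { assert (D : is_derive (fun s => (U s x0 - a s) * exp (- K * s)) t0 ((ut - pt + - K * (U t0 x0 - a t0)) * exp (- K * t0))).
      { apply (exp_weight_derive (fun s => U s x0 - a s)). apply (is_derive_minus (fun s => U s x0) a); assumption. }
      assert (Q := left_max_derive_nonneg _ _ _ (t0 - T0) D ltac:(lra)).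
      assert (Q' : 0 <= (ut - pt + - K * (U t0 x0 - a t0)) * exp (- K * t0)).
      { apply Q. intros s Hs. specialize (La s ltac:(lra)). specialize (Hall s x0 ltac:(lra)). unfold N in Hall.
        rewrite Ea. pose proof (exp_pos (- K * s)). nra. }
      rewrite Ea in Q'. fold Y in Q'. nra. }
    assert (Hspace : uxx - pxx <= 2 * Y).
    { destruct (local_max_second_derive (fun y => (U t0 y - b y) * exp (- K * t0) - eps * (1 + y ^ 2))
        (fun y => (U1 y - b1 y) * exp (- K * t0) - eps * (2 * y)) x0 ((uxx - pxx) * exp (- K * t0) - eps * 2) 1) as [_ Q]; [lra| | | |].
      - intros y _. apply (is_derive_minus (fun y => (U t0 y - b y) * exp (- K * t0)) (fun y => eps * (1 + y ^ 2))).
        + apply (is_derive_ext (fun y => exp (- K * t0) * (U t0 y - b y))); [intro; apply Rmult_comm|].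
          rewrite (Rmult_comm (U1 y - b1 y)).
          apply (is_derive_scal (fun y => U t0 y - b y)). apply (is_derive_minus (U t0) b); [apply DU2|apply Db].
        + auto_derive; [trivial|ring].
      - apply (is_derive_minus (fun y => (U1 y - b1 y) * exp (- K * t0)) (fun y => eps * (2 * y))).
        + apply (is_derive_ext (fun y => exp (- K * t0) * (U1 y - b1 y))); [intro; apply Rmult_comm|].
          rewrite (Rmult_comm (uxx - pxx)).
          apply (is_derive_scal (fun y => U1 y - b1 y)). apply (is_derive_minus U1 b1); assumption.
        + auto_derive; [trivial|ring].
      - intros y _. specialize (Hall t0 y ltac:(lra)). unfold N in Hall. specialize (Lb y). rewrite Eb. nra.
      - assert (Q2 : (uxx - pxx) * exp (- K * t0) <= eps * 2) by lra.
        apply Rmult_le_compat_r with (r := exp (K * t0)) in Q2; [|lra].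
        rewrite Rmult_assoc, Hee, Rmult_1_r in Q2. lra. }
    (* Maximality also controls the delayed difference by [Y], because the weight is larger at
       earlier times; before [T0] the initial ordering applies. *)
    assert (Hdel : g (U (t0 - h) x0) <= g (Psi (t0 - h) x0) + L * Y).
    { assert (Hd : U (t0 - h) x0 <= Psi (t0 - h) x0 + Y).
      { destruct (Rle_lt_dec T0 (t0 - h)) as [h1|h1].
        - specialize (Hall (t0 - h) x0 ltac:(lra)). unfold N in Hall. fold Y in Hall.
          assert (exp (- K * t0) <= exp (- K * (t0 - h))) by (apply exp_le; unfold K; nra).
          destruct (Rle_lt_dec (U (t0 - h) x0) (Psi (t0 - h) x0 + Y)) as [h2|h2]; [exact h2|exfalso].
          assert (Y * exp (- K * t0) < (U (t0 - h) x0 - Psi (t0 - h) x0) * exp (- K * (t0 - h))) by nra. lra.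
        - specialize (Hinit (t0 - h) x0 ltac:(lra)). lra. }
      pose proof (Hgm _ _ Hd). pose proof (Hgl (Psi (t0 - h) x0) (Psi (t0 - h) x0 + Y) ltac:(lra)).
      replace (Psi (t0 - h) x0 + Y - Psi (t0 - h) x0) with Y in * by ring. lra. }
    unfold K in Htime. unfold Y in *. lra. }
  intros t x Ht. destruct (Rle_lt_dec (U t x) (Psi t x)) as [h0|h0]; [exact h0|exfalso].
  pose proof (exp_pos (- K * t)).
  set (Q := (U t x - Psi t x) * exp (- K * t)). assert (HQ : 0 < Q) by (apply Rmult_lt_0_compat; lra).
  assert (Hx : 0 < 1 + x ^ 2) by (pose proof (pow2_ge_0 x); lra).
  specialize (Hmain (Q / (2 * (1 + x ^ 2))) ltac:(apply Rdiv_lt_0_compat; lra) t x Ht). fold Q in Hmain.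
  replace (Q / (2 * (1 + x ^ 2)) * (1 + x ^ 2)) with (Q / 2) in Hmain by (field; lra). lra.
Qed.

Definition evolution (g : R -> R) h kappa (u : R -> R -> R) :=
  (forall t x, - h <= t -> 0 <= u t x <= kappa) /\
  (forall T, jointly_continuous (- h) T u) /\
  (forall t x, 0 < t -> exists ut u1 uxx, is_derive (fun s => u s x) t ut /\ (forall y, is_derive (u t) y (u1 y)) /\
     is_derive u1 x uxx /\ ut = uxx - u t x + g (u (t - h) x)).

Lemma classical_solution_evolution g h kappa w0 u : is_classical_solution g h kappa w0 u -> evolution g h kappa u.
Proof.
  intros (_ & Hb & Hc & Hd). split; [exact Hb|]. split.
  - intros T t x t0 x0 Ht Ht0 Lt Lx. apply is_lim_seq_eps. intros eps He.
    destruct (Hc t0 x0 ltac:(lra) eps He) as (d & Hd0 & K).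
    destruct (proj1 (is_lim_seq_eps _ _) Lt d Hd0) as [N1 H1].
    destruct (proj1 (is_lim_seq_eps _ _) Lx d Hd0) as [N2 H2].
    exists (Nat.max N1 N2). intros n Hn. apply K; [apply Ht|apply H1; lia|apply H2; lia].
  - intros t x Ht. destruct (Hd t x Ht) as (E1 & E2 & E3 & E4).
    exists (Derive (fun s => u s x) t), (Derive (u t)), (Derive_n (u t) 2 x).
    split; [apply Derive_correct, E1|]. split; [|split].
    + intro y. apply Derive_correct. apply (Hd t y Ht).
    + apply Derive_correct, E3.
    + exact E4.
Qed.

(* Doubling of variables: the barrier kappa r (2 - r), r = x - y, controls
   (t - T + 1) (u(t,x) - u(t,y)) on the strip 0 <= r <= 1. *)
Lemma evolution_lipschitz {g kappa k0 k1 L} h u T : monostable g kappa k0 k1 L -> 0 <= h -> evolution g h kappa u -> 1 < T ->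
  forall x y, Rabs (u T x - u T y) <= 2 * kappa * Rabs (x - y).
Proof.
  intros Hg Hh (Hb & Hc & Hd) HT. pose proof (ms_kappa Hg) as Hk.
  assert (Hbb : forall t x y e, - h <= t -> (e = 1 \/ e = - 1) -> e * (u t x - u t y) <= kappa).
  { intros t x y e Ht He. pose proof (Hb t x Ht). pose proof (Hb t y Ht). destruct He; subst e; lra. }
  assert (Hmain : forall e, (e = 1 \/ e = - 1) -> forall x r, 0 <= r <= 1 -> e * (u T x - u T (x - r)) <= kappa * (r * (2 - r))).
  { intros e He x1 r1 Hr1.
    destruct (Rle_lt_dec (e * (u T x1 - u T (x1 - r1))) (kappa * (r1 * (2 - r1)))) as [h0|h0]; [exact h0|exfalso].
    set (del := e * (u T x1 - u T (x1 - r1)) - kappa * (r1 * (2 - r1))). assert (Hdel : 0 < del) by (unfold del; lra).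
    pose proof (pow2_ge_0 x1) as Hx1s.
    (* The first bound keeps the final balance negative; the second keeps the violation at [x1]
       alive after penalization. *)
    set (eps := Rmin (kappa / 4) (del / (2 * (1 + x1 ^ 2)))).
    assert (He0 : 0 < eps) by (apply Rmin_glb_lt; [lra|apply Rdiv_lt_0_compat; lra]).
    assert (He1 : eps <= kappa / 4) by apply Rmin_l.
    assert (He2 : eps * x1 ^ 2 <= del / 2).
    { apply Rle_trans with (del / (2 * (1 + x1 ^ 2)) * (1 + x1 ^ 2)); [|right; field; lra].
      apply Rmult_le_compat; try lra. apply Rmin_r. }
    (* A linear cutoff: the function vanishes at time [T - 1], so no regularity of the data there is
       needed, and it has weight 1 at [T]. *)
    set (tau := fun t => t - (T - 1)).
    set (Z := fun t x r => tau t * (e * (u t x - u t (x - r))) - kappa * (r * (2 - r)) - eps * x ^ 2).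
    assert (HZ1 : 0 < Z T x1 r1). { unfold Z, tau. replace (T - (T - 1)) with 1 by ring. unfold del in *. lra. }
    set (X := 1 + Rabs x1 + kappa / eps).
    assert (HX : 0 <= kappa / eps) by (apply Rdiv_le_0_compat; lra).
    pose proof (Rabs_pos x1).
    destruct (box_max Z (T - 1) T (- X) X 0 1) as (t0 & x0 & r0 & Ht0 & Hx0 & Hr0 & Hmax); try (unfold X; lra).
    { intros t x r ta xa ra A1 A2 A3 B1 B2 B3 L1 L2 L3.
      assert (Lr : is_lim_seq (fun n => x n - r n) (xa - ra)) by (apply is_lim_seq_minus'; assumption).
      assert (C1 : is_lim_seq (fun n => u (t n) (x n)) (u ta xa)) by (apply (Hc T t x); try assumption; [intro n; specialize (A1 n); lra|lra]).
      assert (C2 : is_lim_seq (fun n => u (t n) (x n - r n)) (u ta (xa - ra))).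
      { apply (Hc T t (fun n => x n - r n)); try assumption; [intro n; specialize (A1 n); lra|lra]. }
      unfold Z, tau. apply is_lim_seq_minus'; [apply is_lim_seq_minus'|].
      - apply is_lim_seq_mult'.
        + apply is_lim_seq_minus'; [exact L1|apply is_lim_seq_const].
        + apply is_lim_seq_mult'; [apply is_lim_seq_const|]. apply is_lim_seq_minus'; assumption.
      - apply is_lim_seq_mult'; [apply is_lim_seq_const|]. apply is_lim_seq_mult'; [exact L3|].
        apply is_lim_seq_minus'; [apply is_lim_seq_const|exact L3].
      - apply is_lim_seq_mult'; [apply is_lim_seq_const|]. simpl.
        apply is_lim_seq_mult'; [exact L2|]. apply is_lim_seq_mult'; [exact L2|apply is_lim_seq_const]. }
    assert (HZ0 : 0 < Z t0 x0 r0).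
    { specialize (Hmax T x1 r1 ltac:(lra)). assert (- X <= x1 <= X) by (apply Rabs_le_between; unfold X; lra).
      specialize (Hmax H0 Hr1). lra. }
    assert (Htau : forall t, T - 1 <= t <= T -> 0 <= tau t <= 1) by (intros t Ht; unfold tau; lra).
    assert (Hall : forall t x r, T - 1 <= t <= T -> 0 <= r <= 1 -> Z t x r <= Z t0 x0 r0).
    { intros t x r Ht Hr. destruct (Rle_lt_dec (Rabs x) X) as [h1|h1].
      - apply Hmax; [exact Ht|apply Rabs_le_between, h1|exact Hr].
      - left. apply Rle_lt_trans with 0; [|exact HZ0]. unfold Z.
        assert (Hx2 : X <= x ^ 2). { rewrite <- (pow2_abs x). assert (1 <= X) by (unfold X; lra). nra. }
        assert (kappa <= eps * X).
        { unfold X. rewrite !Rmult_plus_distr_l. replace (eps * (kappa / eps)) with kappa by (field; lra).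
          assert (0 <= eps * Rabs x1) by (apply Rmult_le_pos; lra). lra. }
        specialize (Hbb t x (x - r) e ltac:(lra) He). specialize (Htau t Ht).
        assert (0 <= kappa * (r * (2 - r))) by (apply Rmult_le_pos; [lra|apply Rmult_le_pos; lra]).
        assert (tau t * (e * (u t x - u t (x - r))) <= kappa) by nra. nra. }
    clear Hmax.
    assert (Ht0' : T - 1 < t0).
    { destruct (proj1 Ht0) as [h1|h1]; [exact h1|exfalso]. unfold Z, tau in HZ0. rewrite <- h1 in HZ0.
      assert (0 <= kappa * (r0 * (2 - r0))) by (apply Rmult_le_pos; [lra|apply Rmult_le_pos; lra]).
      pose proof (pow2_ge_0 x0). assert (0 <= eps * x0 ^ 2) by (apply Rmult_le_pos; lra). lra. }
    assert (Hr00 : 0 < r0).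
    { destruct (proj1 Hr0) as [h1|h1]; [exact h1|exfalso]. unfold Z in HZ0. rewrite <- h1, Rminus_0_r in HZ0.
      pose proof (pow2_ge_0 x0). assert (0 <= eps * x0 ^ 2) by (apply Rmult_le_pos; lra). lra. }
    assert (Hr01 : r0 < 1).
    { destruct (proj2 Hr0) as [h1|h1]; [exact h1|exfalso]. unfold Z in HZ0. rewrite h1 in HZ0.
      specialize (Hbb t0 x0 (x0 - 1) e ltac:(lra) He). specialize (Htau t0 Ht0).
      pose proof (pow2_ge_0 x0). assert (0 <= eps * x0 ^ 2) by (apply Rmult_le_pos; lra). nra. }
    set (y0 := x0 - r0).
    destruct (Hd t0 x0 ltac:(lra)) as (utx & u1x & uxx & X1 & X2 & X3 & X4).
    destruct (Hd t0 y0 ltac:(lra)) as (uty & u1y & uyy & Y1 & Y2 & Y3 & Y4).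
    set (du := e * (u t0 x0 - u t0 y0)) in *.
    assert (Htime : 0 <= 1 * du + tau t0 * (e * (utx - uty))).
    { apply (left_max_derive_nonneg (fun s => tau s * (e * (u s x0 - u s y0))) t0 _ (t0 - (T - 1))).
      - apply (is_derive_mult tau (fun s => e * (u s x0 - u s y0))).
        + unfold tau. auto_derive; [trivial|ring].
        + apply (is_derive_scal (fun s => u s x0 - u s y0)). apply (is_derive_minus (fun s => u s x0) (fun s => u s y0)); assumption.
        + intros n m. apply Rmult_comm.
      - lra.
      - intros s Hs. specialize (Hall s x0 r0 ltac:(lra) ltac:(lra)). unfold Z in Hall. unfold y0. lra. }
    set (rho := Rmin r0 (1 - r0)). assert (Hrho : 0 < rho) by (apply Rmin_glb_lt; lra).
    assert (Hrho1 : rho <= r0) by apply Rmin_l. assert (Hrho2 : rho <= 1 - r0) by apply Rmin_r.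
    assert (Hxdir : tau t0 * e * uxx + 2 * kappa - 2 * eps <= 0).
    { destruct (local_max_second_derive
        (fun x => tau t0 * e * (u t0 x - u t0 y0) - (kappa * ((x - y0) * (2 - (x - y0))) + eps * x ^ 2))
        (fun x => tau t0 * e * (u1x x - 0) - (kappa * (2 - 2 * (x - y0)) + eps * (2 * x))) x0
        (tau t0 * e * (uxx - 0) - (kappa * (- 2) + eps * 2)) rho Hrho) as [_ Q].
      - intros y _. apply (is_derive_minus (fun x => tau t0 * e * (u t0 x - u t0 y0)) (fun x => kappa * ((x - y0) * (2 - (x - y0))) + eps * x ^ 2)).
        + apply (is_derive_scal (fun x => u t0 x - u t0 y0)).
          apply (is_derive_minus (u t0) (fun _ => u t0 y0)); [apply X2|apply (is_derive_const (u t0 y0))].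
        + auto_derive; [trivial|ring].
      - apply (is_derive_minus (fun x => tau t0 * e * (u1x x - 0)) (fun x => kappa * (2 - 2 * (x - y0)) + eps * (2 * x))).
        + apply (is_derive_scal (fun x => u1x x - 0)).
          apply (is_derive_minus u1x (fun _ => 0)); [apply X3|apply (is_derive_const 0)].
        + auto_derive; [trivial|ring].
      - intros y Hy. apply Rabs_def2 in Hy. specialize (Hall t0 y (y - y0) Ht0 ltac:(unfold y0; lra)). unfold Z in Hall.
        replace (y - (y - y0)) with y0 in Hall by ring. fold y0 in Hall.
        replace (x0 - y0) with r0 by (unfold y0; ring). lra.
      - lra. }
    assert (Hydir : - (tau t0 * e * uyy) + 2 * kappa <= 0).
    { destruct (local_max_second_derive
        (fun y => tau t0 * e * (u t0 x0 - u t0 y) - (kappa * ((x0 - y) * (2 - (x0 - y)))))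
        (fun y => tau t0 * e * (0 - u1y y) - (kappa * (2 * (x0 - y) - 2))) y0
        (tau t0 * e * (0 - uyy) - (kappa * (- 2))) rho Hrho) as [_ Q].
      - intros y _. apply (is_derive_minus (fun y => tau t0 * e * (u t0 x0 - u t0 y)) (fun y => kappa * ((x0 - y) * (2 - (x0 - y))))).
        + apply (is_derive_scal (fun y => u t0 x0 - u t0 y)).
          apply (is_derive_minus (fun _ => u t0 x0) (u t0)); [apply (is_derive_const (u t0 x0))|apply Y2].
        + auto_derive; [trivial|ring].
      - apply (is_derive_minus (fun y => tau t0 * e * (0 - u1y y)) (fun y => kappa * (2 * (x0 - y) - 2))).
        + apply (is_derive_scal (fun y => 0 - u1y y)).
          apply (is_derive_minus (fun _ => 0) u1y); [apply (is_derive_const 0)|apply Y3].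
        + auto_derive; [trivial|ring].
      - intros y Hy. apply Rabs_def2 in Hy. specialize (Hall t0 x0 (x0 - y) Ht0 ltac:(unfold y0 in Hy; lra)). unfold Z in Hall.
        replace (x0 - (x0 - y)) with y in Hall by ring. fold y0 in Hall.
        replace (x0 - y0) with r0 by (unfold y0; ring). lra.
      - lra. }
    assert (HF : forall x, - kappa <= - u t0 x + g (u (t0 - h) x) <= kappa).
    { intro x. pose proof (Hb t0 x ltac:(lra)). pose proof (Hb (t0 - h) x ltac:(lra)) as Hbd.
      pose proof (ms_mono Hg 0 (u (t0 - h) x) ltac:(lra)). pose proof (ms_mono Hg (u (t0 - h) x) kappa ltac:(lra)).
      rewrite (ms_zero Hg) in *. rewrite (ms_fix Hg) in *. lra. }
    pose proof (HF x0) as F1. pose proof (HF y0) as F2.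
    assert (Hdu : du <= kappa) by (apply Hbb; [lra|exact He]).
    specialize (Htau t0 Ht0).
    set (f1 := - u t0 x0 + g (u (t0 - h) x0)) in *. set (f2 := - u t0 y0 + g (u (t0 - h) y0)) in *.
    replace (utx - uty) with ((uxx - uyy) + (f1 - f2)) in Htime by (unfold f1, f2; lra).
    (* The balance: the cutoff costs [kappa], the reaction [2 kappa], while the concave barrier
       gains [2 kappa] in each of the two variables up to [2 eps]; the total is at most
       [- kappa + 2 eps < 0]. *)
    assert (tau t0 * (e * (f1 - f2)) <= 2 * kappa) by (destruct He; subst e; nra).
    nra. }
  assert (Hord : forall x y, y <= x -> Rabs (u T x - u T y) <= 2 * kappa * Rabs (x - y)).
  { intros x y Hxy. rewrite (Rabs_right (x - y)) by lra.
    destruct (Rle_lt_dec (x - y) 1) as [h1|h1].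
    - pose proof (Hmain 1 ltac:(left; reflexivity) x (x - y) ltac:(lra)) as A1.
      pose proof (Hmain (- 1) ltac:(right; reflexivity) x (x - y) ltac:(lra)) as A2.
      replace (x - (x - y)) with y in * by ring.
      assert (kappa * ((x - y) * (2 - (x - y))) <= 2 * kappa * (x - y)) by nra.
      apply Rabs_le. lra.
    - pose proof (Hb T x ltac:(lra)). pose proof (Hb T y ltac:(lra)).
      apply Rabs_le. nra. }
  intros x y. destruct (Rle_lt_dec y x) as [h0|h0]; [apply Hord, h0|].
  rewrite (Rabs_minus_sym (u T x)), (Rabs_minus_sym x). apply Hord. lra.
Qed.

(** * Stability and convergence *)

Definition is_sign (e : R) := e = 1 \/ e = -1.

(** If [u] solves the equation with [g], then [e u] solves it with [signed e g], which is again
    increasing with the same Lipschitz constant. Lower barriers for [u] thus become upper barriers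
    for [- u]. *)
Definition signed (e : R) (g : R -> R) (y : R) := e * g (e * y).

Lemma is_derive_ext_R (f1 f2 : R -> R) (x l : R) : (forall t : R, f1 t = f2 t) -> is_derive f1 x l -> is_derive f2 x l.
Proof. intros H. apply is_derive_ext. exact H. Qed.

Lemma signed_mono e g : is_sign e -> (forall x y, x <= y -> g x <= g y) -> forall x y, x <= y -> signed e g x <= signed e g y.
Proof.
  intros He Hg x y Hxy. unfold signed. destruct He; subst e.
  - pose proof (Hg (1 * x) (1 * y) ltac:(lra)). lra.
  - pose proof (Hg (-1 * y) (-1 * x) ltac:(lra)). lra.
Qed.

Lemma signed_lip e g L : is_sign e -> (forall x y, x <= y -> g y - g x <= L * (y - x)) ->
  forall x y, x <= y -> signed e g y - signed e g x <= L * (y - x).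
Proof.
  intros He Hg x y Hxy. unfold signed. destruct He; subst e.
  - pose proof (Hg (1 * x) (1 * y) ltac:(lra)). lra.
  - pose proof (Hg (-1 * y) (-1 * x) ltac:(lra)). lra.
Qed.

Lemma evolution_subsolution g h kappa u e T0 T : is_sign e -> 0 <= T0 -> evolution g h kappa u ->
  is_subsolution (signed e g) h T0 T (fun t x => e * u t x).
Proof.
  intros He HT (_ & _ & Hd) t x Ht. destruct (Hd t x ltac:(lra)) as (ut & u1 & uxx & D1 & D2 & D3 & E).
  exists (e * ut), (fun y => e * u1 y), (e * uxx). split; [|split; [|split]].
  - apply (is_derive_scal (fun s => u s x)), D1.
  - intro y. apply (is_derive_scal (u t)), D2.
  - apply (is_derive_scal u1), D3.
  - unfold signed. replace (e * (e * u (t - h) x)) with (u (t - h) x) by (destruct He; subst e; ring).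
    right. rewrite E. ring.
Qed.

Lemma evolution_jointly_continuous g h kappa u e T0 T : 0 <= T0 -> 0 <= h -> evolution g h kappa u ->
  jointly_continuous T0 T (fun t x => e * u t x).
Proof.
  intros HT Hh (_ & Hc & _) t x t0 x0 Ht Ht0 Lt Lx.
  apply is_lim_seq_mult'; [apply is_lim_seq_const|].
  apply (Hc T t x t0 x0); [intro n; specialize (Ht n); lra|lra|exact Lt|exact Lx].
Qed.

Lemma lim_seq_continuous_fun (f : R -> R) (t : nat -> R) (t0 : R) : continuous f t0 -> is_lim_seq t t0 -> is_lim_seq (fun n => f (t n)) (f t0).
Proof. intros Hf Ht. apply (is_lim_seq_continuous f t t0); [|exact Ht]. apply continuity_pt_filterlim, Hf. Qed.

Lemma fast_front_increasing {g kappa c tau lam phi phi1} : fast_front g kappa c tau lam phi phi1 ->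
  forall x y, x < y -> phi x < phi y.
Proof.
  intros [Hf Hd _ _ _] x y Hxy. apply (derive_pos_lt phi phi1); [exact Hxy| |intros; apply Hd].
  intros z _. apply (fr_sol Hf).
Qed.

Lemma fast_front_le {g kappa c tau lam phi phi1} : fast_front g kappa c tau lam phi phi1 ->
  forall x y, x <= y -> phi x <= phi y.
Proof.
  intros H x y [h| ->]; [left; apply (fast_front_increasing H _ _ h)|lra].
Qed.

Lemma fast_front_derive_eta {g kappa k0 k1 L} c tau lam phi phi1 : monostable g kappa k0 k1 L -> 0 < lam ->
  fast_front g kappa c tau lam phi phi1 -> exists C, 0 < C /\ forall z, phi1 z <= C * eta lam z.
Proof.
  intros Hg Hl [Hf Hd Hs Hds Hdr]. pose proof (front_profile Hf) as Hp.
  pose proof (ms_kappa Hg) as Hk.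
  destruct (lin_sol_harnack c _ phi phi1 (fr_sol Hf)) as (z1 & z2 & Hz1 & Hz2 & _ & _ & HH).
  { intro z. apply (delayed_bounds tau phi Hg (proj2 Hp)). }
  { intro z. apply Hp. }
  destruct (Hds 1 Rlt_0_1) as [Z HZ].
  set (B := z2 * kappa). assert (HB : 0 < B) by (apply Rmult_lt_0_compat; lra).
  assert (HBd : forall z, phi1 z <= B).
  { intro z. eapply Rle_trans; [apply HH|]. apply Rmult_le_compat_l; [lra|apply Hp]. }
  pose proof (exp_pos (- lam * Z)) as He.
  exists (B + (1 + B * exp (- lam * Z))). split; [nra|].
  intro z. apply le_eta; [lra|nra|apply HBd|].
  pose proof (exp_pos (lam * z)). destruct (Rle_lt_dec z Z) as [h|h].
  - specialize (HZ z h). assert (0 <= B * exp (- lam * Z) * exp (lam * z)) by (apply Rmult_le_pos; [apply Rmult_le_pos|]; lra). lra.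
  - eapply Rle_trans; [apply HBd|].
    assert (1 <= exp (- lam * Z) * exp (lam * z)).
    { rewrite <- exp_plus, <- exp_0. apply exp_le. nra. } nra.
Qed.

Lemma fast_front_derive_tail g kappa c tau lam phi phi1 : 0 < lam -> fast_front g kappa c tau lam phi phi1 ->
  forall nu, 0 < nu -> exists R0, 0 < R0 /\ forall z, R0 <= Rabs z -> phi1 z <= nu * eta lam z.
Proof.
  intros Hl [Hf Hd Hs Hds Hdr] nu Hnu.
  destruct (Hds nu Hnu) as [Z1 HZ1]. destruct (Hdr nu Hnu) as [Z2 HZ2].
  exists (1 + Rabs Z1 + Rabs Z2). pose proof (Rabs_pos Z1). pose proof (Rabs_pos Z2).
  pose proof (Rle_abs Z2). pose proof (Rle_abs (- Z1)). rewrite Rabs_Ropp in *.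
  split; [lra|]. intros z Hz. destruct (Rle_lt_dec 0 z) as [h|h].
  - rewrite (Rabs_right z) in Hz by lra. rewrite eta_right by lra. specialize (HZ2 z ltac:(lra)). lra.
  - rewrite (Rabs_left z) in Hz by lra. rewrite eta_left by lra. apply HZ1. lra.
Qed.

(** For either sign the reaction term is an ordinary increment of [g] over a length [Q], forward or
    backward, so the same slope estimates apply. *)
Lemma signed_increment e (f : R -> R) v Q : is_sign e ->
  (e * f (v + e * Q) - e * f v = f (v + Q) - f v) \/ (e * f (v + e * Q) - e * f v = f v - f (v - Q)).
Proof.
  intros [->| ->]; [left|right]; [replace (v + 1 * Q) with (v + Q) by ring|replace (v + -1 * Q) with (v - Q) by ring]; ring.
Qed.

(** The computation shared by the stability barriers and the spreading gap. The profile equation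
    cancels the front, leaving the favourable term [p1 phi1] from the moving shift; since
    [e * e = 1], it has the same sign for both values of [e]. Test functions are needed only for the
    perturbation [v]. *)
Lemma perturbed_front_supersolution_at g h c phi phi1 e T0 s (p : R -> R) p1 (v : R -> R -> R) (vt vy vy1 : R -> R) dt dyy t x :
  is_sign e -> lin_sol c (delayed g (c * h) phi) phi phi1 -> is_derive p t p1 ->
  vt t = v t x -> (forall r, T0 <= r <= t -> v r x <= vt r) -> is_derive vt t dt ->
  vy x = v t x -> (forall y, v t y <= vy y) -> (forall y, is_derive vy y (vy1 y)) -> is_derive vy1 x dyy ->
  let Psi := fun t x => e * phi (x + c * t + s + e * p t) + v t x in
  let zt := x + c * t + s + e * p t in
  signed e g (Psi (t - h) x) - e * g (phi (zt - c * h)) + dyy - v t x <= dt + p1 * phi1 zt ->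
  supersolution_at (signed e g) h T0 Psi t x.
Proof.
  intros Hsg [D1 D2] Dp E1 L1 Dt E2 L2 Dy Dy1 Psi zt Hineq.
  exists (fun t => e * phi (x + c * t + s + e * p t) + vt t), (fun y => e * phi (y + c * t + s + e * p t) + vy y),
    (fun y => e * phi1 (y + c * t + s + e * p t) + vy1 y), (e * (phi1 zt * (c + e * p1)) + dt),
    (e * (c * phi1 zt + phi zt - delayed g (c * h) phi zt) + dyy).
  assert (Dz : forall (f : R -> R) y l, is_derive f (y + c * t + s + e * p t) l ->
    is_derive (fun y => f (y + c * t + s + e * p t)) y l).
  { intros f y l Hf. apply (is_derive_ext_R (fun y => f (y + (c * t + s + e * p t)))); [intro; f_equal; ring|].
    apply is_derive_shift. replace (y + (c * t + s + e * p t)) with (y + c * t + s + e * p t) by ring. exact Hf. }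
  split; [|split; [|split; [|split; [|split; [|split; [|split]]]]]].
  - rewrite E1. reflexivity.
  - intros r Hr. apply Rplus_le_compat_l, L1, Hr.
  - apply (is_derive_plus (fun t => e * phi (x + c * t + s + e * p t)) vt); [|exact Dt].
    apply (is_derive_scal (fun t => phi (x + c * t + s + e * p t))).
    rewrite Rmult_comm. apply (is_derive_comp phi (fun t => x + c * t + s + e * p t)); [apply D1|].
    apply (is_derive_plus (fun t => x + c * t + s) (fun t => e * p t)); [auto_derive; [trivial|ring]|].
    apply (is_derive_scal p), Dp.
  - rewrite E2. reflexivity.
  - intro y. apply Rplus_le_compat_l, L2.
  - intro y. apply (is_derive_plus (fun y => e * phi (y + c * t + s + e * p t)) vy); [|apply Dy].
    apply (is_derive_scal (fun y => phi (y + c * t + s + e * p t))), Dz, D1.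
  - apply (is_derive_plus (fun y => e * phi1 (y + c * t + s + e * p t)) vy1); [|exact Dy1].
    apply (is_derive_scal (fun y => phi1 (y + c * t + s + e * p t))), Dz, D2.
  - change (delayed g (c * h) phi zt) with (g (phi (zt - c * h))).
    replace (e * (phi1 zt * (c + e * p1))) with (e * c * phi1 zt + (e * e) * (p1 * phi1 zt)) by ring.
    replace (e * e) with 1 by (destruct Hsg; subst e; ring).
    change (Psi t x) with (e * phi zt + v t x). lra.
Qed.

(* Fife-McLeod barriers: e = 1 bounds u from above, e = -1 from below. *)
Lemma front_stability {g kappa k0 k1 L} h c lam phi phi1 : monostable g kappa k0 k1 L -> 0 <= h -> 0 < c ->
  decay_rate k0 c (c * h) lam -> fast_front g kappa c (c * h) lam phi phi1 ->
  exists q0 gam C, 0 < q0 /\ 0 < gam /\ 0 < C /\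
    forall u e T0 s q, evolution g h kappa u -> is_sign e -> 0 <= T0 -> 0 < q <= q0 ->
      (forall t x, T0 - h <= t <= T0 -> e * u t x <= e * phi (x + c * t + s) + q * eta lam (x + c * t + s)) ->
      forall t x, T0 <= t -> e * u t x <= e * phi (x + c * t + s + e * (C * q)) + q * exp (- gam * (t - T0)) * eta lam (x + c * t + s).
Proof.
  intros Hg Hh Hc Hlam Hff.
  pose proof (ff_front Hff) as Hf. pose proof (fast_front_le Hff) as Hmon.
  pose proof (ff_deriv_pos Hff) as Hphi1.
  pose proof (front_profile Hf) as Hp.
  destruct (fr_sol Hf) as [D1 D2].
  pose proof (ms_kappa Hg) as Hk. pose proof (ms_L Hg) as HL.
  pose proof (ms_k0 Hg) as Hk0. pose proof (ms_k1 Hg) as Hk1.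
  set (tau := c * h) in *. assert (Ht : 0 <= tau) by (apply Rmult_le_pos; lra).
  destruct (decay_rate_margin _ _ _ _ Hlam) as (eps & He & Hm).
  destruct Hlam as [Hl0 Hl1].
  assert (Hlin : lam ^ 2 - c * lam - 1 <= 0) by (pose proof (exp_pos (- (lam * tau))); nra).
  set (k1' := k1 + (1 - k1) / 2).
  (* Both tail inequalities are strict at rate 0, hence survive for small [gam]; the factor
     [exp (gam * h)] appears because the delayed perturbation is larger. *)
  assert (Hgam : exists gam, 0 < gam /\ lam ^ 2 - c * lam - 1 + gam + (k0 + eps) * (exp (gam * h) * exp (- (lam * tau))) <= 0 /\
     - 1 + gam + k1' * exp (gam * h) <= 0).
  { set (f1 := fun x => lam ^ 2 - c * lam - 1 + x + (k0 + eps) * (exp (x * h) * exp (- (lam * tau)))).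
    set (f2 := fun x => - 1 + x + k1' * exp (x * h)).
    assert (F1 : f1 0 < 0) by (unfold f1; rewrite Rmult_0_l, exp_0; lra).
    assert (F2 : f2 0 < 0) by (unfold f2, k1'; rewrite Rmult_0_l, exp_0; lra).
    assert (C1 : continuous f1 0).
    { unfold f1. eapply is_derive_continuous. auto_derive; [trivial|reflexivity]. }
    assert (C2 : continuous f2 0).
    { unfold f2. eapply is_derive_continuous. auto_derive; [trivial|reflexivity]. }
    destruct (continuous_eps f1 0 (- f1 0) C1 ltac:(lra)) as (d1 & Hd1 & K1).
    destruct (continuous_eps f2 0 (- f2 0) C2 ltac:(lra)) as (d2 & Hd2 & K2).
    pose proof (Rmin_glb_lt _ _ _ Hd1 Hd2). pose proof (Rmin_l d1 d2). pose proof (Rmin_r d1 d2).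
    set (x := Rmin d1 d2 / 2) in *. exists x.
    assert (Hx : Rabs (x - 0) = x) by (rewrite Rminus_0_r, Rabs_right; unfold x; lra).
    specialize (K1 x ltac:(rewrite Hx; unfold x; lra)). specialize (K2 x ltac:(rewrite Hx; unfold x; lra)).
    apply Rabs_def2 in K1. apply Rabs_def2 in K2.
    split; [unfold x; lra|]. split; [change (f1 x <= 0); lra|change (f2 x <= 0); lra]. }
  destruct Hgam as (gam & Hgam & Hga & Hgb).
  set (eg := exp (gam * h)) in *.
  assert (Heg : 1 <= eg) by (unfold eg; apply exp_ge_1; nra).
  assert (Hegi : eg * exp (- gam * h) = 1).
  { unfold eg. rewrite <- exp_plus. replace (gam * h + - gam * h) with 0 by ring. apply exp_0. }
  destruct (ms_slope0 Hg eps He) as (d0 & Hd0 & Hs0).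
  destruct (ms_slope1 Hg ((1 - k1) / 2) ltac:(lra)) as (d1 & Hd1 & Hs1).
  destruct (fr_left Hf (d0 / 2) ltac:(lra)) as [Z0 HZ0].
  destruct (fr_right Hf (d1 / 2) ltac:(lra)) as [Z1 HZ1].
  set (R0 := 2 + Rabs Z0 + Rabs Z1 + tau).
  pose proof (Rabs_pos Z0) as A0. pose proof (Rabs_pos Z1) as A1.
  assert (HR0 : - R0 + 1 <= Z0) by (pose proof (Rle_abs (- Z0)); rewrite Rabs_Ropp in *; unfold R0; lra).
  assert (HR1 : Z1 + tau + 1 <= R0) by (pose proof (Rle_abs Z1); unfold R0; lra).
  assert (HRp : 2 <= R0) by (unfold R0; lra).
  assert (Hmu : exists mu, 0 < mu /\ forall z, - R0 - 1 <= z <= R0 + 1 -> mu <= phi1 z).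
  { destruct (continuity_ab_min phi1 (- R0 - 1) (R0 + 1)) as (zm & Hzm & _); [lra| |].
    - intros z _. eapply is_derive_continuity_pt, D2.
    - exists (phi1 zm). split; [apply Hphi1|exact Hzm]. }
  destruct Hmu as (mu & Hmu & Hmin).
  (* Chosen so that in the middle zone, where [phi' >= mu], the term [p' phi'] pays for the reaction
     cost [L eg] and the decay rate [gam]. *)
  set (C := (L * eg + gam) * eg / (gam * mu)).
  assert (HCn : 0 < (L * eg + gam) * eg) by (apply Rmult_lt_0_compat; [|lra]; assert (0 < L * eg) by (apply Rmult_lt_0_compat; lra); lra).
  assert (Hgm : 0 < gam * mu) by (apply Rmult_lt_0_compat; lra).
  assert (HC : 0 < C) by (apply Rdiv_lt_0_compat; assumption).
  assert (HCe : C * (gam * mu) = (L * eg + gam) * eg) by (unfold C; field; lra).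
  (* The shift stays at most 1, and delayed perturbations stay where the slope bounds near 0 and
     [kappa] hold. *)
  set (q0 := Rmin (/ C) (Rmin (d0 / (2 * eg)) (d1 / (2 * eg)))).
  assert (Hq0 : 0 < q0).
  { apply Rmin_glb_lt; [apply Rinv_0_lt_compat, HC|]. apply Rmin_glb_lt; apply Rdiv_lt_0_compat; lra. }
  assert (Hq0C : C * q0 <= 1).
  { apply Rle_trans with (C * / C); [apply Rmult_le_compat_l; [lra|apply Rmin_l]|right; field; lra]. }
  assert (Hq0' : q0 <= Rmin (d0 / (2 * eg)) (d1 / (2 * eg))) by apply Rmin_r.
  assert (Hq0d : q0 * eg <= d0 / 2).
  { apply Rle_trans with (d0 / (2 * eg) * eg); [|right; field; lra]. apply Rmult_le_compat_r; [lra|].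
    pose proof (Rmin_l (d0 / (2 * eg)) (d1 / (2 * eg))). lra. }
  assert (Hq0d1 : q0 * eg <= d1 / 2).
  { apply Rle_trans with (d1 / (2 * eg) * eg); [|right; field; lra]. apply Rmult_le_compat_r; [lra|].
    pose proof (Rmin_r (d0 / (2 * eg)) (d1 / (2 * eg))). lra. }
  exists q0, gam, C. split; [exact Hq0|]. split; [exact Hgam|]. split; [exact HC|].
  intros u e T0 s q Hu Hsg HT0 Hq Hinit T x1 HT.
  (* Starting the shift at [T0 - h] rather than [T0] makes it nonnegative on the whole initial
     window. *)
  set (p := fun t => C * q * (1 - exp (- gam * (t - (T0 - h))))).
  set (E := fun t => 1 * exp (- gam * (t - T0))).
  set (Psi := fun t x => e * phi (x + c * t + s + e * p t) + q * E t * eta lam (x + c * t + s)).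
  assert (HCq0 : C * q <= C * q0) by (apply Rmult_le_compat_l; lra).
  assert (HCq : 0 < C * q <= 1) by (split; [apply Rmult_lt_0_compat; lra|lra]).
  assert (Hp01 : forall t, T0 - h <= t -> 0 <= p t <= C * q).
  { intros t Htt. unfold p. pose proof (exp_pos (- gam * (t - (T0 - h)))).
    assert (exp (- gam * (t - (T0 - h))) <= 1) by (apply exp_decay_le_1; lra).
    split; [apply Rmult_le_pos|apply Rmult_le_1]; lra. }
  assert (Hpmono : forall t t', t <= t' -> p t <= p t').
  { intros t t' Htt. unfold p. assert (exp (- gam * (t' - (T0 - h))) <= exp (- gam * (t - (T0 - h)))) by (apply exp_decay_le; lra).
    apply Rmult_le_compat_l; lra. }
  assert (HE0 : forall t, 0 < E t) by (intro t; unfold E; pose proof (exp_pos (- gam * (t - T0))); lra).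
  assert (HE1 : forall t, T0 <= t -> E t <= 1) by (intros t Htt; unfold E; rewrite Rmult_1_l; apply exp_decay_le_1; lra).
  assert (HEh : forall t, E (t - h) = eg * E t).
  { intro t. unfold E, eg. rewrite !Rmult_1_l, <- exp_plus. f_equal. ring. }
  assert (Hesg : e * e = 1) by (destruct Hsg; subst e; ring).
  assert (Hephi : forall a b, a <= b -> forall y, e * phi (y + e * a) <= e * phi (y + e * b)).
  { intros a b Hab y. destruct Hsg; subst e.
    - pose proof (Hmon (y + 1 * a) (y + 1 * b) ltac:(lra)). lra.
    - pose proof (Hmon (y + -1 * b) (y + -1 * a) ltac:(lra)). lra. }
  assert (Hemb : forall v, 0 <= v <= kappa -> - kappa <= e * v <= kappa) by (intros v Hv; destruct Hsg; subst e; lra).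
  assert (Dp : forall t, is_derive p t (C * q * (gam * (exp (- gam * h) * E t)))).
  { intro t. replace (C * q * (gam * (exp (- gam * h) * E t))) with (0 - C * q * (- gam * exp (- gam * (t - (T0 - h))))).
    - apply (is_derive_ext_R (fun t => C * q - C * q * exp (- gam * (t - (T0 - h))))); [intro; unfold p; ring|].
      apply (is_derive_minus (fun _ => C * q) (fun t => C * q * exp (- gam * (t - (T0 - h))))); [apply (is_derive_const (C * q))|apply is_derive_exp_affine].
    - unfold E. replace (- gam * (t - (T0 - h))) with (- gam * h + - gam * (t - T0)) by ring. rewrite exp_plus. ring. }
  assert (DE : forall t, is_derive E t (- gam * E t)).
  { intro t. unfold E. replace (- gam * (1 * exp (- gam * (t - T0)))) with (1 * (- gam * exp (- gam * (t - T0)))) by ring. apply is_derive_exp_affine. }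
  assert (Hcmp : e * u T x1 <= Psi T x1).
  { apply (comparison (signed e g) L h T0 T (fun t x => e * u t x) Psi (2 * kappa)).
    - lra.
    - apply signed_mono; [exact Hsg|apply (ms_mono Hg)].
    - apply signed_lip; [exact Hsg|apply (ms_lip Hg)].
    - exact Hh.
    - apply (evolution_jointly_continuous g h kappa); assumption.
    - intros t x t0 x0 Htt Htt0 Lt Lx. unfold Psi.
      assert (Lz : is_lim_seq (fun n => x n + c * t n + s) (x0 + c * t0 + s)).
      { apply is_lim_seq_plus'; [|apply is_lim_seq_const]. apply is_lim_seq_plus'; [exact Lx|].
        apply is_lim_seq_mult'; [apply is_lim_seq_const|exact Lt]. }
      apply is_lim_seq_plus'.
      + apply is_lim_seq_mult'; [apply is_lim_seq_const|].
        apply (lim_seq_continuous_fun phi (fun n => x n + c * t n + s + e * p (t n))); [apply Hp|].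
        apply is_lim_seq_plus'; [exact Lz|]. apply is_lim_seq_mult'; [apply is_lim_seq_const|].
        apply (lim_seq_continuous_fun p); [eapply is_derive_continuous, Dp|exact Lt].
      + apply is_lim_seq_mult'.
        * apply is_lim_seq_mult'; [apply is_lim_seq_const|].
          apply (lim_seq_continuous_fun E); [eapply is_derive_continuous, DE|exact Lt].
        * apply (lim_seq_continuous_fun (eta lam) (fun n => x n + c * t n + s)); [apply eta_continuous; lra|exact Lz].
    - apply (evolution_subsolution g h kappa); assumption.
    - intros t x Htt.
      set (z := x + c * t + s). set (zt := z + e * p t).
      specialize (Hp01 t ltac:(lra)) as Hpt. specialize (HE1 t ltac:(lra)) as HEt. specialize (HE0 t) as HEt0.
      set (Q := q * (eg * E t) * eta lam (z - tau)).
      assert (HQ0 : 0 < Q).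
      { unfold Q. pose proof (eta_pos lam (z - tau)). apply Rmult_lt_0_compat; [apply Rmult_lt_0_compat; [lra|apply Rmult_lt_0_compat; lra]|lra]. }
      assert (HQ1 : Q <= q * E t * eg).
      { unfold Q. pose proof (eta_le_1 lam (z - tau)). pose proof (eta_pos lam (z - tau)).
        replace (q * E t * eg) with (q * (eg * E t) * 1) by ring. apply Rmult_le_compat_l; [|lra].
        apply Rmult_le_pos; [lra|apply Rmult_le_pos; lra]. }
      assert (HQ2 : Q <= q0 * eg).
      { eapply Rle_trans; [exact HQ1|]. apply Rmult_le_compat_r; [lra|]. apply Rle_trans with q; [apply Rmult_le_1|]; lra. }
      assert (Hdel : signed e g (Psi (t - h) x) <= e * g (phi (zt - tau) + e * Q)).
      { replace (e * g (phi (zt - tau) + e * Q)) with (signed e g (e * phi (zt - tau) + Q)).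
        - apply signed_mono; [exact Hsg|apply (ms_mono Hg)|]. unfold Psi.
          replace (x + c * (t - h) + s) with (z - tau) by (unfold z, tau; ring).
          rewrite HEh. fold Q. apply Rplus_le_compat_r.
          unfold zt. replace (z + e * p t - tau) with (z - tau + e * p t) by ring.
          apply Hephi, Hpmono. lra.
        - unfold signed. replace (e * (e * phi (zt - tau) + Q)) with (phi (zt - tau) + e * Q); [reflexivity|].
          rewrite Rmult_plus_distr_l, <- Rmult_assoc, Hesg. ring. }
      set (D := e * g (phi (zt - tau) + e * Q) - e * g (phi (zt - tau))).
      assert (HDL : D <= L * Q).
      { destruct (signed_increment e g (phi (zt - tau)) Q Hsg) as [X|X]; unfold D; rewrite X.
        - eapply Rle_trans; [apply (ms_lip Hg); lra|right; ring].
        - eapply Rle_trans; [apply (ms_lip Hg); lra|right; ring]. }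
      assert (Hepz : Rabs (zt - z) <= 1).
      { unfold zt. replace (z + e * p t - z) with (e * p t) by ring. destruct Hsg; subst e; apply Rabs_le; lra. }
      apply Rabs_le_between in Hepz.
      assert (HDleft : z <= - R0 -> D <= (k0 + eps) * Q).
      { intro Hz. assert (X0 : phi (zt - tau) <= d0 / 2) by (apply HZ0; lra).
        pose proof (fr_pos Hf (zt - tau)).
        destruct (signed_increment e g (phi (zt - tau)) Q Hsg) as [X|X]; unfold D; rewrite X.
        - destruct (Hs0 (phi (zt - tau)) (phi (zt - tau) + Q)) as [_ Y]; lra.
        - destruct (Hs0 (phi (zt - tau) - Q) (phi (zt - tau))) as [_ Y]; lra. }
      assert (HDright : R0 <= z -> D <= k1' * Q).
      { intro Hz. assert (X0 : kappa - d1 / 2 <= phi (zt - tau)) by (apply HZ1; lra).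
        pose proof (fr_lt Hf (zt - tau)).
        destruct (signed_increment e g (phi (zt - tau)) Q Hsg) as [X|X]; unfold D; rewrite X.
        - eapply Rle_trans; [apply (Hs1 (phi (zt - tau)) (phi (zt - tau) + Q)); lra|right; unfold k1'; ring].
        - eapply Rle_trans; [apply (Hs1 (phi (zt - tau) - Q) (phi (zt - tau))); lra|right; unfold k1'; ring]. }
      set (qE := q * E t). assert (HqE : 0 < qE) by (apply Rmult_lt_0_compat; lra).
      set (p1 := C * q * (gam * (exp (- gam * h) * E t))).
      assert (Hp1 : p1 * eg = C * gam * qE).
      { unfold p1, qE. replace (C * q * (gam * (exp (- gam * h) * E t)) * eg) with (C * gam * (q * E t) * (eg * exp (- gam * h))) by ring.
        rewrite Hegi. ring. }
      assert (Hp1pos : 0 < p1).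
      { unfold p1. pose proof (exp_pos (- gam * h)). apply Rmult_lt_0_compat; [lra|apply Rmult_lt_0_compat; [lra|apply Rmult_lt_0_compat; lra]]. }
      assert (Hmid : - R0 <= z <= R0 -> qE * (L * eg + gam) <= p1 * phi1 zt).
      { intro Hz. specialize (Hmin zt ltac:(lra)).
        apply Rle_trans with (p1 * mu); [|apply Rmult_le_compat_l; lra].
        apply Rmult_le_reg_r with eg; [lra|].
        replace (p1 * mu * eg) with (p1 * eg * mu) by ring. rewrite Hp1.
        replace (C * gam * qE * mu) with (C * (gam * mu) * qE) by ring. rewrite HCe. right. ring. }
      specialize (Hphi1 zt) as Hphi1z.
      assert (Hp1phi : 0 < p1 * phi1 zt) by (apply Rmult_lt_0_compat; lra).
      (* A smooth branch above [eta] and equal to it at [z] provides both test functions; only the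
         scalar inequality differs between the two sides of the kink. *)
      assert (Hbranch : forall br br1 br2 : R -> R, (forall y, is_derive br y (br1 y)) -> (forall y, is_derive br1 y (br2 y)) ->
        br z = eta lam z -> (forall y, eta lam y <= br y) ->
        D + qE * (br2 z - c * br1 z - br z + gam * br z) <= p1 * phi1 zt ->
        supersolution_at (signed e g) h T0 Psi t x).
      { intros br br1 br2 Db1 Db2 Ebr Hbr Hineq.
        assert (Dlin : is_derive (fun t => x + c * t + s) t c) by (auto_derive; [trivial|ring]).
        assert (Dz : forall (f : R -> R) y l, is_derive f (y + c * t + s) l -> is_derive (fun y => f (y + c * t + s)) y l).
        { intros f y l Hfl. apply (is_derive_ext_R (fun y => f (y + (c * t + s)))); [intro; f_equal; ring|].
          apply is_derive_shift. replace (y + (c * t + s)) with (y + c * t + s) by ring. exact Hfl. }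
        apply (perturbed_front_supersolution_at g h c phi phi1 e T0 s p p1 (fun t x => q * E t * eta lam (x + c * t + s))
          (fun t => q * E t * br (x + c * t + s)) (fun y => qE * br (y + c * t + s)) (fun y => qE * br1 (y + c * t + s))
          (q * (- gam * E t) * br z + qE * (br1 z * c)) (qE * br2 z) t x Hsg (conj D1 D2) (Dp t)).
        - fold z. rewrite Ebr. reflexivity.
        - intros s' Hs'. specialize (HE0 s'). apply Rmult_le_compat_l; [apply Rmult_le_pos; lra|apply Hbr].
        - apply (is_derive_mult (fun t => q * E t) (fun t => br (x + c * t + s))).
          + apply (is_derive_scal E), DE.
          + rewrite Rmult_comm. apply (is_derive_comp br (fun t => x + c * t + s)); [apply Db1|exact Dlin].
          + intros; apply Rmult_comm.
        - fold z. rewrite Ebr. reflexivity.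
        - intro y. apply Rmult_le_compat_l; [left; exact HqE|apply Hbr].
        - intro y. apply (is_derive_scal (fun y => br (y + c * t + s))), Dz, Db1.
        - apply (is_derive_scal (fun y => br1 (y + c * t + s))), Dz, Db2.
        - fold Psi z zt tau qE. rewrite <- Ebr.
          replace (q * (- gam * E t) * br z) with (- gam * (qE * br z)) by (unfold qE; ring).
          change (e * phi (x + c * (t - h) + s + e * p (t - h)) + q * E (t - h) * eta lam (x + c * (t - h) + s)) with (Psi (t - h) x).
          unfold D in Hineq. lra. }
      destruct (Rle_lt_dec z 0) as [hz|hz].
      + apply (Hbranch (fun y => 1 * exp (lam * (y - 0))) (fun y => 1 * (lam * exp (lam * (y - 0)))) (fun y => lam * (lam * exp (lam * (y - 0))))).
        * intro y. apply is_derive_exp_affine.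
        * intro y. apply (is_derive_ext_R (fun y => lam * exp (lam * (y - 0)))); [intro; symmetry; apply Rmult_1_l|apply is_derive_exp_affine].
        * rewrite Rmult_1_l, Rminus_0_r. symmetry. apply eta_left; lra.
        * intro y. rewrite Rmult_1_l, Rminus_0_r. apply eta_le_exp.
        * rewrite !Rmult_1_l, Rminus_0_r. set (ez := exp (lam * z)).
          assert (Hez : 0 < ez <= 1) by (split; [apply exp_pos|unfold ez; apply exp_le_1, Rmult_nonneg_nonpos; lra]).
          destruct (Rle_lt_dec z (- R0)) as [h1|h1].
          -- assert (HQe : Q <= qE * ez * (eg * exp (- (lam * tau)))).
             { unfold Q, qE. pose proof (eta_le_exp lam (z - tau)).
               replace (q * E t * ez * (eg * exp (- (lam * tau)))) with (q * (eg * E t) * (ez * exp (- (lam * tau)))) by ring.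
               apply Rmult_le_compat_l; [apply Rmult_le_pos; [lra|apply Rmult_le_pos; lra]|].
               unfold ez. rewrite <- exp_plus. replace (lam * z + - (lam * tau)) with (lam * (z - tau)) by ring. assumption. }
             specialize (HDleft h1).
             assert ((k0 + eps) * Q <= (k0 + eps) * (qE * ez * (eg * exp (- (lam * tau))))) by (apply Rmult_le_compat_l; lra).
             assert (Hfin : qE * ez * (lam ^ 2 - c * lam - 1 + gam + (k0 + eps) * (eg * exp (- (lam * tau)))) <= 0).
             { apply Rmult_nonneg_nonpos; [apply Rmult_le_pos|]; lra. }
             lra.
          -- specialize (Hmid ltac:(lra)).
             assert (L * Q <= L * (qE * eg)) by (apply Rmult_le_compat_l; [lra|unfold qE; lra]).
             assert (qE * ez * (lam ^ 2 - c * lam - 1) <= 0).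
             { apply Rmult_nonneg_nonpos; [apply Rmult_le_pos|]; lra. }
             assert (qE * gam * ez <= qE * gam * 1) by (apply Rmult_le_compat_l; [apply Rmult_le_pos; lra|lra]). lra.
      + apply (Hbranch (fun _ => 1) (fun _ => 0) (fun _ => 0)).
        * intro y. apply (is_derive_const 1).
        * intro y. apply (is_derive_const 0).
        * symmetry. apply eta_right; lra.
        * intro y. apply eta_le_1.
        * destruct (Rle_lt_dec R0 z) as [h1|h1].
          -- specialize (HDright h1).
             assert (k1' * Q <= k1' * (qE * eg)) by (apply Rmult_le_compat_l; [unfold k1'; lra|unfold qE; lra]).
             assert (qE * (- 1 + gam + k1' * eg) <= 0) by (apply Rmult_nonneg_nonpos; lra). lra.
          -- specialize (Hmid ltac:(lra)).
             assert (L * Q <= L * (qE * eg)) by (apply Rmult_le_compat_l; [lra|unfold qE; lra]). lra.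
    - intros t x Htt. unfold Psi.
      pose proof (Hemb (u t x) (proj1 Hu t x ltac:(lra))). pose proof (Hemb (phi (x + c * t + s + e * p t)) (proj2 Hp _)).
      pose proof (eta_pos lam (x + c * t + s)). specialize (HE0 t).
      assert (0 <= q * E t * eta lam (x + c * t + s)) by (apply Rmult_le_pos; [apply Rmult_le_pos|]; lra). lra.
    - intros t x Htt. eapply Rle_trans; [apply (Hinit t x Htt)|]. unfold Psi.
      pose proof (eta_pos lam (x + c * t + s)).
      assert (1 <= E t).
      { unfold E. rewrite Rmult_1_l. apply exp_ge_1. assert (0 <= gam * (T0 - t)) by (apply Rmult_le_pos; lra). lra. }
      pose proof (Hephi 0 (p t) ltac:(apply Hp01; lra) (x + c * t + s)) as K. rewrite Rmult_0_r, Rplus_0_r in K.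
      assert (q * eta lam (x + c * t + s) <= q * E t * eta lam (x + c * t + s)) by (apply Rmult_le_compat_r; [|apply Rle_trans with (q * 1); [|apply Rmult_le_compat_l]]; lra). lra.
    - lra. }
  eapply Rle_trans; [exact Hcmp|]. unfold Psi, E. rewrite Rmult_1_l. apply Rplus_le_compat_r.
  apply Hephi. apply Hp01. lra.
Qed.

(* Compactly supported (after taking the positive part) subsolution of b_t = b_yy - b, with spreading support. *)
Definition bump K N r tau y : R := exp (- K * tau) * (1 - y ^ 2 / (r ^ 2 + N * tau)) ^ 3.

(** After substituting [y ^ 2 = rho (1 - q)], with [q] the base of the cube, the inequality reduces
    to a quadratic in [q]. The exponent [K] is the one for which completing the square makes it
    nonnegative. *)
Lemma bump_subsolution N r tau y : 0 < N -> 0 < r -> 0 <= tau ->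
  let K := 1 + (3 * N + 30) ^ 2 / (96 * r ^ 2) in
  exists bt b1 byy, is_derive (fun s => bump K N r s y) tau bt /\ (forall x, is_derive (bump K N r tau) x (b1 x)) /\
    is_derive b1 y byy /\ (0 < bump K N r tau y -> bt - byy + bump K N r tau y <= 0).
Proof.
  intros HN Hr Ht K. set (K0 := (3 * N + 30) ^ 2 / (96 * r ^ 2)) in K.
  set (rho := r ^ 2 + N * tau).
  assert (Hr2 : 0 < r ^ 2) by nra.
  assert (Hrho : 0 < rho) by (unfold rho; assert (0 <= N * tau) by (apply Rmult_le_pos; lra); lra).
  assert (Hrho' : r ^ 2 <= rho) by (unfold rho; assert (0 <= N * tau) by (apply Rmult_le_pos; lra); lra).
  set (E := exp (- K * tau)). assert (HE : 0 < E) by apply exp_pos.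
  set (p := fun x => 1 - x ^ 2 / rho).
  exists (E * (- K * p y ^ 3 + 3 * p y ^ 2 * (y ^ 2 * N / rho ^ 2))), (fun x => E * (3 * p x ^ 2 * (- 2 * x / rho))),
    (E * (6 * p y * (4 * y ^ 2 / rho ^ 2) - 6 * p y ^ 2 / rho)).
  split; [|split; [|split]].
  - unfold bump. auto_derive; [replace (r * (r * 1) + N * tau) with rho by (unfold rho; ring); lra|].
    change (exp (- K * tau)) with E. unfold p.
    replace (r * (r * 1) + N * tau) with rho by (unfold rho; ring). field. lra.
  - intro x. unfold bump. fold rho E. unfold p. auto_derive; [lra|]. field. lra.
  - unfold p. auto_derive; [lra|]. field. lra.
  - intro Hpos.
    assert (Hb : bump K N r tau y = E * p y ^ 3) by reflexivity.
    rewrite Hb in *. set (q := p y) in *.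
    assert (Hq : 0 < q).
    { destruct (Rlt_le_dec 0 q) as [h|h]; [exact h|exfalso]. assert (q ^ 3 <= 0) by (pose proof (pow2_ge_0 q); simpl in *; nra). nra. }
    assert (Hy : y ^ 2 = rho * (1 - q)) by (unfold q, p; field; lra).
    assert (Hq1 : q <= 1).
    { pose proof (pow2_ge_0 y). assert (0 <= rho * (1 - q)) by lra. nra. }
    replace (E * (- K * q ^ 3 + 3 * q ^ 2 * (y ^ 2 * N / rho ^ 2)) - E * (6 * q * (4 * y ^ 2 / rho ^ 2) - 6 * q ^ 2 / rho) + E * q ^ 3)
      with (- (E * q / rho * (K0 * rho * q ^ 2 - 3 * q * (1 - q) * N + 24 * (1 - q) - 6 * q)))
      by (unfold K; rewrite Hy; field; lra).
    (* The square is [((3 N + 30) q - 48) ^ 2 / 96]; what remains is [3 N q ^ 2]. *)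
    assert (H0 : 0 <= K0 * rho * q ^ 2 - 3 * q * (1 - q) * N + 24 * (1 - q) - 6 * q).
    { assert (HK0 : K0 * r ^ 2 = (3 * N + 30) ^ 2 / 96) by (unfold K0; field; lra).
      assert (HK0p : 0 <= K0) by (unfold K0; apply Rdiv_le_0_compat; [apply pow2_ge_0|lra]).
      assert (A : (3 * N + 30) ^ 2 / 96 * q ^ 2 <= K0 * rho * q ^ 2).
      { rewrite <- HK0. apply Rmult_le_compat_r; [apply pow2_ge_0|]. apply Rmult_le_compat_l; assumption. }
      pose proof (pow2_ge_0 ((3 * N + 30) * q - 48)) as B.
      assert (0 <= 3 * N * q ^ 2) by (apply Rmult_le_pos; [lra|apply pow2_ge_0]).
      lra. }
    assert (0 <= E * q / rho) by (apply Rdiv_le_0_compat; [apply Rmult_le_pos; lra|lra]).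
    assert (0 <= E * q / rho * (K0 * rho * q ^ 2 - 3 * q * (1 - q) * N + 24 * (1 - q) - 6 * q)) by (apply Rmult_le_pos; assumption).
    lra.
Qed.

Lemma lim_seq_Rmax_0 (u : nat -> R) (l : R) : is_lim_seq u l -> is_lim_seq (fun n => Rmax (u n) 0) (Rmax l 0).
Proof.
  intro H. apply is_lim_seq_eps. intros eps He. destruct (proj1 (is_lim_seq_eps _ _) H eps He) as [N HN].
  exists N. intros n Hn. eapply Rle_lt_trans; [|apply (HN n Hn)].
  apply Rabs_Rmax_le; [apply Rle_refl|]. replace (0 - 0) with 0 by ring. rewrite Rabs_R0. apply Rabs_pos.
Qed.

Lemma fast_front_lipschitz {g kappa k0 k1 L} c tau lam phi phi1 : monostable g kappa k0 k1 L -> 0 < lam ->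
  fast_front g kappa c tau lam phi phi1 ->
  exists C, 0 < C /\ (forall z, phi1 z <= C * eta lam z) /\ forall x y, Rabs (phi x - phi y) <= C * Rabs (x - y).
Proof.
  intros Hg Hl Hff. destruct (fast_front_derive_eta c tau lam phi phi1 Hg Hl Hff) as (C & HC & H).
  exists C. split; [exact HC|]. split; [exact H|].
  apply (derive_bound_lipschitz phi phi1).
  - apply (fr_sol (ff_front Hff)).
  - intro z. pose proof (ff_deriv_pos Hff z). specialize (H z).
    pose proof (eta_le_1 lam z). pose proof (eta_pos lam z). apply Rabs_le. nra.
Qed.

(** Near the point of the gap, Lipschitz bounds leave at least half of it on a ball. This half,
    shaped as a bump, is subtracted from the barrier: monotonicity of [g] allows dropping it from
    the delayed term, so only the equation [b_t = b_yy - b] matters. After unit time the bump is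
    positive on the required interval during a full delay window. *)
Lemma gap_spreads {g kappa k0 k1 L} h c lam phi phi1 : monostable g kappa k0 k1 L -> 0 <= h -> 0 < c -> 0 < lam ->
  fast_front g kappa c (c * h) lam phi phi1 ->
  forall R0 del, 0 < R0 -> 0 < del -> exists d1 B, 0 < d1 /\ 0 < B /\
    forall u e T0 s eps, evolution g h kappa u -> is_sign e -> 1 < T0 -> 0 < eps ->
      (forall t x, T0 - h <= t <= T0 -> e * u t x <= e * phi (x + c * t + s) + eps) ->
      e * u T0 (- c * T0) <= e * phi s - del ->
      forall t x, T0 + 1 <= t <= T0 + 1 + h -> Rabs (x + c * t) <= R0 ->
        e * u t x <= e * phi (x + c * t + s) + eps * B - d1.
Proof.
  intros Hg Hh Hc Hl Hff R0 del HR0 Hdel.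
  pose proof (ff_front Hff) as Hf. pose proof (front_profile Hf) as Hp.
  destruct (fr_sol Hf) as [D1 D2].
  pose proof (ms_kappa Hg) as Hk. pose proof (ms_L Hg) as HL.
  destruct (fast_front_lipschitz c (c * h) lam phi phi1 Hg Hl Hff) as (Lam & HLam & _ & Hlip).
  (* [2 kappa] and [Lam] are the Lipschitz constants of [u] and [phi]; within radius [r] they
     consume at most [del / 2]. *)
  set (r := del / (2 * (2 * kappa + Lam))).
  assert (Hr : 0 < r) by (apply Rdiv_lt_0_compat; lra).
  assert (Hrd : (2 * kappa + Lam) * r = del / 2) by (unfold r; field; lra).
  assert (Hch : 0 <= c * (1 + h)) by (apply Rmult_le_pos; lra).
  (* The bump stays at a fixed [x] while the front frame moves; [ell] adds this drift. Taking
     [N = 2 ell ^ 2] makes the base of the cube at least one half on the target after unit time,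
     whence the factor [/ 8]. *)
  set (ell := R0 + c * (1 + h)). assert (Hell : 0 < ell) by (unfold ell; lra).
  set (N := 2 * ell ^ 2). assert (HN : 0 < N) by (unfold N; nra).
  set (K := 1 + (3 * N + 30) ^ 2 / (96 * r ^ 2)).
  assert (HK : 0 <= K).
  { unfold K. assert (0 <= (3 * N + 30) ^ 2 / (96 * r ^ 2)) by (apply Rdiv_le_0_compat; [apply pow2_ge_0|nra]). lra. }
  set (d1 := del / 2 * (exp (- K * (1 + h)) * / 8)).
  assert (Hd1 : 0 < d1).
  { unfold d1. pose proof (exp_pos (- K * (1 + h))). apply Rmult_lt_0_compat; lra. }
  exists d1, (exp (L * (1 + 2 * h))). split; [exact Hd1|]. split; [apply exp_pos|].
  intros u e T0 s eps Hu Hsg HT0 Heps Hinit Hgap T x1 HT Hx1.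
  assert (Hesg : e * e = 1) by (destruct Hsg; subst e; ring).
  set (y0 := - c * T0).
  (* The initial error may grow at the Lipschitz rate of [g]; over the total length [1 + 2 h] this
     produces the constant [B]. *)
  set (G := fun t => eps * exp (L * (t - (T0 - h)))).
  set (bp := fun t x => if Rlt_dec t T0 then 0 else Rmax (bump K N r (t - T0) (x - y0)) 0).
  set (Psi := fun t x => e * phi (x + c * t + s) + G t - del / 2 * bp t x).
  assert (Hbp0 : forall t x, 0 <= bp t x) by (intros t x; unfold bp; destruct (Rlt_dec t T0); [lra|apply Rmax_r]).
  assert (Hbp1 : forall t x, T0 <= t -> bp t x = Rmax (bump K N r (t - T0) (x - y0)) 0).
  { intros t x Htt. unfold bp. destruct (Rlt_dec t T0); [lra|reflexivity]. }
  assert (DG : forall t, is_derive G t (eps * (L * exp (L * (t - (T0 - h)))))) by (intro t; apply is_derive_exp_affine).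
  assert (HG0 : forall t, 0 < G t) by (intro t; unfold G; pose proof (exp_pos (L * (t - (T0 - h)))); apply Rmult_lt_0_compat; lra).
  assert (HGe : forall t, T0 - h <= t -> eps <= G t).
  { intros t Htt. unfold G. assert (1 <= exp (L * (t - (T0 - h)))).
    { apply exp_ge_1. apply Rmult_le_pos; lra. } nra. }
  assert (HGm : forall t t', t <= t' -> G t <= G t').
  { intros t t' Htt. unfold G. apply Rmult_le_compat_l; [lra|]. apply exp_le, Rmult_le_compat_l; lra. }
  assert (Hemb : forall v, 0 <= v <= kappa -> - kappa <= e * v <= kappa) by (intros v Hv; destruct Hsg; subst e; lra).
  assert (Hrho : forall t, T0 <= t -> 0 < r ^ 2 + N * (t - T0)).
  { intros t Htt. assert (0 < r ^ 2) by nra. assert (0 <= N * (t - T0)) by (apply Rmult_le_pos; lra). lra. }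
  assert (Hbump1 : forall t x, T0 <= t -> bump K N r (t - T0) (x - y0) <= 1).
  { intros t x Htt. unfold bump. specialize (Hrho t Htt).
    assert (Hsq : 0 <= (x - y0) ^ 2 / (r ^ 2 + N * (t - T0))) by (apply Rdiv_le_0_compat; [apply pow2_ge_0|lra]).
    set (v := 1 - (x - y0) ^ 2 / (r ^ 2 + N * (t - T0))) in *.
    assert (Hv : v <= 1) by (unfold v; lra).
    assert (Hv3 : v ^ 3 <= 1).
    { destruct (Rle_lt_dec 0 v).
      - rewrite <- (pow1 3). apply pow_incr. lra.
      - assert (v ^ 3 <= 0); [|lra]. pose proof (pow2_ge_0 v). simpl in *. nra. }
    pose proof (exp_pos (- K * (t - T0))).
    assert (exp (- K * (t - T0)) <= 1).
    { apply exp_le_1. assert (0 <= K * (t - T0)) by (apply Rmult_le_pos; lra). lra. }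
    nra. }
  assert (Hcmp : e * u T x1 <= Psi T x1).
  { apply (comparison (signed e g) L h T0 T (fun t x => e * u t x) Psi (2 * kappa + del)).
    - lra.
    - apply signed_mono; [exact Hsg|apply (ms_mono Hg)].
    - apply signed_lip; [exact Hsg|apply (ms_lip Hg)].
    - exact Hh.
    - apply (evolution_jointly_continuous g h kappa); try assumption. lra.
    - intros t x t0 x0 Htt Htt0 Lt Lx. unfold Psi.
      assert (Lz : is_lim_seq (fun n => x n + c * t n + s) (x0 + c * t0 + s)).
      { apply is_lim_seq_plus'; [|apply is_lim_seq_const]. apply is_lim_seq_plus'; [exact Lx|].
        apply is_lim_seq_mult'; [apply is_lim_seq_const|exact Lt]. }
      assert (Ltau : is_lim_seq (fun n => t n - T0) (t0 - T0)) by (apply is_lim_seq_minus'; [exact Lt|apply is_lim_seq_const]).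
      assert (Ly : is_lim_seq (fun n => x n - y0) (x0 - y0)) by (apply is_lim_seq_minus'; [exact Lx|apply is_lim_seq_const]).
      apply is_lim_seq_minus'.
      + apply is_lim_seq_plus'.
        * apply is_lim_seq_mult'; [apply is_lim_seq_const|].
          apply (lim_seq_continuous_fun phi (fun n => x n + c * t n + s)); [apply Hp|exact Lz].
        * apply (lim_seq_continuous_fun G); [eapply is_derive_continuous, DG|exact Lt].
      + apply is_lim_seq_mult'; [apply is_lim_seq_const|].
        rewrite Hbp1 by lra.
        apply (is_lim_seq_ext (fun n => Rmax (bump K N r (t n - T0) (x n - y0)) 0)).
        * intro n. symmetry. apply Hbp1. specialize (Htt n). lra.
        * apply (lim_seq_Rmax_0 (fun n => bump K N r (t n - T0) (x n - y0))).
          unfold bump. apply is_lim_seq_mult'.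
          -- apply (lim_seq_continuous_fun (fun y => exp (- K * y)) (fun n => t n - T0)); [|exact Ltau].
             apply (is_derive_continuous _ _ (- K * exp (- K * (t0 - T0)))). auto_derive; [trivial|ring].
          -- apply (lim_seq_continuous_fun (fun y => y ^ 3) (fun n => 1 - (x n - y0) ^ 2 / (r ^ 2 + N * (t n - T0)))).
             ++ eapply is_derive_continuous. auto_derive; [trivial|reflexivity].
             ++ apply is_lim_seq_minus'; [apply is_lim_seq_const|]. apply is_lim_seq_div'.
                ** apply (lim_seq_continuous_fun (fun y => y ^ 2) (fun n => x n - y0)); [|exact Ly].
                   eapply is_derive_continuous. auto_derive; [trivial|reflexivity].
                ** apply is_lim_seq_plus'; [apply is_lim_seq_const|].
                   apply is_lim_seq_mult'; [apply is_lim_seq_const|exact Ltau].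
                ** specialize (Hrho t0 ltac:(lra)). lra.
    - apply (evolution_subsolution g h kappa); try assumption. lra.
    - intros t x Htt. set (z := x + c * t + s).
      assert (Hdel' : signed e g (Psi (t - h) x) <= e * g (phi (z - c * h)) + L * G t).
      { apply Rle_trans with (signed e g (e * phi (z - c * h) + G t)).
        - apply signed_mono; [exact Hsg|apply (ms_mono Hg)|]. unfold Psi.
          replace (x + c * (t - h) + s) with (z - c * h) by (unfold z; ring).
          pose proof (Hbp0 (t - h) x). pose proof (HGm (t - h) t ltac:(lra)).
          assert (0 <= del / 2 * bp (t - h) x) by (apply Rmult_le_pos; lra). lra.
        - specialize (HG0 t).
          pose proof (signed_lip e g L Hsg (ms_lip Hg) (e * phi (z - c * h)) (e * phi (z - c * h) + G t) ltac:(lra)) as X.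
          unfold signed in X at 2. rewrite <- Rmult_assoc, Hesg, Rmult_1_l in X. lra. }
      assert (Hbranch : forall (ft fy fy1 : R -> R) dt dyy, ft t = bp t x -> (forall s', T0 <= s' <= t -> ft s' <= bp s' x) -> is_derive ft t dt ->
        fy x = bp t x -> (forall y, fy y <= bp t y) -> (forall y, is_derive fy y (fy1 y)) -> is_derive fy1 x dyy ->
        dt - dyy + bp t x <= 0 -> supersolution_at (signed e g) h T0 Psi t x).
      { intros ft fy fy1 dt dyy F1 F2 F3 F4 F5 F6 F7 F8.
        apply (supersolution_at_ext _ _ _ (fun t x => e * phi (x + c * t + s + e * 0) + (G t - del / 2 * bp t x)));
          [intros r' y'; unfold Psi; rewrite Rmult_0_r, Rplus_0_r; ring|].
        apply (perturbed_front_supersolution_at g h c phi phi1 e T0 s (fun _ => 0) 0 (fun t x => G t - del / 2 * bp t x)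
          (fun t => G t - del / 2 * ft t) (fun y => G t - del / 2 * fy y) (fun y => 0 - del / 2 * fy1 y)
          (eps * (L * exp (L * (t - (T0 - h)))) - del / 2 * dt) (0 - del / 2 * dyy) t x Hsg (conj D1 D2) (is_derive_const 0 t)).
        - rewrite F1. reflexivity.
        - intros s' Hs'. specialize (F2 s' Hs'). assert (del / 2 * ft s' <= del / 2 * bp s' x) by (apply Rmult_le_compat_l; lra). lra.
        - apply (is_derive_minus G (fun t => del / 2 * ft t)); [apply DG|apply (is_derive_scal ft), F3].
        - rewrite F4. reflexivity.
        - intro y. specialize (F5 y). assert (del / 2 * fy y <= del / 2 * bp t y) by (apply Rmult_le_compat_l; lra). lra.
        - intro y. apply (is_derive_minus (fun _ => G t) (fun y => del / 2 * fy y)); [apply (is_derive_const (G t))|apply (is_derive_scal fy), F6].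
        - apply (is_derive_minus (fun _ => 0) (fun y => del / 2 * fy1 y)); [apply (is_derive_const 0)|apply (is_derive_scal fy1), F7].
        - rewrite Rmult_0_r, !Rplus_0_r, Rmult_0_l. fold z.
          replace (e * phi (x + c * (t - h) + s) + (G (t - h) - del / 2 * bp (t - h) x)) with (Psi (t - h) x) by (unfold Psi; ring).
          replace (eps * (L * exp (L * (t - (T0 - h))))) with (L * G t) by (unfold G; ring). specialize (HG0 t).
          assert (del / 2 * (dt - dyy + bp t x) <= 0) by (apply Rmult_nonneg_nonpos; lra).
          lra. }
      destruct (Rlt_le_dec 0 (bump K N r (t - T0) (x - y0))) as [hb|hb].
      + destruct (bump_subsolution N r (t - T0) (x - y0) HN Hr ltac:(lra)) as (bt & b1 & byy & B1 & B2 & B3 & B4). fold K in B1, B2, B3, B4.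
        assert (Ebp : bump K N r (t - T0) (x - y0) = bp t x) by (rewrite Hbp1 by lra; symmetry; apply Rmax_left; lra).
        apply (Hbranch (fun s' => bump K N r (s' - T0) (x - y0)) (fun y => bump K N r (t - T0) (y - y0)) (fun y => b1 (y - y0)) bt byy).
        * exact Ebp.
        * intros s' Hs'. rewrite Hbp1 by lra. apply Rmax_l.
        * apply (is_derive_shift (fun s' => bump K N r s' (x - y0)) (- T0)). exact B1.
        * exact Ebp.
        * intro y. rewrite Hbp1 by lra. apply Rmax_l.
        * intro y. apply (is_derive_shift (bump K N r (t - T0)) (- y0)). apply B2.
        * apply (is_derive_shift b1 (- y0)). exact B3.
        * rewrite <- Ebp. apply B4, hb.
      + assert (Ebp : 0 = bp t x) by (rewrite Hbp1 by lra; symmetry; apply Rmax_right; lra).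
        apply (Hbranch (fun _ => 0) (fun _ => 0) (fun _ => 0) 0 0).
        * exact Ebp.
        * intros; apply Hbp0.
        * apply (is_derive_const 0).
        * exact Ebp.
        * intros; apply Hbp0.
        * intro; apply (is_derive_const 0).
        * apply (is_derive_const 0).
        * rewrite <- Ebp. lra.
    - intros t x Htt. unfold Psi.
      pose proof (Hemb (u t x) (proj1 Hu t x ltac:(lra))). pose proof (Hemb (phi (x + c * t + s)) (proj2 Hp _)).
      specialize (HG0 t).
      assert (bp t x <= 1) by (rewrite Hbp1 by lra; apply Rmax_lub; [apply Hbump1; lra|lra]).
      assert (del / 2 * bp t x <= del / 2 * 1) by (apply Rmult_le_compat_l; lra). lra.
    - intros t x Htt. pose proof (Hinit t x Htt) as Hi. pose proof (HGe t ltac:(lra)) as Hge. unfold Psi.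
      destruct (Rlt_le_dec t T0) as [h1|h1].
      + unfold bp. destruct (Rlt_dec t T0); [|lra]. lra.
      + assert (t = T0) by lra. subst t. rewrite Hbp1 by lra.
        destruct (Rle_lt_dec (Rabs (x - y0)) r) as [h2|h2].
        * pose proof (evolution_lipschitz h u T0 Hg Hh Hu HT0 x y0) as Q1.
          pose proof (Hlip (x + c * T0 + s) s) as Q2.
          replace (x + c * T0 + s - s) with (x - y0) in Q2 by (unfold y0; ring).
          apply Rabs_le_between in Q1. apply Rabs_le_between in Q2.
          fold y0 in Hgap.
          assert (e * u T0 x - e * u T0 y0 <= 2 * kappa * Rabs (x - y0)) by (destruct Hsg; subst e; lra).
          assert (e * phi s - e * phi (x + c * T0 + s) <= Lam * Rabs (x - y0)) by (destruct Hsg; subst e; lra).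
          assert ((2 * kappa + Lam) * Rabs (x - y0) <= (2 * kappa + Lam) * r) by (apply Rmult_le_compat_l; lra).
          assert (Rmax (bump K N r (T0 - T0) (x - y0)) 0 <= 1) by (apply Rmax_lub; [apply Hbump1; lra|lra]).
          assert (del / 2 * Rmax (bump K N r (T0 - T0) (x - y0)) 0 <= del / 2 * 1) by (apply Rmult_le_compat_l; lra). lra.
        * rewrite Rmax_right; [lra|]. unfold bump. replace (T0 - T0) with 0 by ring. rewrite !Rmult_0_r, exp_0, Rplus_0_r, Rmult_1_l.
          assert (Hv : 1 - (x - y0) ^ 2 / r ^ 2 <= 0).
          { assert (r ^ 2 <= (x - y0) ^ 2) by (rewrite <- (pow2_abs (x - y0)); apply pow_incr; lra).
            assert (0 < r ^ 2) by nra.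
            assert (1 <= (x - y0) ^ 2 / r ^ 2); [|lra].
            apply Rmult_le_reg_r with (r ^ 2); [lra|]. replace ((x - y0) ^ 2 / r ^ 2 * r ^ 2) with ((x - y0) ^ 2) by (field; lra). lra. }
          set (v := 1 - (x - y0) ^ 2 / r ^ 2) in *. replace (v ^ 3) with (v ^ 2 * v) by ring.
          apply Rmult_nonneg_nonpos; [apply pow2_ge_0|exact Hv].
    - lra. }
  eapply Rle_trans; [exact Hcmp|]. unfold Psi. rewrite Hbp1 by lra.
  assert (HGT : G T <= eps * exp (L * (1 + 2 * h))).
  { unfold G. apply Rmult_le_compat_l; [lra|]. apply exp_le, Rmult_le_compat_l; lra. }
  assert (Hbig : exp (- K * (1 + h)) * / 8 <= bump K N r (T - T0) (x1 - y0)).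
  { unfold bump. specialize (Hrho T ltac:(lra)).
    assert (Hy : (x1 - y0) ^ 2 <= ell ^ 2).
    { rewrite <- (pow2_abs (x1 - y0)). apply pow_incr. split; [apply Rabs_pos|].
      replace (x1 - y0) with ((x1 + c * T) + - (c * (T - T0))) by (unfold y0; ring).
      eapply Rle_trans; [apply Rabs_triang|]. rewrite Rabs_Ropp.
      rewrite (Rabs_right (c * (T - T0))) by (apply Rle_ge, Rmult_le_pos; lra).
      assert (c * (T - T0) <= c * (1 + h)) by (apply Rmult_le_compat_l; lra). unfold ell. lra. }
    assert (HNr : N <= r ^ 2 + N * (T - T0)).
    { assert (N * 1 <= N * (T - T0)) by (apply Rmult_le_compat_l; lra). pose proof (pow2_ge_0 r). lra. }
    assert (Hv : / 2 <= 1 - (x1 - y0) ^ 2 / (r ^ 2 + N * (T - T0))).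
    { assert ((x1 - y0) ^ 2 / (r ^ 2 + N * (T - T0)) <= / 2); [|lra].
      apply Rmult_le_reg_r with (r ^ 2 + N * (T - T0)); [lra|].
      replace ((x1 - y0) ^ 2 / (r ^ 2 + N * (T - T0)) * (r ^ 2 + N * (T - T0))) with ((x1 - y0) ^ 2) by (field; lra).
      unfold N in *. lra. }
    apply Rmult_le_compat.
    - left; apply exp_pos.
    - lra.
    - apply exp_le. assert (K * (T - T0) <= K * (1 + h)) by (apply Rmult_le_compat_l; lra). lra.
    - replace (/ 8) with ((/ 2) ^ 3) by field. apply pow_incr. lra. }
  rewrite Rmax_left by (pose proof (exp_pos (- K * (1 + h))); lra).
  assert (del / 2 * (exp (- K * (1 + h)) * / 8) <= del / 2 * bump K N r (T - T0) (x1 - y0)) by (apply Rmult_le_compat_l; lra).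
  unfold d1. lra.
Qed.

(* For e = 1: limsup of (u - phi(. + s)) / eta is at most 0; for e = -1: the same for phi(. + s) - u. *)
Definition eventually_below (u : R -> R -> R) (phi : R -> R) c lam e s := forall eps, 0 < eps ->
  exists T, forall t, T <= t -> forall x, e * u t x <= e * phi (x + c * t + s) + eps * eta lam (x + c * t).

(** The exponentially decaying error disappears in the limit, so only the shift [C q] remains;
    recentring the weight costs a constant factor. *)
Lemma stability_eventually {g kappa k0 k1 L} h c lam phi phi1 : monostable g kappa k0 k1 L -> 0 <= h -> 0 < c ->
  decay_rate k0 c (c * h) lam -> fast_front g kappa c (c * h) lam phi phi1 ->
  exists q0 C, 0 < q0 /\ 0 < C /\ forall u e T0 s q, evolution g h kappa u -> is_sign e -> 0 <= T0 -> 0 < q <= q0 ->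
      (forall t x, T0 - h <= t <= T0 -> e * u t x <= e * phi (x + c * t + s) + q * eta lam (x + c * t + s)) ->
      eventually_below u phi c lam e (s + e * (C * q)).
Proof.
  intros Hg Hh Hc Hlam Hff.
  destruct (front_stability h c lam phi phi1 Hg Hh Hc Hlam Hff) as (q0 & gam & C & Hq0 & Hgam & HC & Hst).
  destruct Hlam as [Hl _].
  exists q0, C. split; [exact Hq0|]. split; [exact HC|].
  intros u e T0 s q Hu Hsg HT0 Hq Hinit eps Heps.
  set (A := exp (lam * Rabs s)). assert (HA : 0 < A) by apply exp_pos.
  destruct (exp_small_left gam (q * A) eps Hgam) as [Z HZ]; [apply Rmult_le_pos; lra|exact Heps|].
  exists (Rmax T0 (T0 - Z)). intros t Ht x. pose proof (Rmax_l T0 (T0 - Z)). pose proof (Rmax_r T0 (T0 - Z)).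
  eapply Rle_trans; [apply (Hst u e T0 s q Hu Hsg HT0 Hq Hinit t x); lra|].
  rewrite (Rplus_assoc (x + c * t) s). apply Rplus_le_compat_l.
  specialize (HZ (- (t - T0)) ltac:(lra)). replace (gam * - (t - T0)) with (- gam * (t - T0)) in HZ by ring.
  pose proof (eta_shift lam (x + c * t) s ltac:(lra)) as Hsh. fold A in Hsh.
  pose proof (exp_pos (- gam * (t - T0))). pose proof (eta_pos lam (x + c * t)).
  apply Rle_trans with (q * exp (- gam * (t - T0)) * (A * eta lam (x + c * t))).
  - apply Rmult_le_compat_l; [apply Rmult_le_pos; lra|exact Hsh].
  - replace (q * exp (- gam * (t - T0)) * (A * eta lam (x + c * t))) with (q * A * exp (- gam * (t - T0)) * eta lam (x + c * t)) by ring.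
    apply Rmult_le_compat_r; lra.
Qed.

(** The translate is moved by [th] and stability is restarted with [q = th / (2 C)], which gives
    back only half of [th]. On the core the spread gap pays for the move; in the tails
    [phi' <= nu eta] does. *)
Lemma recurrent_gap_improves {g kappa k0 k1 L} h c lam phi phi1 u e s del : monostable g kappa k0 k1 L -> 0 <= h -> 0 < c ->
  decay_rate k0 c (c * h) lam -> fast_front g kappa c (c * h) lam phi phi1 ->
  evolution g h kappa u -> is_sign e -> eventually_below u phi c lam e s -> 0 < del ->
  (forall T, exists t, T <= t /\ e * u t (- c * t) <= e * phi s - del) ->
  exists th, 0 < th /\ eventually_below u phi c lam e (s - e * th).
Proof.
  intros Hg Hh Hc Hlam Hff Hu Hsg Hbel Hdel Hgap.
  destruct (stability_eventually h c lam phi phi1 Hg Hh Hc Hlam Hff) as (q0 & C & Hq0 & HC & Hst).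
  destruct Hlam as [Hl _].
  destruct (fast_front_lipschitz c (c * h) lam phi phi1 Hg Hl Hff) as (Lam & HLam & _ & Hlip).
  pose proof (ff_front Hff) as Hf. destruct (fr_sol Hf) as [D1 _].
  (* With this value the tail cost of the move is exactly [q / 2] times the weight. It depends only
     on [C] and [lam], so the core radius and the gap [d1] can be fixed before [th]. *)
  set (nu := / (4 * C * exp lam)).
  assert (Hnu : 0 < nu) by (apply Rinv_0_lt_compat; pose proof (exp_pos lam); apply Rmult_lt_0_compat; lra).
  destruct (fast_front_derive_tail g kappa c (c * h) lam phi phi1 Hl Hff nu Hnu) as (R1 & HR1 & Htail).
  pose proof (Rabs_pos s) as Has.
  set (R0 := R1 + Rabs s + 1).
  destruct (gap_spreads h c lam phi phi1 Hg Hh Hc Hl Hff R0 del ltac:(unfold R0; lra) Hdel) as (d1 & B & Hd1 & HB & Hspread).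
  set (th := Rmin 1 (Rmin (d1 / (2 * Lam)) (2 * C * q0))).
  assert (Hth : 0 < th).
  { apply Rmin_glb_lt; [lra|]. apply Rmin_glb_lt; [apply Rdiv_lt_0_compat; lra|apply Rmult_lt_0_compat; lra]. }
  assert (Hth1 : th <= 1) by apply Rmin_l.
  assert (Hth' : th <= Rmin (d1 / (2 * Lam)) (2 * C * q0)) by apply Rmin_r.
  assert (Hth2 : Lam * th <= d1 / 2).
  { apply Rle_trans with (Lam * (d1 / (2 * Lam))); [|right; field; lra]. apply Rmult_le_compat_l; [lra|].
    pose proof (Rmin_l (d1 / (2 * Lam)) (2 * C * q0)). lra. }
  set (q := th / (2 * C)).
  assert (Hq : 0 < q) by (apply Rdiv_lt_0_compat; lra).
  assert (HCq : C * q = th / 2) by (unfold q; field; lra).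
  assert (Hqq0 : q <= q0).
  { apply Rmult_le_reg_l with (2 * C); [lra|]. pose proof (Rmin_r (d1 / (2 * Lam)) (2 * C * q0)). lra. }
  set (c1 := exp (lam * (Rabs s + 1))). assert (Hc1 : 0 < c1) by apply exp_pos.
  set (eps := Rmin (d1 / (2 * B)) (q / (2 * c1))).
  assert (Heps : 0 < eps) by (apply Rmin_glb_lt; apply Rdiv_lt_0_compat; lra).
  assert (Heps1 : eps * B <= d1 / 2).
  { apply Rle_trans with (d1 / (2 * B) * B); [apply Rmult_le_compat_r; [lra|apply Rmin_l]|right; field; lra]. }
  assert (Heps2 : eps * c1 <= q / 2).
  { apply Rle_trans with (q / (2 * c1) * c1); [apply Rmult_le_compat_r; [lra|apply Rmin_r]|right; field; lra]. }
  destruct (Hbel eps Heps) as [T HT].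
  (* The delay window before [T0] must lie after [T], and [T0 > 1] is needed for the interior
     Lipschitz bound. *)
  destruct (Hgap (Rmax (T + h) 2)) as (T0 & HT0 & Hgap0).
  pose proof (Rmax_l (T + h) 2). pose proof (Rmax_r (T + h) 2).
  exists (th / 2). split; [lra|].
  replace (s - e * (th / 2)) with (s - e * th + e * (C * q)) by (rewrite HCq; field).
  apply (Hst u e (T0 + 1 + h) (s - e * th) q Hu Hsg); [lra|lra|].
  intros t x Ht. set (z := x + c * t + s).
  replace (x + c * t + (s - e * th)) with (z - e * th) by (unfold z; ring).
  pose proof (eta_pos lam (z - e * th)) as Hep.
  assert (Heth : Rabs (e * th) = th) by (destruct Hsg; subst e; [rewrite Rmult_1_l; apply Rabs_right; lra|rewrite Rabs_left; lra]).
  destruct (Rle_lt_dec (Rabs (x + c * t)) R0) as [hx|hx].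
  - assert (Hin0 : forall t x, T0 - h <= t <= T0 -> e * u t x <= e * phi (x + c * t + s) + eps).
    { intros t' x' Ht'. eapply Rle_trans; [apply (HT t'); lra|]. apply Rplus_le_compat_l.
      pose proof (eta_le_1 lam (x' + c * t')). nra. }
    assert (Hin := Hspread u e T0 s eps Hu Hsg ltac:(lra) Heps Hin0).
    specialize (Hin Hgap0 t x ltac:(lra) hx). fold z in Hin.
    specialize (Hlip z (z - e * th)). replace (z - (z - e * th)) with (e * th) in Hlip by ring. rewrite Heth in Hlip.
    apply Rabs_le_between in Hlip.
    assert (e * phi z - e * phi (z - e * th) <= Lam * th) by (destruct Hsg; subst e; lra).
    assert (0 <= q * eta lam (z - e * th)) by (apply Rmult_le_pos; lra). lra.
  - specialize (HT t ltac:(lra) x). fold z in HT.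
    assert (Hx : eps * eta lam (x + c * t) <= q / 2 * eta lam (z - e * th)).
    { pose proof (eta_shift lam (z - e * th) (e * th - s) ltac:(lra)) as Q.
      replace (z - e * th + (e * th - s)) with (x + c * t) in Q by (unfold z; ring).
      assert (Rabs (e * th - s) <= Rabs s + 1).
      { unfold Rminus. eapply Rle_trans; [apply Rabs_triang|]. rewrite Rabs_Ropp. lra. }
      assert (exp (lam * Rabs (e * th - s)) <= c1) by (apply exp_le, Rmult_le_compat_l; lra).
      apply Rle_trans with (eps * (c1 * eta lam (z - e * th))).
      - apply Rmult_le_compat_l; [lra|]. eapply Rle_trans; [exact Q|]. apply Rmult_le_compat_r; lra.
      - rewrite <- Rmult_assoc. apply Rmult_le_compat_r; lra. }
    assert (Hmv : e * phi z - e * phi (z - e * th) <= q / 2 * eta lam (z - e * th)).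
    { assert (Hd : exists y, Rabs (y - (z - e * th)) <= 1 /\ Rabs (y - z) <= 1 /\ e * phi z - e * phi (z - e * th) = phi1 y * th).
      { destruct Hsg; subst e.
        - destruct (mean_value phi phi1 (z - 1 * th) z ltac:(lra) (fun y _ => D1 y)) as (y & E & Hy).
          exists y. split; [apply Rabs_le; lra|]. split; [apply Rabs_le; lra|]. lra.
        - destruct (mean_value phi phi1 z (z - -1 * th) ltac:(lra) (fun y _ => D1 y)) as (y & E & Hy).
          exists y. split; [apply Rabs_le; lra|]. split; [apply Rabs_le; lra|]. lra. }
      destruct Hd as (y & Hy1 & Hy2 & E). rewrite E.
      assert (Hyb : R1 <= Rabs y).
      { pose proof (Rabs_triang (x + c * t - y) y) as Q1. replace (x + c * t - y + y) with (x + c * t) in Q1 by ring.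
        pose proof (Rabs_triang (z - y) (- s)) as Q2. replace (z - y + - s) with (x + c * t - y) in Q2 by (unfold z; ring).
        rewrite Rabs_Ropp, (Rabs_minus_sym z y) in Q2. unfold R0 in hx. lra. }
      specialize (Htail y Hyb).
      pose proof (eta_shift lam (z - e * th) (y - (z - e * th)) ltac:(lra)) as Q.
      replace (z - e * th + (y - (z - e * th))) with y in Q by ring.
      assert (exp (lam * Rabs (y - (z - e * th))) <= exp lam).
      { apply exp_le. apply Rle_trans with (lam * 1); [apply Rmult_le_compat_l; lra|lra]. }
      assert (Hy3 : phi1 y <= nu * (exp lam * eta lam (z - e * th))).
      { eapply Rle_trans; [exact Htail|]. apply Rmult_le_compat_l; [lra|]. eapply Rle_trans; [exact Q|]. apply Rmult_le_compat_r; lra. }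
      apply Rle_trans with (nu * (exp lam * eta lam (z - e * th)) * th); [apply Rmult_le_compat_r; lra|].
      right. unfold nu, q. field. pose proof (exp_pos lam). split; lra. }
    lra.
Qed.

(** * Fitting the initial data between translates of the front *)

Lemma initial_upper_bound g kappa c tau lam h phi phi1 (w : R -> R -> R) A mu q : 0 < lam -> 0 < c ->
  fast_front g kappa c tau lam phi phi1 -> 0 <= h -> 0 < A -> lam < mu -> 0 < q ->
  (forall t x, - h <= t <= 0 -> w t x <= kappa) -> (forall t x, - h <= t <= 0 -> w t x <= A * exp (mu * x)) ->
  exists s, forall t x, 0 - h <= t <= 0 -> 1 * w t x <= 1 * phi (x + c * t + s) + q * eta lam (x + c * t + s).
Proof.
  intros Hl Hc Hff Hh HA Hmu Hq Hk Hw. pose proof (ff_front Hff) as Hf.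
  destruct (fr_right Hf q Hq) as [Zq HZq].
  assert (Hch : 0 <= c * h) by (apply Rmult_le_pos; lra).
  (* During the initial window the moving coordinate lags by at most [c h]; [E] is the corresponding
     loss in the weight. Since [mu > lam], the data are below [q E] times the weight far to the
     left. *)
  set (E := exp (- (lam * (c * h)))). assert (HE : 0 < E) by apply exp_pos.
  destruct (exp_small_left (mu - lam) A (q * E)) as [Z HZ]; [lra|lra|apply Rmult_lt_0_compat; lra|].
  set (M := Rmin Z 0). assert (HM1 : M <= Z) by apply Rmin_l. assert (HM0 : M <= 0) by apply Rmin_r.
  set (s := - M + c * h + Rmax Zq 0).
  assert (Hs1 : Zq <= Rmax Zq 0) by apply Rmax_l. assert (Hs2 : 0 <= Rmax Zq 0) by apply Rmax_r.
  exists s. intros t x Ht. rewrite !Rmult_1_l.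
  assert (Hct : - (c * h) <= c * t) by (rewrite <- Ropp_mult_distr_r_reverse; apply Rmult_le_compat_l; lra).
  destruct (Rle_lt_dec x M) as [hx|hx].
  - specialize (HZ x ltac:(lra)). pose proof (fr_pos Hf (x + c * t + s)).
    apply Rle_trans with (q * eta lam (x - c * h)).
    + rewrite eta_left by lra. eapply Rle_trans; [apply Hw; lra|].
      replace (mu * x) with ((mu - lam) * x + lam * x) by ring. rewrite exp_plus.
      replace (lam * (x - c * h)) with (- (lam * (c * h)) + lam * x) by ring. rewrite exp_plus. fold E.
      rewrite <- !Rmult_assoc. apply Rmult_le_compat_r; [left; apply exp_pos|exact HZ].
    + assert (q * eta lam (x - c * h) <= q * eta lam (x + c * t + s)); [|lra].
      apply Rmult_le_compat_l; [lra|]. apply eta_mono; unfold s; lra.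
  - specialize (HZq (x + c * t + s) ltac:(unfold s; lra)). rewrite eta_right by (unfold s; lra).
    specialize (Hk t x ltac:(lra)). lra.
Qed.

(** The data are only above [kappa - sigma] on the right, which may be too far from [kappa] for
    stability. A level [b t] rising slowly by [g y > y], minus an exponential boundary layer [E], is
    a subsolution that reaches [kappa - q / 2] in finite time. *)
Lemma right_state_invades {g kappa k0 k1 L} h u B sigma q : monostable g kappa k0 k1 L -> 0 <= h -> evolution g h kappa u ->
  0 < sigma < kappa -> 0 < q <= kappa ->
  (forall t x, - h <= t <= 0 -> B <= x -> kappa - sigma < u t x) ->
  exists T B', 0 <= T /\ forall t x, T - h <= t <= T -> B' <= x -> kappa - q <= u t x.
Proof.
  intros Hg Hh Hu Hsig Hq HB.
  pose proof (ms_kappa Hg) as Hk. pose proof (ms_L Hg) as HL.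
  set (m0 := Rmin (kappa - sigma) (kappa / 2)).
  assert (Hm0 : 0 < m0) by (apply Rmin_glb_lt; lra).
  assert (Hm1 : m0 <= kappa - sigma) by apply Rmin_l. assert (Hm2 : m0 <= kappa / 2) by apply Rmin_r.
  set (top := kappa - q / 2).
  assert (Hgrow : exists d, 0 < d /\ forall y, m0 / 2 <= y <= top -> d <= g y - y).
  { destruct (continuity_ab_min (fun y => g y - y) (m0 / 2) top) as (y & Hy & Hy'); [unfold top; lra| |].
    - intros y _. apply continuity_pt_minus; [|apply continuity_pt_id].
      apply continuity_pt_filterlim, (monostable_continuous Hg).
    - exists (g y - y). split; [|exact Hy]. pose proof (ms_above Hg y ltac:(unfold top in *; lra)). lra. }
  destruct Hgrow as (d & Hd & Hgrow).
  (* Slow enough for the growth [g y - y >= d] despite the delay, for [b] to stay above [m0 / 2] on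
     the initial window, and for [b] to vary by at most [q / 4] over the final window. *)
  set (sl := Rmin (d / (1 + h)) (Rmin (m0 / (2 * (1 + h))) (q / (4 * (1 + h))))).
  assert (Hsl : 0 < sl) by (apply Rmin_glb_lt; [|apply Rmin_glb_lt]; apply Rdiv_lt_0_compat; lra).
  assert (Hs' : sl <= Rmin (m0 / (2 * (1 + h))) (q / (4 * (1 + h)))) by apply Rmin_r.
  assert (Hsl1 : sl * (1 + h) <= d).
  { apply Rle_trans with (d / (1 + h) * (1 + h)); [apply Rmult_le_compat_r; [lra|apply Rmin_l]|right; field; lra]. }
  assert (Hsl2 : sl * (1 + h) <= m0 / 2).
  { apply Rle_trans with (m0 / (2 * (1 + h)) * (1 + h)); [apply Rmult_le_compat_r; [lra|]|right; field; lra].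
    pose proof (Rmin_l (m0 / (2 * (1 + h))) (q / (4 * (1 + h)))). lra. }
  assert (Hsl3 : sl * (1 + h) <= q / 4).
  { apply Rle_trans with (q / (4 * (1 + h)) * (1 + h)); [apply Rmult_le_compat_r; [lra|]|right; field; lra].
    pose proof (Rmin_r (m0 / (2 * (1 + h))) (q / (4 * (1 + h)))). lra. }
  assert (Hslh : 0 <= sl * h) by (apply Rmult_le_pos; lra).
  set (b := fun t => m0 + sl * t).
  set (T := (top - m0) / sl). assert (HT : 0 <= T) by (apply Rdiv_le_0_compat; unfold top; lra).
  assert (HbT : b T = top) by (unfold b, T; field; lra).
  (* Left of [B] it exceeds [kappa] and makes the barrier trivial; it satisfies
     [E_t = E_xx - E + L E], which absorbs the Lipschitz error of [g]. *)
  set (E := fun t x => kappa * (exp (L * (t + h)) * exp (- (x - B)))).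
  set (Psi := fun t x => E t x - b t).
  assert (HE0 : forall t x, 0 < E t x).
  { intros t x. unfold E. apply Rmult_lt_0_compat; [lra|]. apply Rmult_lt_0_compat; apply exp_pos. }
  assert (Hbm : forall t t', t <= t' -> b t <= b t') by (intros t t' Htt; unfold b; assert (sl * t <= sl * t') by (apply Rmult_le_compat_l; lra); lra).
  assert (Hcmp : forall t x, 0 - h <= t <= T -> - 1 * u t x <= Psi t x).
  { assert (Hinit : forall t x, 0 - h <= t <= 0 -> - 1 * u t x <= Psi t x).
    { intros t x Ht. unfold Psi. pose proof (Hbm t 0 ltac:(lra)) as Q. unfold b at 2 in Q. rewrite Rmult_0_r in Q.
      pose proof (HE0 t x). destruct (Rle_lt_dec B x) as [hx|hx].
      - specialize (HB t x ltac:(lra) hx). lra.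
      - assert (1 <= exp (L * (t + h)) * exp (- (x - B))).
        { rewrite <- exp_plus, <- exp_0. apply exp_le. assert (0 <= L * (t + h)) by (apply Rmult_le_pos; lra). lra. }
        assert (kappa <= E t x) by (unfold E; nra). pose proof (proj1 Hu t x ltac:(lra)). lra. }
    intros t x Ht. destruct (Rle_lt_dec t 0) as [h0|h0]; [apply Hinit; lra|].
    apply (comparison (signed (-1) g) L h 0 T (fun t x => - 1 * u t x) Psi kappa).
    - lra.
    - apply signed_mono; [right; reflexivity|apply (ms_mono Hg)].
    - apply signed_lip; [right; reflexivity|apply (ms_lip Hg)].
    - exact Hh.
    - apply (evolution_jointly_continuous g h kappa); try assumption. lra.
    - intros tn xn t0 x0 Htt Htt0 Lt Lx. unfold Psi, E, b.
      apply is_lim_seq_minus'.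
      + apply is_lim_seq_mult'; [apply is_lim_seq_const|]. apply is_lim_seq_mult'.
        * apply (lim_seq_continuous_fun (fun y => exp (L * (y + h)))); [|exact Lt].
          eapply is_derive_continuous. auto_derive; [trivial|reflexivity].
        * apply (lim_seq_continuous_fun (fun y => exp (- (y - B)))); [|exact Lx].
          eapply is_derive_continuous. auto_derive; [trivial|reflexivity].
      + apply is_lim_seq_plus'; [apply is_lim_seq_const|]. apply is_lim_seq_mult'; [apply is_lim_seq_const|exact Lt].
    - apply (evolution_subsolution g h kappa); try assumption; [right; reflexivity|lra].
    - intros t' x' Ht'.
      exists (fun t => Psi t x'), (Psi t'), (fun x => - E t' x), (L * E t' x' - sl), (E t' x').
      split; [reflexivity|]. split; [intros; lra|]. split; [|split; [reflexivity|split; [intro; lra|split; [|split]]]].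
      + unfold Psi, E, b. auto_derive; [trivial|]. unfold Rminus. ring.
      + intro y. unfold Psi, E, b. auto_derive; [trivial|]. unfold Rminus. ring.
      + unfold E. auto_derive; [trivial|]. unfold Rminus. ring.
      + unfold signed, Psi.
        pose proof (HE0 t' x') as He. pose proof (HE0 (t' - h) x') as He'.
        assert (Hee : E (t' - h) x' <= E t' x').
        { unfold E. apply Rmult_le_compat_l; [lra|]. apply Rmult_le_compat_r; [left; apply exp_pos|].
          apply exp_le, Rmult_le_compat_l; lra. }
        assert (Hb1 : m0 / 2 <= b (t' - h)).
        { pose proof (Hbm (- h) (t' - h) ltac:(lra)) as Q. unfold b at 1 in Q. lra. }
        assert (Hb2 : b (t' - h) <= top) by (rewrite <- HbT; apply Hbm; lra).
        specialize (Hgrow (b (t' - h)) ltac:(lra)).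
        replace (-1 * (E (t' - h) x' - b (t' - h))) with (b (t' - h) - E (t' - h) x') by ring.
        pose proof (ms_lip Hg (b (t' - h) - E (t' - h) x') (b (t' - h)) ltac:(lra)) as Q.
        replace (b (t' - h) - (b (t' - h) - E (t' - h) x')) with (E (t' - h) x') in Q by ring.
        assert (L * E (t' - h) x' <= L * E t' x') by (apply Rmult_le_compat_l; lra).
        assert (b t' - b (t' - h) = sl * h) by (unfold b; ring). lra.
    - intros t' x' Ht'. unfold Psi. pose proof (HE0 t' x'). pose proof (proj1 Hu t' x' ltac:(lra)).
      pose proof (Hbm t' T ltac:(lra)). rewrite HbT in *. unfold top in *. lra.
    - exact Hinit.
    - lra. }
  destruct (exp_small_left 1 (kappa * exp (L * (T + h))) (q / 4)) as [Z HZ]; [lra|apply Rmult_le_pos; [lra|left; apply exp_pos]|lra|].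
  exists T, (B - Z). split; [exact HT|].
  intros t x Ht Hx. specialize (Hcmp t x ltac:(lra)). unfold Psi in Hcmp.
  specialize (HZ (- (x - B)) ltac:(lra)). rewrite Rmult_1_l in HZ.
  assert (E t x <= q / 4).
  { eapply Rle_trans; [|exact HZ]. unfold E. rewrite Rmult_assoc. apply Rmult_le_compat_l; [lra|].
    apply Rmult_le_compat_r; [left; apply exp_pos|]. apply exp_le, Rmult_le_compat_l; lra. }
  pose proof (Hbm (T - h) t ltac:(lra)) as Q.
  assert (b (T - h) = top - sl * h) by (rewrite <- HbT; unfold b; ring).
  unfold top in *. lra.
Qed.

(** Once the right state is within [q] of [kappa], the front is shifted so far right that, wherever
    this is not known, [phi] itself is below [q eta] by its fast decay. *)
Lemma initial_lower_bound {g kappa k0 k1 L} h c tau lam phi phi1 u B sigma q0 : monostable g kappa k0 k1 L -> 0 <= h -> 0 < c -> 0 < lam ->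
  evolution g h kappa u -> fast_front g kappa c tau lam phi phi1 ->
  0 < sigma < kappa -> 0 < q0 -> (forall t x, - h <= t <= 0 -> B <= x -> kappa - sigma < u t x) ->
  exists T s q, 0 <= T /\ 0 < q <= q0 /\
    forall t x, T - h <= t <= T -> -1 * u t x <= -1 * phi (x + c * t + s) + q * eta lam (x + c * t + s).
Proof.
  intros Hg Hh Hc Hl Hu Hff Hsig Hq0 HB. pose proof (ff_front Hff) as Hf.
  pose proof (fast_front_le Hff) as Hmon.
  pose proof (fr_lt Hf 0) as H0. pose proof (fr_pos Hf 0) as H0p.
  (* Left of the kink the weight is too small to help, so [phi z <= phi 0 <= kappa - q] must suffice
     where [u >= kappa - q]. *)
  set (q := Rmin q0 (kappa - phi 0)).
  assert (Hq : 0 < q) by (apply Rmin_glb_lt; lra).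
  assert (Hq1 : q <= q0) by apply Rmin_l. assert (Hq2 : q <= kappa - phi 0) by apply Rmin_r.
  destruct (right_state_invades h u B sigma q Hg Hh Hu Hsig ltac:(lra) HB) as (T & B' & HT & Hinv).
  destruct (ff_small Hff q Hq) as [Z HZ].
  set (Y := Rmin Z 0). assert (HY : Y <= Z) by apply Rmin_l. assert (HY0 : Y <= 0) by apply Rmin_r.
  exists T, (Y - B' - c * T), q. split; [exact HT|]. split; [lra|].
  intros t x Ht. set (z := x + c * t + (Y - B' - c * T)).
  pose proof (proj1 Hu t x ltac:(lra)) as Hub.
  destruct (Rle_lt_dec B' x) as [hx|hx].
  - specialize (Hinv t x Ht hx). destruct (Rle_lt_dec z 0) as [hz|hz].
    + pose proof (Hmon z 0 hz). pose proof (eta_pos lam z). assert (0 <= q * eta lam z) by (apply Rmult_le_pos; lra). lra.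
    + rewrite eta_right by lra. pose proof (fr_lt Hf z). lra.
  - assert (c * t <= c * T) by (apply Rmult_le_compat_l; lra).
    assert (Hz : z <= Y) by (unfold z; lra).
    specialize (HZ z ltac:(lra)). rewrite eta_left by lra. lra.
Qed.

(** By [phi' <= C eta], changing the shift by [d] costs at most a multiple of [d eta]. Hence the
    best translates are attained. *)
Lemma eventually_below_closed {g kappa k0 k1 L} c tau lam phi phi1 u e s : monostable g kappa k0 k1 L -> 0 < lam ->
  fast_front g kappa c tau lam phi phi1 -> is_sign e ->
  (forall d, 0 < d -> exists s', Rabs (s' - s) <= d /\ eventually_below u phi c lam e s') ->
  eventually_below u phi c lam e s.
Proof.
  intros Hg Hl Hff Hsg H eps Heps.
  destruct (fast_front_lipschitz c tau lam phi phi1 Hg Hl Hff) as (C & HC & Hd & _).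
  pose proof (ff_front Hff) as Hf. destruct (fr_sol Hf) as [D1 _].
  pose proof (fast_front_le Hff) as Hmon.
  set (A := exp (lam * (Rabs s + 1))). assert (HA : 0 < A) by apply exp_pos.
  set (d := Rmin 1 (eps / (2 * (C * A)))).
  assert (HCA : 0 < C * A) by (apply Rmult_lt_0_compat; lra).
  assert (Hd0 : 0 < d) by (apply Rmin_glb_lt; [lra|apply Rdiv_lt_0_compat; lra]).
  assert (Hd1 : d <= 1) by apply Rmin_l.
  assert (Hd2 : C * A * d <= eps / 2).
  { apply Rle_trans with (C * A * (eps / (2 * (C * A)))); [apply Rmult_le_compat_l; [lra|apply Rmin_r]|right; field; lra]. }
  destruct (H d Hd0) as (s' & Hs' & Hb). destruct (Hb (eps / 2) ltac:(lra)) as [T HT].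
  exists T. intros t Ht x. specialize (HT t Ht x). set (y := x + c * t) in *.
  pose proof (eta_pos lam y) as Hey.
  enough (Rabs (phi (y + s') - phi (y + s)) <= eps / 2 * eta lam y).
  { apply Rabs_le_between in H0. destruct Hsg; subst e; lra. }
  assert (Hup : forall w, Rabs (w - y) <= Rabs s + 1 -> phi1 w <= C * A * eta lam y).
  { intros w Hw. eapply Rle_trans; [apply Hd|]. rewrite Rmult_assoc. apply Rmult_le_compat_l; [lra|].
    pose proof (eta_shift lam y (w - y) ltac:(lra)) as Q. replace (y + (w - y)) with w in Q by ring.
    eapply Rle_trans; [exact Q|]. apply Rmult_le_compat_r; [lra|]. apply exp_le, Rmult_le_compat_l; lra. }
  assert (Hgen : forall a b, Rabs (a - s) <= 1 -> Rabs (b - s) <= 1 -> a <= b -> b - a <= d -> phi (y + b) - phi (y + a) <= eps / 2 * eta lam y).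
  { intros a b Ha Hb' Hab Hd'. apply Rabs_le_between in Ha. apply Rabs_le_between in Hb'.
    destruct Hab as [Hab| ->].
    - destruct (mean_value phi phi1 (y + a) (y + b) ltac:(lra) (fun w _ => D1 w)) as (w & E & Hw). rewrite E.
      pose proof (Rle_abs s). pose proof (Rle_abs (- s)). rewrite Rabs_Ropp in *.
      specialize (Hup w ltac:(apply Rabs_le; lra)).
      apply Rle_trans with (C * A * eta lam y * d).
      + apply Rmult_le_compat; try lra. left. apply (ff_deriv_pos Hff).
      + replace (C * A * eta lam y * d) with (C * A * d * eta lam y) by ring. apply Rmult_le_compat_r; lra.
    - replace (phi (y + b) - phi (y + b)) with 0 by ring. apply Rmult_le_pos; lra. }
  assert (Hss : Rabs (s - s) <= 1) by (replace (s - s) with 0 by ring; rewrite Rabs_R0; lra).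
  assert (Hs1 : Rabs (s' - s) <= 1) by lra.
  apply Rabs_le_between in Hs'.
  destruct (Rle_lt_dec s s') as [h|h].
  - specialize (Hgen s s' Hss Hs1 h ltac:(lra)). pose proof (Hmon (y + s) (y + s') ltac:(lra)). rewrite Rabs_right; lra.
  - specialize (Hgen s' s Hs1 Hss ltac:(lra) ltac:(lra)). pose proof (Hmon (y + s') (y + s) ltac:(lra)). rewrite Rabs_left1; lra.
Qed.

Lemma fast_front_attracts {g kappa k0 k1 L} h c lam phi phi1 u s_up s_low : monostable g kappa k0 k1 L -> 0 <= h -> 0 < c ->
  decay_rate k0 c (c * h) lam -> fast_front g kappa c (c * h) lam phi phi1 -> evolution g h kappa u ->
  eventually_below u phi c lam 1 s_up -> eventually_below u phi c lam (-1) s_low ->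
  exists s0, eventually_below u phi c lam 1 s0 /\ eventually_below u phi c lam (-1) s0.
Proof.
  intros Hg Hh Hc Hlam Hff Hu Hup Hlow.
  pose proof (proj1 Hlam) as Hl.
  pose proof (fast_front_increasing Hff) as Hinc.
  (* Both bounds are read at [x = - c t], where the weight is 1 and the front values are [phi s] and
     [phi s']. *)
  assert (Hord : forall s s', eventually_below u phi c lam 1 s -> eventually_below u phi c lam (-1) s' -> s' <= s).
  { intros s s' H1 H2. destruct (Rle_lt_dec s' s) as [h0|h0]; [exact h0|exfalso]. specialize (Hinc s s' h0).
    set (eps := (phi s' - phi s) / 3).
    destruct (H1 eps ltac:(unfold eps; lra)) as [T1 HT1]. destruct (H2 eps ltac:(unfold eps; lra)) as [T2 HT2].
    set (t := Rmax T1 T2). specialize (HT1 t (Rmax_l _ _) (- (c * t))). specialize (HT2 t (Rmax_r _ _) (- (c * t))).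
    replace (- (c * t) + c * t) with 0 in * by ring. rewrite Rplus_0_l in *. rewrite eta_right in * by lra. unfold eps in *. lra. }
  (* The infimum of upper shifts is obtained as minus a supremum. *)
  destruct (completeness (fun s => eventually_below u phi c lam 1 (- s))) as [sa [Ha1 Ha2]].
  { exists (- s_low). intros s Hs. specialize (Hord (- s) s_low Hs Hlow). lra. }
  { exists (- s_up). rewrite Ropp_involutive. exact Hup. }
  destruct (completeness (fun s => eventually_below u phi c lam (-1) s)) as [sb [Hb1 Hb2]].
  { exists s_up. intros s Hs. apply (Hord s_up s Hup Hs). }
  { exists s_low. exact Hlow. }
  assert (HA : eventually_below u phi c lam 1 (- sa)).
  { apply (eventually_below_closed c (c * h) lam phi phi1 u 1 (- sa) Hg Hl Hff); [left; reflexivity|].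
    intros d Hd. apply NNPP. intro Hn. assert (sa <= sa - d); [|lra]. apply Ha2. intros s Hs.
    destruct (Rle_lt_dec s (sa - d)) as [h0|h0]; [exact h0|exfalso]. apply Hn. exists (- s). split; [|exact Hs].
    specialize (Ha1 s Hs). apply Rabs_le. lra. }
  assert (HB : eventually_below u phi c lam (-1) sb).
  { apply (eventually_below_closed c (c * h) lam phi phi1 u (-1) sb Hg Hl Hff); [right; reflexivity|].
    intros d Hd. apply NNPP. intro Hn. assert (sb <= sb - d); [|lra]. apply Hb2. intros s Hs.
    destruct (Rle_lt_dec s (sb - d)) as [h0|h0]; [exact h0|exfalso]. apply Hn. exists s. split; [|exact Hs].
    specialize (Hb1 s Hs). apply Rabs_le. lra. }
  pose proof (Hord _ _ HA HB) as Hle.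
  destruct Hle as [Hlt|Heq].
  (* With [del] half the difference of the two front values at 0, at each time [u] is either at most
     [phi (- sa) - del] or above [phi sb + del] there; one of the two gaps recurs. *)
  - exfalso. specialize (Hinc sb (- sa) Hlt). set (del := (phi (- sa) - phi sb) / 2). assert (Hdel : 0 < del) by (unfold del; lra).
    destruct (classic (forall T, exists t, T <= t /\ 1 * u t (- c * t) <= 1 * phi (- sa) - del)) as [hg|hg].
    + destruct (recurrent_gap_improves h c lam phi phi1 u 1 (- sa) del Hg Hh Hc Hlam Hff Hu (or_introl eq_refl) HA Hdel hg) as (th & Hth & Hb).
      assert (sa + th <= sa); [|lra]. apply Ha1. replace (- (sa + th)) with (- sa - 1 * th) by ring. exact Hb.
    + destruct (recurrent_gap_improves h c lam phi phi1 u (-1) sb del Hg Hh Hc Hlam Hff Hu (or_intror eq_refl) HB Hdel) as (th & Hth & Hb).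
      * apply not_all_ex_not in hg. destruct hg as [T1 HT1]. intro T. exists (Rmax T T1). split; [apply Rmax_l|].
        destruct (Rle_lt_dec (1 * u (Rmax T T1) (- c * Rmax T T1)) (1 * phi (- sa) - del)) as [h0|h0].
        -- exfalso. apply HT1. exists (Rmax T T1). split; [apply Rmax_r|exact h0].
        -- unfold del in *. lra.
      * assert (sb + th <= sb); [|lra]. apply Hb1. replace (sb + th) with (sb - -1 * th) by ring. exact Hb.
  - exists sb. split; [rewrite Heq; exact HA|exact HB].
Qed.

Theorem theorem2
  (g : R -> R) (kappa h : R)
  (HH : hypH g kappa)
  (Hmono : forall x y, x <= y -> g x <= g y)
  (Hh : 0 <= h)
  (c_sharp c_star : R) (Hcs : is_c_sharp g h c_sharp)
  (Hmin : is_min_speed g h kappa c_star)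
  (Hpushed : c_sharp < c_star)
  (phi : R -> R) (Hphi : is_wavefront g h kappa c_star phi)
  (lam1 lam2 : R) (Hlam : are_lambdas g h c_star lam1 lam2)
  (w0 : R -> R -> R) (A B sigma mu : R)
  (HA : 0 < A) (HB : 0 < B) (Hsigma : 0 < sigma < kappa) (Hmu : lam1 < mu)
  (Hw0reg : initial_regular h w0)
  (IC1 : forall s x, -h <= s <= 0 -> 0 <= w0 s x <= kappa)
  (IC2 : forall s x, -h <= s <= 0 -> w0 s x <= A * exp (mu * x))
  (IC3 : forall s x, -h <= s <= 0 -> B <= x -> kappa - sigma < w0 s x)
  (lam : R) (Hlam1 : lam1 < lam) (Hlam2 : lam < lam2) (Hlammu : lam < mu)
  (u : R -> R -> R) (Hu : is_classical_solution g h kappa w0 u) :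
  exists s0 : R, forall eps, 0 < eps -> exists T, forall t, T <= t -> forall x,
    Rabs (u t x - phi (x + c_star * t + s0)) / eta lam (x + c_star * t) <= eps.
Proof.
  destruct (hypH_monostable g kappa HH Hmono) as [L Hg].
  pose proof (are_lambdas_speed_pos g kappa _ L h c_star lam1 lam2 Hg Hh Hlam) as Hc.
  assert (Ht : 0 <= c_star * h) by (apply Rmult_le_pos; lra).
  pose proof (decay_rate_between g kappa _ L h c_star lam1 lam2 lam Hg Hh Hlam (conj Hlam1 Hlam2)) as Hrate.
  (* Decay is obtained at the midpoint of [lam] and [lam2], so that [phi] is negligible against
     [exp (lam z)] rather than merely comparable with it. *)
  pose proof (decay_rate_between g kappa _ L h c_star lam1 lam2 ((lam + lam2) / 2) Hg Hh Hlam ltac:(lra)) as Hrate'.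
  destruct (minimal_front_decay h c_star phi _ Hg Hh Hc Hmin Hphi Hrate') as [M HM].
  pose proof (wavefront_front h c_star phi Hg Hphi) as Hf.
  pose proof (fast_front_intro c_star (c_star * h) phi _ lam ((lam + lam2) / 2) M Hg Ht Hf Hrate ltac:(lra) HM) as Hff.
  pose proof (classical_solution_evolution g h kappa w0 u Hu) as Hev.
  pose proof (proj1 Hrate) as Hl. pose proof (proj1 Hu) as Huw.
  destruct (stability_eventually h c_star lam phi _ Hg Hh Hc Hrate Hff) as (q0 & C & Hq0 & HC & Hst).
  destruct (initial_upper_bound g kappa c_star (c_star * h) lam h phi _ w0 A mu q0 Hl Hc Hff Hh HA Hlammu Hq0) as [s1 Hs1].
  { intros t x Htt. apply IC1, Htt. }
  { exact IC2. }
  destruct (initial_lower_bound h c_star (c_star * h) lam phi _ u B sigma q0 Hg Hh Hc Hl Hev Hff Hsigma Hq0)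
    as (T2 & s2 & q2 & HT2 & Hq2 & Hs2).
  { intros t x Htt Hx. rewrite Huw by exact Htt. apply IC3; assumption. }
  (* The upper barrier starts at time 0 from the data; the lower one starts only at [T2], after the
     right state has invaded. *)
  assert (Hup0 : eventually_below u phi c_star lam 1 (s1 + 1 * (C * q0))).
  { apply (Hst u 1 0 s1 q0 Hev (or_introl eq_refl)); [lra|lra|].
    intros t x Htt. rewrite (Huw t x) by lra. apply Hs1, Htt. }
  pose proof (Hst u (-1) T2 s2 q2 Hev (or_intror eq_refl) HT2 Hq2 Hs2) as Hlow0.
  destruct (fast_front_attracts h c_star lam phi _ u _ _ Hg Hh Hc Hrate Hff Hev Hup0 Hlow0) as (s0 & Hup & Hlow).
  exists s0. intros eps Heps. destruct (Hup eps Heps) as [T3 HT3]. destruct (Hlow eps Heps) as [T4 HT4].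
  exists (Rmax T3 T4). intros t Htt x.
  pose proof (Rmax_l T3 T4). pose proof (Rmax_r T3 T4).
  specialize (HT3 t ltac:(lra) x). specialize (HT4 t ltac:(lra) x).
  pose proof (eta_pos lam (x + c_star * t)) as He.
  apply Rmult_le_reg_r with (eta lam (x + c_star * t)); [exact He|].
  unfold Rdiv. rewrite Rmult_assoc, Rinv_l, Rmult_1_r by lra. apply Rabs_le. lra.
Qed.
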